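(* Let $(X,d)$ be a compact extended Ptolemy metric space which contains at least three points. If any three points of $X$ lie on a circle in $X$, then $(X,d)$ is Möbius equivalent to $(S^n,d_0)$ for some $n\in\mathbb{N}$ (with $n\ge 1$), where $d_0$ is the chordal metric on $S^n$.
   Context: An extended metric on a set $X$ (with at least two points) is a map $d:X\times X\to[0,\infty]$ such that there is a subset $\Omega(d)\subset X$ with at most one element, $d$ restricted to $X\setminus\Omega(d)$ is a metric with finite values, $d(x,\omega)=\infty$ for $x\in X\setminus\Omega(d)$, $\omega\in\Omega(d)$, and $d(\omega,\omega)=0$; the point $\omega\in\Omega(d)$ (if it exists) is called the remote point, often written $\infty$. The topology on $X$ has as basis the open balls $B_r(x)$ around points $x\in X\setminus\Omega(d)$ together with the complements of closed balls $\overline B_r(x)$; compactness refers to this topology. Products and sums involving $\infty$ use the standard conventions: in a product-of-distances expression in which a single point equals $\infty$, every factor involving $\infty$ is cancelled (e.g. $d(x,z)d(y,\infty)=d(x,y)d(z,\infty)+d(x,\infty)d(y,z)$ means $d(x,z)=d(x,y)+d(y,z)$). A quadruple $(x,y,z,w)\in X^4$ is admissible if no entry occurs three or four times; its cross ratio triple is $\mathrm{crt}(x,y,z,w)=(d(x,y)d(z,w):d(x,z)d(y,w):d(x,w)d(y,z))\in\mathbb{R}P^2$, with the conventions $\mathrm{crt}(x,y,z,\infty)=(d(x,y):d(x,z):d(y,z))$ and $\mathrm{crt}(x,y,\infty,\infty)=(0:1:1)$ (and analogously for other positions of $\infty$). A map $f$ between extended metric spaces is Möbius if it is injective and preserves $\mathrm{crt}$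 of all admissible quadruples; two extended metric spaces are Möbius equivalent if there is a bijective Möbius map between them. $(X,d)$ is Ptolemy if $d(x,y)d(z,w)\le d(x,z)d(y,w)+d(x,w)d(y,z)$ for all quadruples of points (equivalently, for every admissible quadruple the three entries of $\mathrm{crt}$ satisfy the triangle inequality). A circle in $X$ is a subset $\sigma\subset X$ homeomorphic to $S^1$ such that for any four distinct points $x,y,z,w\in\sigma$ with $y$ and $w$ in different components of $\sigma\setminus\{x,z\}$ one has $d(x,z)d(y,w)=d(x,y)d(z,w)+d(x,w)d(y,z)$. The chordal metric $d_0$ on $S^n\subset\mathbb{R}^{n+1}$ is the restriction of the Euclidean metric of $\mathbb{R}^{n+1}$. *)

(* Defs.v *)
From Stdlib Require Import Reals.
From Coquelicot Require Import Rbar.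
Open Scope R_scope.

(* An extended metric d on X with set of remote points Om (at most one point). *)
Definition ext_metric {X : Type} (d : X -> X -> Rbar) (Om : X -> Prop) : Prop :=
  (forall a b, Om a -> Om b -> a = b) /\
  (forall x y, ~ Om x -> ~ Om y -> exists r : R, d x y = Finite r) /\
  (forall x y, ~ Om x -> ~ Om y -> 0 <= real (d x y)) /\
  (forall x y, ~ Om x -> ~ Om y -> (real (d x y) = 0 <-> x = y)) /\
  (forall x y, ~ Om x -> ~ Om y -> real (d x y) = real (d y x)) /\
  (forall x y z, ~ Om x -> ~ Om y -> ~ Om z ->
      real (d x z) <= real (d x y) + real (d y z)) /\
  (forall x w, ~ Om x -> Om w -> d x w = p_infty /\ d w x = p_infty) /\
  (forall w, Om w -> d w w = Finite 0).

(* Factor used in products of distances, implementing the convention that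
   every factor involving the remote point is cancelled (replaced by 1),
   while d(oo,oo) = 0. *)
Definition pf {X : Type} (d : X -> X -> Rbar) (a b : X) : R :=
  match d a b with
  | Finite r => r
  | p_infty => 1
  | m_infty => 0
  end.

Definition is_open {X : Type} (d : X -> X -> Rbar) (Om : X -> Prop)
    (U : X -> Prop) : Prop :=
  forall p, U p -> exists (x : X) (r : R), ~ Om x /\
    ((Rbar_lt (d x p) (Finite r) /\ forall y, Rbar_lt (d x y) (Finite r) -> U y) \/
     (Rbar_lt (Finite r) (d x p) /\ forall y, Rbar_lt (Finite r) (d x y) -> U y)).

Definition is_compact {X : Type} (d : X -> X -> Rbar) (Om : X -> Prop) : Prop :=
  forall (I : Type) (U : I -> X -> Prop),
    (forall i, is_open d Om (U i)) ->
    (forall x, exists i, U i x) ->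
    exists l : list I, forall x, exists i, List.In i l /\ U i x.

Definition connected_subset {X : Type} (d : X -> X -> Rbar) (Om : X -> Prop)
    (C : X -> Prop) : Prop :=
  ~ exists U V : X -> Prop,
      is_open d Om U /\ is_open d Om V /\
      (forall p, C p -> U p \/ V p) /\
      (exists p, C p /\ U p) /\ (exists p, C p /\ V p) /\
      (forall p, C p -> U p -> V p -> False).

Definition diff_components {X : Type} (d : X -> X -> Rbar) (Om : X -> Prop)
    (A : X -> Prop) (y w : X) : Prop :=
  A y /\ A w /\
  ~ exists C : X -> Prop,
      (forall p, C p -> A p) /\ C y /\ C w /\ connected_subset d Om C.

Definition sphere_pt (n : nat) (v : nat -> R) : Prop :=
  (forall i, (n < i)%nat -> v i = 0) /\ sum_f_R0 (fun i => v i ^ 2) n = 1.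

Definition Sphere (n : nat) : Type := { v : nat -> R | sphere_pt n v }.

Definition d0 (n : nat) (p q : Sphere n) : Rbar :=
  Finite (sqrt (sum_f_R0 (fun i => (proj1_sig p i - proj1_sig q i) ^ 2) n)).

Definition noOm {Y : Type} : Y -> Prop := fun _ => False.

Definition homeo_S1_onto {X : Type} (d : X -> X -> Rbar) (Om : X -> Prop)
    (sigma : X -> Prop) (h : Sphere 1 -> X) : Prop :=
  (forall p q, h p = h q -> p = q) /\
  (forall x, sigma x <-> exists p, h p = x) /\
  (forall U, is_open d Om U -> is_open (d0 1) noOm (fun p => U (h p))) /\
  (forall V, is_open (d0 1) noOm V ->
     exists U, is_open d Om U /\ forall p, V p <-> U (h p)).

Definition is_circle {X : Type} (d : X -> X -> Rbar) (Om : X -> Prop)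
    (sigma : X -> Prop) : Prop :=
  (exists h : Sphere 1 -> X, homeo_S1_onto d Om sigma h) /\
  forall x y z w, sigma x -> sigma y -> sigma z -> sigma w ->
    x <> y -> x <> z -> x <> w -> y <> z -> y <> w -> z <> w ->
    diff_components d Om (fun p => sigma p /\ p <> x /\ p <> z) y w ->
    pf d x z * pf d y w = pf d x y * pf d z w + pf d x w * pf d y z.

Definition ptolemy {X : Type} (d : X -> X -> Rbar) : Prop :=
  forall x y z w, pf d x y * pf d z w <= pf d x z * pf d y w + pf d x w * pf d y z.

Definition admissible {X : Type} (x y z w : X) : Prop :=
  ~ (x = y /\ y = z) /\ ~ (x = y /\ y = w) /\
  ~ (x = z /\ z = w) /\ ~ (y = z /\ z = w).

(* a representative in R^3 of the cross ratio triple *)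
Definition crt {X : Type} (d : X -> X -> Rbar) (x y z w : X) : R * R * R :=
  (pf d x y * pf d z w, pf d x z * pf d y w, pf d x w * pf d y z).

Definition rp2_eq (a b : R * R * R) : Prop :=
  let '(a1, a2, a3) := a in let '(b1, b2, b3) := b in
  exists l : R, l <> 0 /\ a1 = l * b1 /\ a2 = l * b2 /\ a3 = l * b3.

Definition is_moebius {X Y : Type} (dX : X -> X -> Rbar) (dY : Y -> Y -> Rbar)
    (f : X -> Y) : Prop :=
  (forall a b, f a = f b -> a = b) /\
  forall x y z w, admissible x y z w ->
    rp2_eq (crt dY (f x) (f y) (f z) (f w)) (crt dX x y z w).

Definition moebius_equivalent {X Y : Type} (dX : X -> X -> Rbar)
    (dY : Y -> Y -> Rbar) : Prop :=
  exists f : X -> Y, (forall y, exists x, f x = y) /\ is_moebius dX dY f.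

(* Main.v *)
(* For a point [w], dividing [d x y] by [d x w * d y w] turns the Ptolemy inequality into a metric
   on [X \ {w}], and every circle through [w] into an isometric copy of the real line. On a line,
   the distance to a fixed point is a convex function, hence nearly differentiable at many
   parameters; read at the other end, this says that on a given circle the Busemann functions of
   the two directions at [w] cancel for most points [w]. A Baire category argument then gives one
   [w] for which this holds for a dense family of circles. Busemann functions are convex by the
   Ptolemy inequality, so cancelling ones are affine, and [X \ {w}] has enough affine functions of
   slope 1 to be a normed space, of finite dimension by compactness. A Ptolemaic norm satisfies
   |x+y|^2 + |x-y|^2 >= 4|x||y|, which by Day's argument with an ellipse of maximal area inscribed
   in the unit ball of each plane forces it to be Euclidean; stereographic projection concludes. *)

Require Import Defs.
From Stdlib Require Import Reals.
From Coquelicot Require Import Rbar.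
From Stdlib Require Import Lra Lia Psatz Arith List Cantor.
From Stdlib Require Import Classical ClassicalEpsilon IndefiniteDescription FunctionalExtensionality.
From Coquelicot Require Import Coquelicot.
From mathcomp.classical Require filter.
Open Scope R_scope.

(** * Limits along an ultrafilter *)

(** The good points [w] depend on the circle, and a category argument meets only countably many open
    conditions. So smoothness is cut into pieces: two points of a dense sequence, a finite list of
    test points, an error [e], and witnesses [p], [q] other than [w]; strict inequalities make each
    piece stable under small moves of [w]. Differentiability and Busemann functions are linked by
    one inversion. Let [p], [w], [q] be equally spaced with step [h] on a line of the metric whose
    remote point is [x]. In the metric whose remote point is [w], the excess of the triangle
    inequality for [p], [z], [q] is then the second difference at [w] of the distance to [z],
    divided by [h] and by a factor bounded below. No derivative is taken: a Lipschitz convex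
    function has some second difference of step [h] that is at most [e * h]. Busemann functions are
    limits along one fixed ultrafilter, so a single choice serves all points. The rhombus inequality
    is Ptolemy's for [x], [-x], [y], [-y]. *)

Lemma ultrafilter_nat :
  exists G : (nat -> Prop) -> Prop,
    ProperFilter G /\ (forall P, eventually P -> G P) /\
    (forall P, G P \/ G (fun n => ~ P n)).
Proof.
assert (HF : @filter.ProperFilter nat eventually).
{ apply filter.Build_ProperFilter.
  - intros [N HN]. exact (HN N (le_n N)).
  - apply filter.Build_Filter.
    + exists 0%nat. intros; exact I.
    + intros P Q HP HQ. exact (filter_and P Q HP HQ).
    + intros P Q HPQ HP. exact (filter_imp P Q HPQ HP). }
destruct (filter.ultraFilterLemma HF) as [G [HU HG]].
exists G. destruct HU as [HP HM]. split; [|split].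
- constructor.
  + intros P HGP. apply NNPP; intros Hn.
    apply (filter.filter_not_empty G).
    refine (@filter.filterS _ G (@filter.filter_filter _ G HP) P _ _ HGP).
    intros x Hx. apply Hn. now exists x.
  + constructor.
    * exact (@filter.filterT _ G (@filter.filter_filter _ G HP)).
    * intros P Q H1 H2. exact (@filter.filterI _ G (@filter.filter_filter _ G HP) P Q H1 H2).
    * intros P Q HPQ H. exact (@filter.filterS _ G (@filter.filter_filter _ G HP) P Q HPQ H).
- exact HG.
- intros P. exact (filter.in_ultra_setVsetC (F:=G) P (filter.Build_UltraFilter HP HM)).
Qed.

Definition tends (G : (nat -> Prop) -> Prop) (u : nat -> R) (l : R) : Prop :=
  forall e, 0 < e -> G (fun n => Rabs (u n - l) < e).

(** The limit is the supremum of the [r] such that [r <= u n] for almost all [n]; the ultrafilter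
    property turns the failure of a lower bound into an upper bound. Fixing [G] beforehand gives
    limits at all points of a space at once, with no diagonal extraction. *)
Lemma ultrafilter_limit (G : (nat -> Prop) -> Prop) :
  ProperFilter G -> (forall P, G P \/ G (fun n => ~ P n)) ->
  forall (u : nat -> R) (M : R), (forall n, Rabs (u n) <= M) ->
  exists l, tends G u l.
Proof.
intros PG HU u M HM.
set (E := fun r => G (fun n => r <= u n)).
destruct (completeness E) as [l [Hub Hlub]].
- exists M. intros r Hr. destruct (filter_ex _ Hr) as [n Hn].
  specialize (HM n). apply Rabs_le_between in HM. lra.
- exists (- M). unfold E. apply filter_forall. intros n.
  specialize (HM n). apply Rabs_le_between in HM. lra.
- exists l. intros e He.
  assert (H1 : G (fun n => l - e / 2 <= u n)).
  { apply NNPP; intros Hn.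
    assert (l <= l - e / 2); [|lra]. apply Hlub. intros r Hr.
    apply Rnot_lt_le; intros Hlt. apply Hn. unfold E in Hr.
    refine (filter_imp _ _ _ Hr). intros; lra. }
  assert (H2 : G (fun n => ~ l + e / 2 <= u n)).
  { destruct (HU (fun n => l + e / 2 <= u n)) as [H|H]; [|exact H].
    exfalso. specialize (Hub _ H). lra. }
  generalize (filter_and _ _ H1 H2). apply filter_imp. intros n [Ha Hb].
  apply Rabs_def1; lra.
Qed.

Lemma tends_const G c : ProperFilter G -> tends G (fun _ => c) c.
Proof.
intros PG e He. apply filter_forall. intros _. rewrite Rminus_diag, Rabs_R0. exact He.
Qed.

Lemma tends_plus G u v l m : ProperFilter G ->
  tends G u l -> tends G v m -> tends G (fun n => u n + v n) (l + m).
Proof.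
intros PG Hu Hv e He.
assert (He2 : 0 < e / 2) by lra.
generalize (filter_and _ _ (Hu _ He2) (Hv _ He2)). apply filter_imp.
intros n [H1 H2]. apply Rabs_def2 in H1. apply Rabs_def2 in H2. apply Rabs_def1; lra.
Qed.

Lemma tends_mult G u v l m : ProperFilter G ->
  tends G u l -> tends G v m -> tends G (fun n => u n * v n) (l * m).
Proof.
intros PG Hu Hv e He.
set (K := Rabs l + Rabs m + 1).
assert (HK : 1 <= K) by (unfold K; pose proof (Rabs_pos l); pose proof (Rabs_pos m); lra).
set (h := Rmin 1 (e / (2 * K))).
assert (Hh : 0 < h) by (apply Rmin_glb_lt; [lra|apply Rdiv_lt_0_compat; lra]).
assert (Hh1 : h <= 1) by apply Rmin_l.
assert (Hh2 : h * K <= e / 2).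
{ apply Rle_trans with (e / (2 * K) * K).
  - apply Rmult_le_compat_r; [lra|apply Rmin_r].
  - right; field; lra. }
generalize (filter_and _ _ (Hu _ Hh) (Hv _ Hh)). apply filter_imp.
intros n [H1 H2].
replace (u n * v n - l * m) with ((u n - l) * (v n - m) + (u n - l) * m + l * (v n - m)) by ring.
eapply Rle_lt_trans; [apply Rabs_triang|].
eapply Rle_lt_trans; [apply Rplus_le_compat_r, Rabs_triang|].
rewrite !Rabs_mult. unfold K in Hh2.
pose proof (Rabs_pos l). pose proof (Rabs_pos m).
pose proof (Rabs_pos (u n - l)). pose proof (Rabs_pos (v n - m)). nra.
Qed.

Lemma tends_le G u v l m : ProperFilter G ->
  tends G u l -> tends G v m -> G (fun n => u n <= v n) -> l <= m.
Proof.
intros PG Hu Hv Huv. apply Rnot_lt_le; intros Hlt.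
assert (He : 0 < (l - m) / 2) by lra.
destruct (filter_ex _ (filter_and _ _ Huv (filter_and _ _ (Hu _ He) (Hv _ He))))
  as (n & H0 & H1 & H2).
apply Rabs_def2 in H1. apply Rabs_def2 in H2. lra.
Qed.

Lemma tends_inv_INR G : (forall P, eventually P -> G P) ->
  tends G (fun n => / INR (S n)) 0.
Proof.
intros Hev e He. apply Hev.
destruct (archimed_cor1 e He) as (n0 & Hn0 & Hn0').
exists n0. intros n Hn. rewrite Rminus_0_r.
assert (0 < / INR (S n)) by (apply Rinv_0_lt_compat, lt_0_INR; lia).
assert (/ INR (S n) <= / INR n0).
{ apply Rinv_le_contravar; [apply lt_0_INR; lia|apply le_INR; lia]. }
rewrite Rabs_pos_eq; lra.
Qed.

(** * Norms on the plane satisfying the rhombus inequality *)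

Definition plane_norm (N : R -> R -> R) : Prop :=
  (forall s t, s <> 0 \/ t <> 0 -> 0 < N s t) /\
  (forall l s t, N (l * s) (l * t) = Rabs l * N s t) /\
  (forall s t s' t', N (s + s') (t + t') <= N s t + N s' t') /\
  (forall s t s' t',
     4 * N s t * N s' t' <= N (s + s') (t + t') ^ 2 + N (s - s') (t - t') ^ 2).

(** For a positive definite form: the ellipse where it is at most 1 lies in the unit ball of [N].
    The area of this ellipse is pi over the square root of [A * C - B ^ 2], so maximal area means
    minimal determinant. *)
Definition majorizes (A B C : R) (N : R -> R -> R) : Prop :=
  forall s t, N s t ^ 2 <= A * s ^ 2 + 2 * B * s * t + C * t ^ 2.

Lemma plane_norm_zero (N : R -> R -> R) : plane_norm N -> N 0 0 = 0.
Proof.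
intros (_ & H & _). specialize (H 0 0 0). rewrite Rabs_R0, !Rmult_0_l in H. exact H.
Qed.

Lemma plane_norm_nonneg (N : R -> R -> R) s t : plane_norm N -> 0 <= N s t.
Proof.
intros HN. destruct (Req_dec s 0) as [->|Hs]; [destruct (Req_dec t 0) as [->|Ht]|].
- rewrite (plane_norm_zero N HN). lra.
- apply Rlt_le, HN. now right.
- apply Rlt_le, HN. now left.
Qed.

Lemma plane_norm_lipschitz (N : R -> R -> R) s t s' t' : plane_norm N ->
  Rabs (N s t - N s' t') <= Rabs (s - s') * N 1 0 + Rabs (t - t') * N 0 1.
Proof.
intros (_ & Hh & Ht & _).
assert (K : forall a b a' b',
  N a b - N a' b' <= Rabs (a - a') * N 1 0 + Rabs (b - b') * N 0 1).
{ intros a b a' b'.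
  assert (H1 := Ht a' b' ((a - a') * 1) ((a - a') * 0)).
  assert (H2 := Ht (a' + (a - a') * 1) (b' + (a - a') * 0) ((b - b') * 0) ((b - b') * 1)).
  rewrite Hh in H1, H2.
  replace (a' + (a - a') * 1 + (b - b') * 0) with a in H2 by ring.
  replace (b' + (a - a') * 0 + (b - b') * 1) with b in H2 by ring. lra. }
apply Rabs_le. generalize (K s t s' t') (K s' t' s t).
rewrite (Rabs_minus_sym s' s), (Rabs_minus_sym t' t). lra.
Qed.

Lemma plane_norm_line_continuous (N : R -> R -> R) a b c d : plane_norm N ->
  continuity (fun p => N (p * a + b) (p * c + d)).
Proof.
intros HN x e He.
set (K := Rabs a * N 1 0 + Rabs c * N 0 1).
assert (HK : 0 <= K).
{ unfold K. pose proof (plane_norm_nonneg N 1 0 HN). pose proof (plane_norm_nonneg N 0 1 HN).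
  pose proof (Rabs_pos a). pose proof (Rabs_pos c). nra. }
exists (e / (K + 1)). split; [apply Rdiv_lt_0_compat; lra|].
intros y [_ Hy]. simpl in *. unfold Rdist in *.
eapply Rle_lt_trans; [apply plane_norm_lipschitz, HN|].
replace (y * a + b - (x * a + b)) with ((y - x) * a) by ring.
replace (y * c + d - (x * c + d)) with ((y - x) * c) by ring.
rewrite !Rabs_mult.
replace (Rabs (y - x) * Rabs a * N 1 0 + Rabs (y - x) * Rabs c * N 0 1)
  with (Rabs (y - x) * K) by (unfold K; ring).
apply Rle_lt_trans with (e / (K + 1) * K).
- apply Rmult_le_compat_r; lra.
- apply Rmult_lt_reg_r with (K + 1); [lra|]. field_simplify; nra.
Qed.

Lemma plane_norm_change (N : R -> R -> R) a b c d : plane_norm N ->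
  a * d - b * c <> 0 -> plane_norm (fun s t => N (a * s + b * t) (c * s + d * t)).
Proof.
intros HN Hdet. pose proof HN as (Hp & Hh & Ht & Hr). split; [|split; [|split]].
- intros s t Hst. apply Hp. apply NNPP; intros Hn. apply not_or_and in Hn.
  destruct Hn as [H1 H2]. apply NNPP in H1. apply NNPP in H2.
  assert ((a * d - b * c) * s = 0).
  { replace ((a * d - b * c) * s) with (d * (a * s + b * t) - b * (c * s + d * t)) by ring.
    rewrite H1, H2; ring. }
  assert ((a * d - b * c) * t = 0).
  { replace ((a * d - b * c) * t) with (a * (c * s + d * t) - c * (a * s + b * t)) by ring.
    rewrite H1, H2; ring. }
  apply Rmult_integral in H. apply Rmult_integral in H0. tauto.
- intros l s t. rewrite <- Hh. f_equal; ring.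
- intros s t s' t'. eapply Rle_trans; [|apply Ht]. right; f_equal; ring.
- intros s t s' t'. eapply Rle_trans; [apply Hr|].
  right; f_equal; f_equal; f_equal; ring.
Qed.

(** By homogeneity it is enough to bound [N] below on the sides [s = 1] and [t = 1] of a square,
    which are compact. *)
Lemma plane_norm_lower (N : R -> R -> R) : plane_norm N ->
  exists k, 0 < k /\ forall s t, k * (s ^ 2 + t ^ 2) <= N s t ^ 2.
Proof.
intros HN. pose proof HN as (Hp & Hh & Ht & Hr).
destruct (continuity_ab_min (fun p => N (p * 0 + 1) (p * 1 + 0)) (-1) 1) as (x & Hx & _);
  [lra|intros; apply plane_norm_line_continuous, HN|].
destruct (continuity_ab_min (fun p => N (p * 1 + 0) (p * 0 + 1)) (-1) 1) as (y & Hy & _);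
  [lra|intros; apply plane_norm_line_continuous, HN|].
simpl in Hx, Hy.
set (m1 := N (x * 0 + 1) (x * 1 + 0)) in *. set (m2 := N (y * 1 + 0) (y * 0 + 1)) in *.
assert (P1 : 0 < m1) by (apply Hp; left; lra).
assert (P2 : 0 < m2) by (apply Hp; right; lra).
set (m := Rmin m1 m2).
assert (Pm : 0 < m) by (apply Rmin_glb_lt; assumption).
assert (Q1 : m <= m1) by apply Rmin_l. assert (Q2 : m <= m2) by apply Rmin_r.
assert (Key : forall s t u, s ^ 2 <= t ^ 2 -> m * Rabs t <= u -> 0 <= u ->
   m ^ 2 / 2 * (s ^ 2 + t ^ 2) <= u ^ 2).
{ intros s t u Hst Hu Hu0. assert ((m * Rabs t) ^ 2 <= u ^ 2).
  { apply pow_incr. split; [|exact Hu]. apply Rmult_le_pos; [lra|apply Rabs_pos]. }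
  rewrite Rpow_mult_distr, pow2_abs in H. nra. }
exists (m ^ 2 / 2). split; [nra|]. intros s t.
destruct (Rle_dec (s ^ 2) (t ^ 2)) as [Hc|Hc].
- apply Key; [exact Hc| |apply plane_norm_nonneg, HN].
  destruct (Req_dec t 0) as [->|Ht0]; [rewrite Rabs_R0, Rmult_0_r; apply plane_norm_nonneg, HN|].
  replace (N s t) with (Rabs t * N (s / t * 1 + 0) (s / t * 0 + 1)).
  + rewrite Rmult_comm. apply Rmult_le_compat_l; [apply Rabs_pos|].
    apply Rle_trans with m2; [exact Q2|]. apply Hy. apply Rabs_le_between.
    rewrite <- (Rabs_pos_eq 1) by lra. apply Rsqr_le_abs_0. unfold Rsqr.
    apply Rmult_le_reg_r with (t ^ 2); [nra|]. field_simplify; nra.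
  + rewrite <- Hh. f_equal; field; exact Ht0.
- apply Rnot_le_lt in Hc. rewrite (Rplus_comm (s ^ 2)).
  apply Key; [lra| |apply plane_norm_nonneg, HN].
  assert (Hs0 : s <> 0) by (intros ->; nra).
  replace (N s t) with (Rabs s * N (t / s * 0 + 1) (t / s * 1 + 0)).
  + rewrite Rmult_comm. apply Rmult_le_compat_l; [apply Rabs_pos|].
    apply Rle_trans with m1; [exact Q1|]. apply Hx. apply Rabs_le_between.
    rewrite <- (Rabs_pos_eq 1) by lra. apply Rsqr_le_abs_0. unfold Rsqr.
    apply Rmult_le_reg_r with (s ^ 2); [nra|]. field_simplify; nra.
  + rewrite <- Hh. f_equal; field; exact Hs0.
Qed.

(* [g] vanishes exactly at the contact directions; if it had a positive minimum,
   the form could be shrunk across [(x, y)] and enlarged along it. *)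
Lemma minimal_form_contact (N : R -> R -> R) : plane_norm N ->
  majorizes 1 0 1 N ->
  (forall A B C, majorizes A B C N -> 1 <= A * C - B ^ 2) ->
  forall x y, x ^ 2 + y ^ 2 = 1 ->
  exists p r, 0 < r /\ p ^ 2 + r ^ 2 = 1 /\ N (p * x - r * y) (p * y + r * x) = 1.
Proof.
intros HN Hq Hmin x y Hxy. pose proof HN as (Hp & Hh & Ht & Hr).
set (g := fun p => p ^ 2 + 1 - N (p * x + - y) (p * y + x) ^ 2).
assert (Hcont : continuity g).
{ unfold g. pose proof (plane_norm_line_continuous N x (- y) y x HN) as Hc.
  apply continuity_minus.
  - apply continuity_plus; [|apply continuity_const; intros ? ?; reflexivity].
    apply derivable_continuous, derivable_pow.
  - intros p. apply (continuity_pt_comp (fun p => N (p * x + - y) (p * y + x)) (fun u => u ^ 2)).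
    + apply Hc.
    + apply derivable_continuous, derivable_pow. }
assert (Hg0 : forall p, 0 <= g p).
{ intros p. unfold g. specialize (Hq (p * x + - y) (p * y + x)). nra. }
destruct (continuity_ab_min g (-2) 2) as (p0 & Hp0 & Hi); [lra|intros; apply Hcont|].
destruct (Req_dec (g p0) 0) as [Hz|Hz].
- set (n := sqrt (p0 ^ 2 + 1)).
  assert (Hn : 0 < n) by (apply sqrt_lt_R0; nra).
  assert (Hn2 : n ^ 2 = p0 ^ 2 + 1) by (apply pow2_sqrt; nra).
  exists (p0 / n), (1 / n). split; [apply Rdiv_lt_0_compat; lra|]. split.
  + replace ((p0 / n) ^ 2 + (1 / n) ^ 2) with ((p0 ^ 2 + 1) / n ^ 2) by (field; lra).
    rewrite Hn2. field; nra.
  + replace (p0 / n * x - 1 / n * y) with (/ n * (p0 * x + - y)) by (field; lra).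
    replace (p0 / n * y + 1 / n * x) with (/ n * (p0 * y + x)) by (field; lra).
    rewrite Hh, Rabs_pos_eq by (apply Rlt_le, Rinv_0_lt_compat, Hn).
    unfold g in Hz.
    assert (E : N (p0 * x + - y) (p0 * y + x) = n).
    { pose proof (plane_norm_nonneg N (p0 * x + - y) (p0 * y + x) HN). nra. }
    rewrite E. field; lra.
(* The form with eigenvalue [1 + ep] along [(x, y)] and [1 - 4 * ep] across it has determinant below
   1. Where [4 * r ^ 2 <= p ^ 2] it is no smaller than the old form; elsewhere [p / r] lies in the
   interval [-2, 2], where the gap [eta] outweighs [4 * ep]. *)
- exfalso. set (eta := g p0) in *.
  assert (He : 0 < eta) by (specialize (Hg0 p0); fold eta in Hg0; lra).
  assert (He1 : eta <= 1).
  { apply Rle_trans with (g 0); [apply Hp0; lra|]. unfold g.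
    pose proof (pow2_ge_0 (N (0 * x + - y) (0 * y + x))). lra. }
  set (ep := eta / 20).
  assert (K := Hmin ((1 + ep) * x ^ 2 + (1 - 4 * ep) * y ^ 2) (5 * ep * x * y)
                 ((1 + ep) * y ^ 2 + (1 - 4 * ep) * x ^ 2)).
  assert (Hm : 1 <= (1 + ep) * (1 - 4 * ep)).
  { replace ((1 + ep) * (1 - 4 * ep)) with ((1 + ep) * (1 - 4 * ep) * (x ^ 2 + y ^ 2) ^ 2)
      by (rewrite Hxy; ring).
    eapply Rle_trans; [apply K|right; ring]. clear K.
    intros s t. set (p := s * x + t * y). set (r := t * x - s * y).
    replace (((1 + ep) * x ^ 2 + (1 - 4 * ep) * y ^ 2) * s ^ 2 + 2 * (5 * ep * x * y) * s * t
      + ((1 + ep) * y ^ 2 + (1 - 4 * ep) * x ^ 2) * t ^ 2)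
      with ((1 + ep) * p ^ 2 + (1 - 4 * ep) * r ^ 2) by (unfold p, r; ring).
    assert (Es : s = p * x - r * y).
    { unfold p, r. replace ((s * x + t * y) * x - (t * x - s * y) * y)
        with (s * (x ^ 2 + y ^ 2)) by ring. rewrite Hxy; ring. }
    assert (Et : t = p * y + r * x).
    { unfold p, r. replace ((s * x + t * y) * y + (t * x - s * y) * x)
        with (t * (x ^ 2 + y ^ 2)) by ring. rewrite Hxy; ring. }
    assert (Epr : s ^ 2 + t ^ 2 = p ^ 2 + r ^ 2).
    { rewrite Es, Et. replace ((p * x - r * y) ^ 2 + (p * y + r * x) ^ 2)
        with ((p ^ 2 + r ^ 2) * (x ^ 2 + y ^ 2)) by ring. rewrite Hxy; ring. }
    destruct (Rle_dec (4 * r ^ 2) (p ^ 2)) as [Hc|Hc].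
    + specialize (Hq s t). unfold ep. nra.
    + assert (Hr0 : r <> 0) by (intros E0; rewrite E0 in Hc; nra).
      assert (Hb : -2 <= p / r <= 2).
      { apply Rabs_le_between. rewrite <- (Rabs_pos_eq 2) by lra.
        apply Rsqr_le_abs_0. unfold Rsqr.
        apply Rmult_le_reg_r with (r ^ 2); [nra|]. field_simplify; nra. }
      specialize (Hp0 (p / r) Hb). fold eta in Hp0. unfold g in Hp0.
      replace (N s t) with (Rabs r * N (p / r * x + - y) (p / r * y + x)).
      * rewrite Rpow_mult_distr, pow2_abs.
        assert (Hr2 : 0 < r ^ 2) by nra.
        assert (Hpr : p ^ 2 = (p / r) ^ 2 * r ^ 2) by (field; exact Hr0).
        set (z := p / r) in *. assert (z ^ 2 <= 4) by nra. rewrite Hpr.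
        assert (N (z * x + - y) (z * y + x) ^ 2 <= (1 + ep) * z ^ 2 + (1 - 4 * ep)).
        { unfold ep. nra. }
        nra.
      * rewrite <- Hh. rewrite Es, Et. f_equal; field; exact Hr0. }
  unfold ep in Hm. nra.
Qed.

(** * Contact directions fill the circle, and an extremal form exists *)

Lemma sin_abs_le (x : R) : Rabs (sin x) <= Rabs x.
Proof.
assert (K : forall y, 0 <= y -> Rabs (sin y) <= y).
{ intros y Hy. destruct (Rle_lt_or_eq_dec 0 y Hy) as [H|<-];
    [|rewrite sin_0, Rabs_R0; lra].
  apply Rabs_le. split; [|left; now apply sin_lt_x].
  destruct (Rle_dec y PI) as [H1|H1].
  - pose proof (sin_ge_0 y Hy H1). lra.
  - pose proof (SIN_bound y). pose proof PI2_1. lra. }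
unfold Rabs at 2. destruct (Rcase_abs x).
- rewrite <- Rabs_Ropp, <- sin_neg. apply K. lra.
- apply K. lra.
Qed.

Lemma plane_norm_circle_lipschitz (N : R -> R -> R) (a b : R) :
  plane_norm N -> N 1 0 <= 1 -> N 0 1 <= 1 ->
  Rabs (N (cos a) (sin a) - N (cos b) (sin b)) <= 2 * Rabs (a - b).
Proof.
intros HN H1 H2. eapply Rle_trans; [apply plane_norm_lipschitz, HN|].
assert (Hb : Rabs (sin ((a - b) / 2)) <= Rabs (a - b) / 2).
{ eapply Rle_trans; [apply sin_abs_le|]. unfold Rdiv. rewrite Rabs_mult.
  rewrite (Rabs_pos_eq (/ 2)) by lra. lra. }
pose proof (Rabs_pos (sin ((a - b) / 2))).
assert (Hc : Rabs (cos a - cos b) <= Rabs (a - b)).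
{ rewrite form2, !Rabs_mult, (Rabs_left (-2)) by lra.
  assert (Rabs (sin ((a + b) / 2)) <= 1) by (apply Rabs_le, SIN_bound).
  pose proof (Rabs_pos (sin ((a + b) / 2))). nra. }
assert (Hs : Rabs (sin a - sin b) <= Rabs (a - b)).
{ rewrite form4, !Rabs_mult, (Rabs_pos_eq 2) by lra.
  assert (Rabs (cos ((a + b) / 2)) <= 1) by (apply Rabs_le, COS_bound).
  pose proof (Rabs_pos (cos ((a + b) / 2))). nra. }
pose proof (plane_norm_nonneg N 1 0 HN). pose proof (plane_norm_nonneg N 0 1 HN).
pose proof (Rabs_pos (cos a - cos b)). pose proof (Rabs_pos (sin a - sin b)). nra.
Qed.

(** For contacts [u], [v] at angle [2 * h] the rhombus inequality reads
    [4 <= N (u + v) ^ 2 + N (u - v) ^ 2]. Here [u + v] is [2 * cos h] times the bisector, and the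
    last term is at most the Euclidean value [4 * sin h ^ 2]; what remains says that [N] is at least
    1 on the bisector. *)
Lemma contact_bisector (N : R -> R -> R) (a b : R) :
  plane_norm N -> majorizes 1 0 1 N -> 0 <= b - a < PI ->
  N (cos a) (sin a) = 1 -> N (cos b) (sin b) = 1 ->
  N (cos ((a + b) / 2)) (sin ((a + b) / 2)) = 1.
Proof.
intros HN Hq Hab Ha Hb. pose proof HN as (Hp & Hh & Ht & Hr).
specialize (Hr (cos a) (sin a) (cos b) (sin b)). rewrite Ha, Hb in Hr.
set (m := (a + b) / 2) in *. set (h := (b - a) / 2).
assert (Ea : a = m - h) by (unfold m, h; field).
assert (Eb : b = m + h) by (unfold m, h; field).
assert (Hqd := Hq (cos a - cos b) (sin a - sin b)).
replace (cos a + cos b) with (2 * cos h * cos m) in Hr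
  by (rewrite Ea, Eb, cos_minus, cos_plus; ring).
replace (sin a + sin b) with (2 * cos h * sin m) in Hr
  by (rewrite Ea, Eb, sin_minus, sin_plus; ring).
rewrite Hh, Rpow_mult_distr, pow2_abs in Hr.
assert (Hd : (cos a - cos b) ^ 2 + (sin a - sin b) ^ 2 = 4 * sin h ^ 2).
{ replace (cos a - cos b) with (2 * sin h * sin m)
    by (rewrite Ea, Eb, cos_minus, cos_plus; ring).
  replace (sin a - sin b) with (- (2 * sin h * cos m))
    by (rewrite Ea, Eb, sin_minus, sin_plus; ring).
  pose proof (sin2_cos2 m) as E. unfold Rsqr in E.
  replace ((2 * sin h * sin m) ^ 2 + (- (2 * sin h * cos m)) ^ 2)
    with (4 * sin h ^ 2 * (sin m * sin m + cos m * cos m)) by ring.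
  rewrite E; ring. }
assert (Hch : 0 < cos h) by (apply cos_gt_0; unfold h; lra).
pose proof (sin2_cos2 h) as Eh. unfold Rsqr in Eh.
specialize (Hq (cos m) (sin m)).
pose proof (sin2_cos2 m) as Em. unfold Rsqr in Em.
pose proof (plane_norm_nonneg N (cos m) (sin m) HN) as H0.
set (F := N (cos m) (sin m)) in *.
assert (F ^ 2 <= 1) by nra.
assert (1 <= F ^ 2).
{ apply Rmult_le_reg_l with (cos h ^ 2); nra. }
nra.
Qed.

Lemma INR_le_pow2 (n : nat) : INR n <= 2 ^ n.
Proof.
induction n as [|n IH]; [simpl; lra|]. rewrite S_INR. simpl.
assert (1 <= 2 ^ n) by (apply pow_R1_Rle; lra). lra.
Qed.

(** Repeated bisection encloses [x] between contacts whose distance tends to 0, and [N] is Lipschitz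
    in the angle. *)
Lemma contact_arc (N : R -> R -> R) (a b : R) :
  plane_norm N -> majorizes 1 0 1 N -> 0 <= b - a < PI ->
  N (cos a) (sin a) = 1 -> N (cos b) (sin b) = 1 ->
  forall x, a <= x <= b -> N (cos x) (sin x) = 1.
Proof.
intros HN Hq Hab Ha Hb x Hx.
assert (K : forall n, exists a' b', a' <= x <= b' /\ b' - a' = (b - a) / 2 ^ n /\
   N (cos a') (sin a') = 1 /\ N (cos b') (sin b') = 1).
{ induction n as [|n (a' & b' & Hx' & Hd & Ha' & Hb')].
  - exists a, b. repeat split; try tauto; simpl; lra.
  - assert (Hle : 0 <= b' - a' < PI).
    { rewrite Hd. split; [rewrite <- Hd; lra|].
      apply Rle_lt_trans with (b - a); [|lra].
      assert (1 <= 2 ^ n) by (apply pow_R1_Rle; lra).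
      apply Rmult_le_reg_r with (2 ^ n); [lra|]. field_simplify; nra. }
    pose proof (contact_bisector N a' b' HN Hq Hle Ha' Hb') as Hm.
    assert (P : 0 < 2 ^ n) by (apply pow_lt; lra).
    assert (Hd2 : (b - a) / 2 ^ S n = (b' - a') / 2) by (rewrite Hd; simpl; field; lra).
    destruct (Rle_dec x ((a' + b') / 2)) as [Hc|Hc].
    + exists a', ((a' + b') / 2). rewrite Hd2. repeat split; try tauto; lra.
    + exists ((a' + b') / 2), b'. rewrite Hd2. repeat split; try tauto; lra. }
assert (H10 : N 1 0 <= 1).
{ specialize (Hq 1 0). pose proof (plane_norm_nonneg N 1 0 HN). nra. }
assert (H01 : N 0 1 <= 1).
{ specialize (Hq 0 1). pose proof (plane_norm_nonneg N 0 1 HN). nra. }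
apply NNPP; intros Hn.
assert (He : 0 < Rabs (N (cos x) (sin x) - 1)) by (apply Rabs_pos_lt; lra).
destruct (archimed_cor1 (Rabs (N (cos x) (sin x) - 1) / (2 * (b - a) + 1))) as (n & Hn1 & Hn2).
{ apply Rdiv_lt_0_compat; lra. }
destruct (K n) as (a' & b' & Hx' & Hd & Ha' & Hb').
pose proof (plane_norm_circle_lipschitz N x a' HN H10 H01) as HL. rewrite Ha' in HL.
rewrite (Rabs_pos_eq (x - a')) in HL by lra.
pose proof (INR_le_pow2 n) as Hp.
assert (Hn0 : 0 < INR n) by (apply lt_0_INR; lia).
assert (H1 : b' - a' <= (b - a) * / INR n).
{ rewrite Hd. apply Rmult_le_compat_l; [lra|]. now apply Rinv_le_contravar. }
assert (H2 : (2 * (b - a) + 1) * / INR n < Rabs (N (cos x) (sin x) - 1)).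
{ apply Rmult_lt_compat_l with (r := 2 * (b - a) + 1) in Hn1; [|lra].
  replace ((2 * (b - a) + 1) * (Rabs (N (cos x) (sin x) - 1) / (2 * (b - a) + 1)))
    with (Rabs (N (cos x) (sin x) - 1)) in Hn1 by (field; lra). exact Hn1. }
pose proof (Rinv_0_lt_compat _ Hn0). nra.
Qed.

(** The opposite of a contact is a contact, so the angles 0, [acos p] and [PI] are contacts. They
    cut the half circle into two arcs shorter than [PI], to which [contact_arc] applies. *)
Lemma two_contacts_euclidean (N : R -> R -> R) (p r : R) :
  plane_norm N -> majorizes 1 0 1 N -> N 1 0 = 1 ->
  p ^ 2 + r ^ 2 = 1 -> 0 < r -> N p r = 1 ->
  forall s t, N s t ^ 2 = s ^ 2 + t ^ 2.
Proof.
intros HN Hq H1 Hpr Hr HpN. pose proof HN as (Hp & Hh & _ & _).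
assert (Angle : forall a b, a ^ 2 + b ^ 2 = 1 -> 0 <= b ->
  0 <= acos a <= PI /\ a = cos (acos a) /\ b = sin (acos a)).
{ intros a b Hab Hb. assert (-1 <= a <= 1) by nra.
  repeat split; try apply acos_bound.
  - now rewrite cos_acos.
  - rewrite sin_acos by assumption. symmetry. apply sqrt_lem_1; [|exact Hb|];
      unfold Rsqr; nra. }
assert (Pi := PI_RGT_0).
destruct (Angle p r Hpr ltac:(lra)) as (Hb & Ep & Er).
set (f := acos p) in *.
assert (Hf : 0 < f < PI).
{ assert (0 <> f) by (intros E; rewrite <- E, sin_0 in Er; lra).
  assert (f <> PI) by (intros E; rewrite E, sin_PI in Er; lra). lra. }
assert (HPI : N (cos PI) (sin PI) = 1).
{ rewrite cos_PI, sin_PI. replace 0 with (-1 * 0) by ring.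
  replace (-1) with (-1 * 1) at 1 by ring. rewrite Hh, H1, Rabs_left; lra. }
assert (H0 : N (cos 0) (sin 0) = 1) by (now rewrite cos_0, sin_0).
rewrite Ep, Er in HpN.
assert (All : forall x, 0 <= x <= PI -> N (cos x) (sin x) = 1).
{ intros x Hx. destruct (Rle_dec x f).
  - apply (contact_arc N 0 f); tauto || lra.
  - apply (contact_arc N f PI); tauto || lra. }
assert (Up : forall a b, a ^ 2 + b ^ 2 = 1 -> N a b = 1).
{ intros a b Hab. destruct (Rle_dec 0 b) as [Hc|Hc].
  - destruct (Angle a b Hab Hc) as (Hx & Ha & Hb'). rewrite Ha, Hb'. now apply All.
  - destruct (Angle (- a) (- b)) as (Hx & Ha & Hb'); [nra|lra|].
    replace a with (-1 * - a) by ring. replace b with (-1 * - b) by ring.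
    rewrite Hh, Ha, Hb', All by assumption. rewrite Rabs_left; lra. }
intros s t. destruct (Req_dec (s ^ 2 + t ^ 2) 0) as [E|E].
- assert (Es : s = 0) by nra. assert (Et : t = 0) by nra. rewrite Es, Et, (plane_norm_zero N HN). ring.
- set (n := sqrt (s ^ 2 + t ^ 2)).
  assert (Hn : 0 < n) by (apply sqrt_lt_R0; nra).
  assert (Hn2 : n ^ 2 = s ^ 2 + t ^ 2) by (apply pow2_sqrt; nra).
  replace s with (n * (s / n)) at 1 by (field; lra).
  replace t with (n * (t / n)) at 1 by (field; lra).
  rewrite Hh, Up, Rabs_pos_eq, <- Hn2 by
    (lra || (replace ((s / n) ^ 2 + (t / n) ^ 2) with ((s ^ 2 + t ^ 2) / n ^ 2) by (field; lra);
      rewrite Hn2; field; exact E)). ring.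
Qed.

(** A majorant stays nonnegative after subtracting [k] times the Euclidean form. Hence
    [k * (A + C) - k ^ 2 <= A * C - B ^ 2], which bounds the coefficients of a minimising sequence;
    their limits along an ultrafilter give the minimum. *)
Lemma minimal_majorant (N : R -> R -> R) : plane_norm N ->
  exists A B C, 0 < A /\ 0 < A * C - B ^ 2 /\ majorizes A B C N /\
    forall A' B' C', majorizes A' B' C' N -> A * C - B ^ 2 <= A' * C' - B' ^ 2.
Proof.
intros HN. destruct (plane_norm_lower N HN) as (k & Hk & Hlow).
assert (Hdet : forall A B C, majorizes A B C N ->
   k <= A /\ k <= C /\ B ^ 2 <= (A - k) * (C - k)).
{ intros A B C Hm.
  assert (H : forall s t, 0 <= (A - k) * s ^ 2 + 2 * B * s * t + (C - k) * t ^ 2).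
  { intros s t. specialize (Hm s t). specialize (Hlow s t). nra. }
  assert (HA : k <= A) by (specialize (H 1 0); nra).
  assert (HC : k <= C) by (specialize (H 0 1); nra).
  repeat split; try assumption.
  destruct (Req_dec (A - k) 0) as [E|E].
  - rewrite E in *. specialize (H (C - k + 1) (- B)). nra.
  - specialize (H (- B) (A - k)).
    assert (0 < A - k) by lra.
    apply Rmult_le_reg_l with (A - k); nra. }
(* Determinants are negated because [completeness] provides suprema; their infimum is [- m]
   below. *)
set (E := fun x => exists A B C, majorizes A B C N /\ x = - (A * C - B ^ 2)).
assert (Hk2 : forall A B C, majorizes A B C N -> k * (A + C) - k ^ 2 <= A * C - B ^ 2).
{ intros A B C Hm. destruct (Hdet A B C Hm) as (? & ? & ?). nra. }
set (a := N 1 0). set (b := N 0 1).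
assert (Ha : 0 <= a) by apply plane_norm_nonneg, HN.
assert (Hb : 0 <= b) by apply plane_norm_nonneg, HN.
(* Some majorant exists: the square of [Rabs s * a + Rabs t * b] is at most twice the sum of the
   squares. *)
assert (H0 : majorizes (2 * a ^ 2) 0 (2 * b ^ 2) N).
{ intros s t. pose proof (plane_norm_lipschitz N s t 0 0 HN) as H.
  rewrite (plane_norm_zero N HN), !Rminus_0_r in H. fold a b in H.
  pose proof (plane_norm_nonneg N s t HN). rewrite Rabs_pos_eq in H by assumption.
  rewrite <- (pow2_abs s), <- (pow2_abs t).
  pose proof (Rabs_pos s). pose proof (Rabs_pos t).
  assert (N s t ^ 2 <= (Rabs s * a + Rabs t * b) ^ 2) by (apply pow_incr; lra).
  pose proof (pow2_ge_0 (Rabs s * a - Rabs t * b)). lra. }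
destruct (completeness E) as [m [Hub Hlub]].
- exists 0. intros x (A & B & C & Hm & ->).
  destruct (Hdet A B C Hm) as (? & ? & ?). nra.
- eexists. exists (2 * a ^ 2), 0, (2 * b ^ 2). split; [exact H0|reflexivity].
- assert (Hseq : forall n : nat, exists q : R * R * R,
     majorizes (fst (fst q)) (snd (fst q)) (snd q) N /\
     fst (fst q) * snd q - snd (fst q) ^ 2 <= - m + / INR (S n)).
  { intros n. apply NNPP; intros Hn.
    assert (Hpos : 0 < / INR (S n)) by (apply Rinv_0_lt_compat, lt_0_INR; lia).
    assert (m <= m - / INR (S n)); [|lra]. apply Hlub.
    intros x (A & B & C & Hm & ->). apply Rnot_lt_le; intros Hlt. apply Hn.
    exists (A, B, C). simpl fst; simpl snd. split; [exact Hm|lra]. }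
  destruct (functional_choice _ Hseq) as [q Hq].
  destruct ultrafilter_nat as (G & PG & Hev & HU).
  set (M := (- m + 1 + k ^ 2) / k).
  assert (Hbd : forall n, 0 <= fst (fst (q n)) /\ 0 <= snd (q n) /\
     fst (fst (q n)) + snd (q n) <= M).
  { intros n. destruct (Hq n) as [Hm Hd].
    destruct (Hdet _ _ _ Hm) as (? & ? & ?). specialize (Hk2 _ _ _ Hm).
    assert (/ INR (S n) <= 1).
    { rewrite <- Rinv_1. apply Rinv_le_contravar; [lra|]. rewrite S_INR.
      pose proof (pos_INR n). lra. }
    repeat split; try lra. unfold M. apply Rmult_le_reg_l with k; [lra|].
    replace (k * ((- m + 1 + k ^ 2) / k)) with (- m + 1 + k ^ 2) by (field; lra). lra. }
  destruct (ultrafilter_limit G PG HU (fun n => fst (fst (q n))) M) as [A HA].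
  { intros n. destruct (Hbd n) as (? & ? & ?). apply Rabs_le. lra. }
  destruct (ultrafilter_limit G PG HU (fun n => snd (q n)) M) as [C HC].
  { intros n. destruct (Hbd n) as (? & ? & ?). apply Rabs_le. lra. }
  destruct (ultrafilter_limit G PG HU (fun n => snd (fst (q n))) M) as [B HB].
  { intros n. destruct (Hbd n) as (? & ? & ?).
    destruct (Hdet _ _ _ (proj1 (Hq n))) as (? & ? & ?). apply Rabs_le.
    assert (0 <= M) by lra. assert (snd (fst (q n)) ^ 2 <= M ^ 2) by nra. split; nra. }
  assert (HM : majorizes A B C N).
  { intros s t. replace (A * s ^ 2 + 2 * B * s * t + C * t ^ 2)
      with (A * s ^ 2 + B * (2 * s * t) + C * t ^ 2) by ring.
    assert (Lc : forall u l c, tends G u l -> tends G (fun n => u n * c) (l * c))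
      by (intros; apply tends_mult; auto using tends_const).
    refine (tends_le G _ _ _ _ PG (tends_const G _ PG) (tends_plus G _ _ _ _ PG
      (tends_plus G _ _ _ _ PG (Lc _ _ _ HA) (Lc _ _ _ HB)) (Lc _ _ _ HC)) _).
    apply filter_forall. intros n. destruct (Hq n) as [Hm _]. specialize (Hm s t). lra. }
  assert (Hmin : A * C - B ^ 2 <= - m).
  { replace (A * C - B ^ 2) with (A * C + (-1) * (B * B)) by ring.
    rewrite <- (Rplus_0_r (- m)).
    refine (tends_le G _ _ _ _ PG
      (tends_plus G _ _ _ _ PG (tends_mult G _ _ _ _ PG HA HC) (tends_mult G _ _ _ _ PG
         (tends_const G (-1) PG) (tends_mult G _ _ _ _ PG HB HB)))
      (tends_plus G _ _ _ _ PG (tends_const G (- m) PG) (tends_inv_INR G Hev)) _).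
    apply filter_forall. intros n. destruct (Hq n) as [_ Hd]. lra. }
  exists A, B, C. destruct (Hdet _ _ _ HM) as (? & ? & ?). specialize (Hk2 _ _ _ HM).
  repeat split; [lra|nra|exact HM|]. intros A' B' C' HM'.
  assert (- (A' * C' - B' ^ 2) <= m) by (apply Hub; exists A', B', C'; auto). lra.
Qed.

Theorem plane_norm_quadratic (N : R -> R -> R) : plane_norm N ->
  exists A B C, forall s t, N s t ^ 2 = A * s ^ 2 + 2 * B * s * t + C * t ^ 2.
Proof.
intros HN. destruct (minimal_majorant N HN) as (A & B & C & HA & HD & Hm & Hmin).
exists A, B, C. set (a := sqrt A). set (e := sqrt (A * C - B ^ 2)).
assert (Pa : 0 < a) by (apply sqrt_lt_R0, HA).
assert (Pe : 0 < e) by (apply sqrt_lt_R0, HD).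
assert (Ea : a ^ 2 = A) by (apply pow2_sqrt; lra).
assert (Ee : e ^ 2 = A * C - B ^ 2) by (apply pow2_sqrt; lra).
(* coordinates in which the extremal form is [s ^ 2 + t ^ 2] *)
set (N1 := fun s t => N (/ a * s + - (B / (a * e)) * t) (0 * s + a / e * t)).
assert (HN1 : plane_norm N1).
{ apply plane_norm_change; [exact HN|].
  replace (/ a * (a / e) - - (B / (a * e)) * 0) with (/ e) by (field; lra).
  apply Rinv_neq_0_compat; lra. }
assert (Hinv : forall u v, N u v = N1 (a * u + B / a * v) (e / a * v)).
{ intros u v. unfold N1. f_equal; field; lra. }
assert (Hq1 : majorizes 1 0 1 N1).
{ intros s t. unfold N1. eapply Rle_trans; [apply Hm|]. right.
  assert (EC : C = (e ^ 2 + B ^ 2) / a ^ 2) by (rewrite Ee, Ea; field; lra).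
  rewrite EC, <- Ea. field. lra. }
assert (Hmin1 : forall A' B' C', majorizes A' B' C' N1 -> 1 <= A' * C' - B' ^ 2).
{ intros A' B' C' HM.
  assert (HM2 : majorizes (A' * a ^ 2) (A' * B + B' * e)
     (A' * (B / a) ^ 2 + 2 * B' * (B / a) * (e / a) + C' * (e / a) ^ 2) N).
  { intros u v. rewrite Hinv. eapply Rle_trans; [apply HM|]. right. field. lra. }
  apply Hmin in HM2. rewrite <- Ee in HM2.
  replace (A' * a ^ 2 * (A' * (B / a) ^ 2 + 2 * B' * (B / a) * (e / a) + C' * (e / a) ^ 2)
     - (A' * B + B' * e) ^ 2) with (e ^ 2 * (A' * C' - B' ^ 2)) in HM2 by (field; lra).
  apply Rmult_le_reg_l with (e ^ 2); nra. }
(* A first contact, starting from an arbitrary direction, then a second one independent of it. The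
   rotation in [N2] moves the first to [(1, 0)]. *)
destruct (minimal_form_contact N1 HN1 Hq1 Hmin1 1 0 ltac:(ring)) as (x & y & Hy & Hxy & Hc).
replace (x * 1 - y * 0) with x in Hc by ring. replace (x * 0 + y * 1) with y in Hc by ring.
destruct (minimal_form_contact N1 HN1 Hq1 Hmin1 x y Hxy) as (p & r & Hr & Hpr & Hc2).
set (N2 := fun s t => N1 (x * s + - y * t) (y * s + x * t)).
assert (HN2 : plane_norm N2) by (apply plane_norm_change; [exact HN1|nra]).
assert (HE : forall s t, N2 s t ^ 2 = s ^ 2 + t ^ 2).
{ apply (two_contacts_euclidean N2 p r); try assumption.
  - intros s t. unfold N2. eapply Rle_trans; [apply Hq1|]. right.
    replace (1 * (x * s + - y * t) ^ 2 + 2 * 0 * (x * s + - y * t) * (y * s + x * t)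
      + 1 * (y * s + x * t) ^ 2) with ((x ^ 2 + y ^ 2) * (s ^ 2 + t ^ 2)) by ring.
    rewrite Hxy. ring.
  - transitivity (N1 x y); [unfold N2; f_equal; ring|exact Hc].
  - etransitivity; [|exact Hc2]. unfold N2. f_equal; ring. }
intros u v. rewrite Hinv. set (s := a * u + B / a * v). set (t := e / a * v).
replace (N1 s t) with (N2 (x * s + y * t) (x * t - y * s)).
- rewrite HE.
  replace ((x * s + y * t) ^ 2 + (x * t - y * s) ^ 2)
    with ((x ^ 2 + y ^ 2) * (s ^ 2 + t ^ 2)) by ring.
  rewrite Hxy. unfold s, t.
  assert (EC : C = (e ^ 2 + B ^ 2) / a ^ 2) by (rewrite Ee, Ea; field; lra).
  rewrite EC, <- Ea. field. lra.
- unfold N2. f_equal.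
  + replace (x * (x * s + y * t) + - y * (x * t - y * s)) with ((x ^ 2 + y ^ 2) * s) by ring.
    rewrite Hxy; ring.
  + replace (y * (x * s + y * t) + x * (x * t - y * s)) with ((x ^ 2 + y ^ 2) * t) by ring.
    rewrite Hxy; ring.
Qed.

(** * From the rhombus inequality to an orthonormal basis *)

Section RhombusNorm.

Context {V : Type} (add : V -> V -> V) (scal : R -> V -> V) (zero : V)
  (dual : (V -> R) -> Prop) (nn : V -> R).

(* All vector identities below are checked on a separating family of functionals. *)
Hypothesis dual_add : forall f, dual f -> forall x y, f (add x y) = f x + f y.
Hypothesis dual_scal : forall f, dual f -> forall l x, f (scal l x) = l * f x.
Hypothesis dual_zero : forall f, dual f -> f zero = 0.
Hypothesis dual_sep : forall x y, (forall f, dual f -> f x = f y) -> x = y.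

Hypothesis nn_pos : forall x, x <> zero -> 0 < nn x.
Hypothesis nn_scal : forall l x, nn (scal l x) = Rabs l * nn x.
Hypothesis nn_add : forall x y, nn (add x y) <= nn x + nn y.

Let sub x y := add x (scal (-1) y).

Hypothesis nn_rhombus : forall x y,
  4 * nn x * nn y <= nn (add x y) ^ 2 + nn (sub x y) ^ 2.

Ltac vec := apply dual_sep; let f := fresh "f" in let Hf := fresh "Hf" in
  intros f Hf; unfold sub;
  repeat (rewrite (dual_add f Hf) || rewrite (dual_scal f Hf) || rewrite (dual_zero f Hf)).

Lemma nn_zero : nn zero = 0.
Proof.
replace zero with (scal 0 zero) by (vec; ring). rewrite nn_scal, Rabs_R0. ring.
Qed.

(** Independent [x] and [y] give a plane norm. For dependent ones positivity fails, but all
    combinations are multiples of one vector. *)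
Lemma nn_comb_quadratic x y : exists A B C, forall s t,
  nn (add (scal s x) (scal t y)) ^ 2 = A * s ^ 2 + 2 * B * s * t + C * t ^ 2.
Proof.
destruct (classic (exists s t, (s <> 0 \/ t <> 0) /\ add (scal s x) (scal t y) = zero))
  as [(s0 & t0 & Hst & E)|Hi].
- assert (E' : forall f, dual f -> s0 * f x + t0 * f y = 0).
  { intros f Hf. rewrite <- (dual_zero f Hf), <- E, (dual_add f Hf), !(dual_scal f Hf). ring. }
  destruct Hst as [H|H].
  + exists ((t0 / s0) ^ 2 * nn y ^ 2), (- (t0 / s0) * nn y ^ 2), (nn y ^ 2). intros s t.
    replace (add (scal s x) (scal t y)) with (scal (t - s * (t0 / s0)) y).
    * rewrite nn_scal, Rpow_mult_distr, pow2_abs. ring.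
    * vec. replace (f x) with (- (t0 * f y) / s0); [field; exact H|].
      specialize (E' f Hf). replace (- (t0 * f y)) with (s0 * f x) by lra. field; exact H.
  + exists (nn x ^ 2), (- (s0 / t0) * nn x ^ 2), ((s0 / t0) ^ 2 * nn x ^ 2). intros s t.
    replace (add (scal s x) (scal t y)) with (scal (s - t * (s0 / t0)) x).
    * rewrite nn_scal, Rpow_mult_distr, pow2_abs. ring.
    * vec. replace (f y) with (- (s0 * f x) / t0); [field; exact H|].
      specialize (E' f Hf). replace (- (s0 * f x)) with (t0 * f y) by lra. field; exact H.
- apply (plane_norm_quadratic (fun s t => nn (add (scal s x) (scal t y)))).
  split; [|split; [|split]].
  + intros s t Hst. apply nn_pos. intros E. apply Hi. now exists s, t.
  + intros l s t. rewrite <- nn_scal. f_equal. vec. ring.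
  + intros s t s' t'. eapply Rle_trans; [|apply nn_add]. right. f_equal. vec. ring.
  + intros s t s' t'. eapply Rle_trans; [apply nn_rhombus|]. right.
    f_equal; f_equal; f_equal; vec; ring.
Qed.

Let Q x := nn x ^ 2.

Lemma parallelogram x y : Q (add x y) + Q (sub x y) = 2 * Q x + 2 * Q y.
Proof.
destruct (nn_comb_quadratic x y) as (A & B & C & H).
assert (K : forall z s t, z = add (scal s x) (scal t y) ->
   Q z = A * s ^ 2 + 2 * B * s * t + C * t ^ 2) by (intros z s t ->; apply H).
rewrite (K (add x y) 1 1), (K (sub x y) 1 (-1)), (K x 1 0), (K y 0 1) by (vec; ring). ring.
Qed.

Let inner x y := (Q (add x y) - Q (sub x y)) / 4.

Lemma Q_opp x y : (forall f, dual f -> f x = - f y) -> Q x = Q y.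
Proof.
intros H. unfold Q. replace x with (scal (-1) y).
- rewrite nn_scal, Rabs_left by lra. ring.
- vec. rewrite (H f Hf). ring.
Qed.

Lemma inner_sym x y : inner x y = inner y x.
Proof.
unfold inner. rewrite (Q_opp (sub x y) (sub y x)).
- replace (add x y) with (add y x) by (vec; ring). reflexivity.
- intros f Hf. unfold sub. rewrite !(dual_add f Hf), !(dual_scal f Hf). ring.
Qed.

(** Homogeneity for real scalars is read off the quadratic form on the span of [x] and [y]; this
    replaces the passage from rational to real scalars in the Jordan-von Neumann theorem. *)
Lemma inner_scal l x y : inner (scal l x) y = l * inner x y.
Proof.
destruct (nn_comb_quadratic x y) as (A & B & C & H).
assert (K : forall z s t, z = add (scal s x) (scal t y) ->
   Q z = A * s ^ 2 + 2 * B * s * t + C * t ^ 2) by (intros z s t ->; apply H).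
unfold inner. rewrite (K (add (scal l x) y) l 1), (K (sub (scal l x) y) l (-1)),
  (K (add x y) 1 1), (K (sub x y) 1 (-1)) by (vec; ring). field.
Qed.

(** The Jordan-von Neumann computation: an alternating sum of four instances of the parallelogram
    law. *)
Lemma inner_add x y z : inner (add x y) z = inner x z + inner y z.
Proof.
pose proof (parallelogram (add x z) y) as H1. pose proof (parallelogram (sub x z) y) as H2.
pose proof (parallelogram (add y z) x) as H3. pose proof (parallelogram (sub y z) x) as H4.
replace (add (add x z) y) with (add (add x y) z) in H1 by (vec; ring).
replace (add (sub x z) y) with (sub (add x y) z) in H2 by (vec; ring).
replace (add (add y z) x) with (add (add x y) z) in H3 by (vec; ring).
replace (add (sub y z) x) with (sub (add x y) z) in H4 by (vec; ring).
assert (E1 : Q (sub (add x z) y) = Q (sub (sub y z) x)).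
{ apply Q_opp. intros f Hf. unfold sub.
  repeat (rewrite (dual_add f Hf) || rewrite (dual_scal f Hf)). ring. }
assert (E2 : Q (sub (sub x z) y) = Q (sub (add y z) x)).
{ apply Q_opp. intros f Hf. unfold sub.
  repeat (rewrite (dual_add f Hf) || rewrite (dual_scal f Hf)). ring. }
unfold inner. lra.
Qed.

Lemma inner_self x : inner x x = Q x.
Proof.
unfold inner. replace (add x x) with (scal 2 x) by (vec; ring).
replace (sub x x) with (scal 0 x) by (vec; ring).
unfold Q. rewrite !nn_scal, Rabs_R0, Rabs_pos_eq by lra. field.
Qed.

Lemma inner_zero x : inner zero x = 0.
Proof.
replace zero with (scal 0 zero) by (vec; ring). rewrite inner_scal. ring.
Qed.

Lemma inner_sub x y z : inner (sub x y) z = inner x z - inner y z.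
Proof.
unfold sub. rewrite inner_add, inner_scal. ring.
Qed.

Fixpoint lincomb (k : nat) (u : nat -> V) (a : nat -> R) : V :=
  match k with
  | O => zero
  | S k => add (lincomb k u a) (scal (a k) (u k))
  end.

Let orthonormal (k : nat) (u : nat -> V) : Prop :=
  forall i j, (i < k)%nat -> (j < k)%nat -> inner (u i) (u j) = if Nat.eq_dec i j then 1 else 0.

Lemma inner_lincomb k u a z :
  inner (lincomb (S k) u a) z = sum_f_R0 (fun i => a i * inner (u i) z) k.
Proof.
induction k as [|k IH].
- simpl. rewrite inner_add, inner_scal, inner_zero. ring.
- change (lincomb (S (S k)) u a) with (add (lincomb (S k) u a) (scal (a (S k)) (u (S k)))).
  rewrite inner_add, inner_scal, IH. reflexivity.
Qed.

Lemma inner_lincomb_orthonormal k u a j : orthonormal k u -> (j < k)%nat ->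
  inner (lincomb k u a) (u j) = a j.
Proof.
intros Hu Hj.
assert (H : forall l, (l <= k)%nat ->
  inner (lincomb l u a) (u j) = if lt_dec j l then a j else 0).
{ induction l as [|l IH]; intros Hl.
  - simpl. rewrite inner_zero. destruct (lt_dec j 0); [lia|reflexivity].
  - simpl. rewrite inner_add, inner_scal, IH, Hu by lia.
    destruct (Nat.eq_dec l j), (lt_dec j l), (lt_dec j (S l)); try lia; subst; ring. }
rewrite H by lia. destruct (lt_dec j k); [reflexivity|lia].
Qed.

Lemma orthonormal_extend k u : orthonormal k u ->
  (exists z, z <> lincomb k u (fun i => inner (u i) z)) ->
  exists u', orthonormal (S k) u'.
Proof.
intros Hu [z Hz]. set (p := lincomb k u (fun i => inner (u i) z)) in *.
set (w := sub z p).
assert (Hw : 0 < nn w).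
{ apply nn_pos. intros E. apply Hz. apply dual_sep. intros f Hf.
  assert (E2 : f w = f zero) by now rewrite E. revert E2. unfold w, sub.
  rewrite (dual_add f Hf), (dual_scal f Hf), (dual_zero f Hf). lra. }
assert (Ho : forall j, (j < k)%nat -> inner w (u j) = 0).
{ intros j Hj. unfold w, p. rewrite inner_sub, inner_lincomb_orthonormal by assumption.
  rewrite (inner_sym (u j)). ring. }
assert (Hs : inner (scal (/ nn w) w) (scal (/ nn w) w) = 1).
{ rewrite inner_scal, inner_sym, inner_scal, inner_self. unfold Q. field. lra. }
exists (fun i => if lt_dec i k then u i else scal (/ nn w) w).
intros i j Hi Hj. destruct (lt_dec i k) as [Hik|Hik]; destruct (lt_dec j k) as [Hjk|Hjk].
- now apply Hu.
- rewrite inner_sym, inner_scal, Ho by assumption.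
  destruct (Nat.eq_dec i j); [lia|ring].
- rewrite inner_scal, Ho by assumption. destruct (Nat.eq_dec i j); [lia|ring].
- rewrite Hs. destruct (Nat.eq_dec i j); [reflexivity|lia].
Qed.

(** The number [M] encodes finite dimension: orthonormal vectors are at mutual distance sqrt 2, so
    no orthonormal family has [M] members. A maximal one spans, and inner products with it are the
    coordinates. *)
Theorem rhombus_norm_euclidean (M : nat) :
  (forall u : nat -> V, (forall i, (i < M)%nat -> nn (u i) = 1) ->
     exists i j, (i < j)%nat /\ (j < M)%nat /\ nn (sub (u i) (u j)) < 1) ->
  (exists x, x <> zero) ->
  exists (m : nat) (c : nat -> V -> R),
    (forall x y, nn (sub x y) ^ 2 = sum_f_R0 (fun i => (c i x - c i y) ^ 2) m) /\
    (forall a : nat -> R, exists x, forall i, (i <= m)%nat -> c i x = a i).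
Proof.
intros HM [x0 Hx0].
assert (Hno : forall u, ~ orthonormal M u).
{ intros u Hu.
  assert (Hn : forall i, (i < M)%nat -> Q (u i) = 1).
  { intros i Hi. rewrite <- inner_self, Hu by assumption.
    destruct (Nat.eq_dec i i); [reflexivity|lia]. }
  destruct (HM u) as (i & j & Hij & Hj & Hd).
  - intros i Hi. specialize (Hn i Hi). unfold Q in Hn.
    destruct (classic (u i = zero)) as [E|E]; [rewrite E, nn_zero in Hn; lra|].
    apply nn_pos in E. nra.
  - assert (E : Q (sub (u i) (u j)) = 2).
    { rewrite <- inner_self, inner_sub, !(inner_sym _ (sub _ _)), !inner_sub, !inner_self.
      rewrite !Hn, !Hu by lia.
      destruct (Nat.eq_dec i j), (Nat.eq_dec j i); try lia; ring. }
    unfold Q in E. destruct (classic (sub (u i) (u j) = zero)) as [E1|E1].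
    + rewrite E1, nn_zero in E. lra.
    + apply nn_pos in E1. nra. }
assert (Hmax : exists k, (exists u, orthonormal k u) /\ forall u, ~ orthonormal (S k) u).
{ apply NNPP; intros Hn.
  assert (H : forall k, exists u, orthonormal k u).
  { induction k as [|k IH].
    - exists (fun _ => zero). intros i j Hi; lia.
    - apply NNPP; intros Hk. apply Hn. exists k. split; [exact IH|].
      intros u Hu. apply Hk. now exists u. }
  destruct (H M) as [u Hu]. exact (Hno u Hu). }
destruct Hmax as (k & [u Hu] & Hk).
assert (Hspan : forall z, z = lincomb k u (fun i => inner (u i) z)).
{ intros z. apply NNPP; intros Hz.
  destruct (orthonormal_extend k u Hu) as [u' Hu']; [now exists z|]. exact (Hk u' Hu'). }
(* [m] is the dimension minus one, since [sum_f_R0] up to [m] has [m + 1] terms; dimension 0 is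
   excluded by [x0]. *)
destruct k as [|m]; [now elim Hx0|].
exists m, (fun i => inner (u i)). split.
- intros x y. change (Q (sub x y) = sum_f_R0 (fun i => (inner (u i) x - inner (u i) y) ^ 2) m).
  rewrite <- inner_self. rewrite (Hspan (sub x y)) at 1. rewrite inner_lincomb.
  apply sum_eq. intros i _. rewrite (inner_sym (u i) (sub x y)), inner_sub.
  rewrite !(inner_sym _ (u i)). ring.
- intros a. exists (lincomb (S m) u a). intros i Hi.
  rewrite inner_sym. apply inner_lincomb_orthonormal; [exact Hu|lia].
Qed.

End RhombusNorm.

(** * Smooth points of a Ptolemaic space and affine functions *)

(* The metric in the Moebius class of [del] that has [c] as its remote point. *)
Definition rho {X : Type} (del : X -> X -> R) (c a b : X) : R :=
  del a b / (del a c * del b c).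

Definition ptolemaic {X : Type} (del : X -> X -> R) : Prop :=
  (forall x, del x x = 0) /\
  (forall x y, x <> y -> 0 < del x y) /\
  (forall x y, del x y = del y x) /\
  (forall x y z, del x z <= del x y + del y z) /\
  (forall x y z w, del x y * del z w <= del x z * del y w + del x w * del y z).

Definition line {X : Type} (del : X -> X -> R) (c : X) (L : R -> X) : Prop :=
  (forall s, L s <> c) /\ (forall s t, rho del c (L s) (L t) = Rabs (s - t)).

Definition has_lines {X : Type} (del : X -> X -> R) : Prop :=
  forall a b c, a <> b -> a <> c -> b <> c ->
    exists L, line del c L /\ L 0 = a /\ L (rho del c a b) = b.

Definition metric_open {X : Type} (del : X -> X -> R) (U : X -> Prop) : Prop :=
  forall p, U p -> exists r, 0 < r /\ forall y, del y p < r -> U y.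

Definition metric_compact {X : Type} (del : X -> X -> R) : Prop :=
  forall (I : Type) (U : I -> X -> Prop),
    (forall i, metric_open del (U i)) -> (forall x, exists i, U i x) ->
    exists l : list I, forall x, exists i, In i l /\ U i x.

Lemma pigeonhole {A : Type} (l : list A) (P : nat -> A -> Prop) :
  (forall i, exists y, In y l /\ P i y) ->
  exists i j y, (i < j)%nat /\ (j < S (length l))%nat /\ P i y /\ P j y.
Proof.
intros H. destruct (functional_choice _ H) as [g Hg]. apply NNPP; intros Hn.
assert (Hinj : forall i j, (i < j)%nat -> (j < S (length l))%nat -> g i <> g j).
{ intros i j Hij Hj E. apply Hn. exists i, j, (g i). repeat split; auto; [apply Hg|].
  rewrite E. apply Hg. }
assert (Hnd : NoDup (map g (seq 0 (S (length l))))).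
{ apply (NoDup_nth _ (g 0%nat)). intros i j Hi Hj.
  rewrite length_map, length_seq in Hi, Hj. rewrite !map_nth, !seq_nth by assumption. simpl.
  intros E. destruct (Nat.lt_trichotomy i j) as [Hc|[Hc|Hc]]; [|exact Hc|];
    [apply Hinj in Hc|apply Hinj in Hc]; congruence || lia. }
apply (NoDup_incl_length (l' := l)) in Hnd.
- rewrite length_map, length_seq in Hnd. lia.
- intros y Hy. apply in_map_iff in Hy. destruct Hy as (k & <- & _). apply Hg.
Qed.

(** The sum [F] over [l] is convex with a Lipschitz constant [M], and convexity bounds each second
    difference by that of [F]. If those of [F] exceeded [e * h] all along a grid of step [h], the
    slope of [F] would grow by at least [k * e] in [k] steps, against the bound [2 * M]. *)
Lemma small_second_difference {A : Type} (f : A -> R -> R) (l : list A) (eta e : R) :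
  0 < eta -> 0 < e ->
  (forall z s t, In z l -> Rabs (f z s - f z t) <= Rabs (s - t)) ->
  (forall z t h, In z l -> 0 <= h -> 2 * f z t <= f z (t + h) + f z (t - h)) ->
  exists t h, 0 < h /\ h <= t /\ t + h < eta /\
    forall z, In z l -> f z (t + h) + f z (t - h) - 2 * f z t <= e * h.
Proof.
intros Heta He Hlip Hconv.
assert (HF : exists F M, 0 <= M /\ (forall s t, Rabs (F s - F t) <= M * Rabs (s - t)) /\
   forall t h, 0 <= h -> 0 <= F (t + h) + F (t - h) - 2 * F t /\
     forall z, In z l -> f z (t + h) + f z (t - h) - 2 * f z t <= F (t + h) + F (t - h) - 2 * F t).
{ induction l as [|z l IH].
  - exists (fun _ => 0), 0. split; [lra|]. split.
    + intros s t. rewrite Rminus_diag, Rabs_R0. lra.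
    + intros t h Hh. split; [lra|intros z []].
  - destruct IH as (F & M & HM & H1 & H2).
    + intros; apply Hlip; now right.
    + intros; apply Hconv; [now right|assumption].
    + exists (fun t => F t + f z t), (M + 1). split; [lra|]. split.
      * intros s t. replace (F s + f z s - (F t + f z t)) with ((F s - F t) + (f z s - f z t)) by ring.
        eapply Rle_trans; [apply Rabs_triang|].
        specialize (H1 s t). specialize (Hlip z s t (or_introl eq_refl)). lra.
      * intros t h Hh. destruct (H2 t h Hh) as [H3 H4].
        specialize (Hconv z t h (or_introl eq_refl) Hh). split; [lra|].
        intros z' [<-|Hz]; [lra|]. specialize (H4 z' Hz). lra. }
destruct HF as (F & M & HM & HF1 & HF2).
destruct (INR_unbounded (2 * M / e)) as [k Hk].
(* With [k + 2] steps, the grid points [(j + 1) * h] for [j < k] have both neighbours in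
   [[0, eta)]. *)
set (h := eta / (INR k + 2)).
pose proof (pos_INR k) as Hk0.
assert (Hh : 0 < h) by (apply Rdiv_lt_0_compat; lra).
assert (Hhk : (INR k + 2) * h = eta) by (unfold h; field; lra).
apply NNPP; intros Hn.
assert (Hbig : forall t, h <= t -> t + h < eta -> e * h < F (t + h) + F (t - h) - 2 * F t).
{ intros t H1 H2. apply Rnot_le_lt; intros Hc. apply Hn. exists t, h.
  repeat split; try assumption. intros z Hz.
  destruct (HF2 t h) as [_ H]; [lra|]. specialize (H z Hz). lra. }
assert (Hind : forall j, (j <= k)%nat ->
  F h - F 0 + INR j * (e * h) <= F ((INR j + 1) * h) - F (INR j * h)).
{ induction j as [|j IH]; intros Hj.
  - simpl. rewrite !Rmult_0_l, Rplus_0_l, Rmult_1_l. lra.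
  - assert (INR (S j) <= INR k) by (apply le_INR; lia). rewrite S_INR in *.
    specialize (IH ltac:(lia)). pose proof (pos_INR j).
    specialize (Hbig ((INR j + 1) * h) ltac:(nra) ltac:(nra)).
    replace ((INR j + 1) * h + h) with ((INR j + 1 + 1) * h) in Hbig by ring.
    replace ((INR j + 1) * h - h) with (INR j * h) in Hbig by ring. lra. }
specialize (Hind k (le_n k)).
pose proof (HF1 h 0) as B1. pose proof (HF1 ((INR k + 1) * h) (INR k * h)) as B2.
rewrite Rminus_0_r, (Rabs_pos_eq h) in B1 by lra.
replace ((INR k + 1) * h - INR k * h) with h in B2 by ring.
rewrite (Rabs_pos_eq h) in B2 by lra.
apply Rabs_le_between in B1. apply Rabs_le_between in B2.
assert (H1 : INR k * (e * h) <= 2 * M * h) by lra.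
assert (H2 : 2 * M < INR k * e).
{ apply Rmult_lt_compat_r with (r := e) in Hk; [|exact He].
  replace (2 * M / e * e) with (2 * M) in Hk by (field; lra). exact Hk. }
nra.
Qed.

Section Moebius.

Context {X : Type} (del : X -> X -> R).
Hypothesis Hdel : ptolemaic del.

Lemma del_refl x : del x x = 0. Proof. apply Hdel. Qed.
Lemma del_pos x y : x <> y -> 0 < del x y. Proof. apply Hdel. Qed.
Lemma del_sym x y : del x y = del y x. Proof. apply Hdel. Qed.
Lemma del_triangle x y z : del x z <= del x y + del y z. Proof. apply Hdel. Qed.
Lemma del_ptolemy x y z w : del x y * del z w <= del x z * del y w + del x w * del y z.
Proof. apply Hdel. Qed.

Lemma del_nonneg x y : 0 <= del x y.
Proof.
destruct (classic (x = y)) as [->|H]; [rewrite del_refl; lra|apply Rlt_le, del_pos, H].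
Qed.

Lemma rho_sym c a b : rho del c a b = rho del c b a.
Proof. unfold rho. rewrite (del_sym a b), Rmult_comm. reflexivity. Qed.

Lemma rho_refl c a : rho del c a a = 0.
Proof. unfold rho. rewrite del_refl. apply Rmult_0_l. Qed.

Lemma rho_pos c a b : a <> c -> b <> c -> a <> b -> 0 < rho del c a b.
Proof.
intros. apply Rdiv_lt_0_compat; [|apply Rmult_lt_0_compat]; now apply del_pos.
Qed.

Lemma rho_nonneg c a b : a <> c -> b <> c -> 0 <= rho del c a b.
Proof.
intros. destruct (classic (a = b)) as [->|H']; [rewrite rho_refl; lra|].
apply Rlt_le, rho_pos; assumption.
Qed.

Lemma rho_ptolemy c x y z w : x <> c -> y <> c -> z <> c -> w <> c ->
  rho del c x y * rho del c z w <= rho del c x z * rho del c y w + rho del c x w * rho del c y z.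
Proof.
intros Hx Hy Hz Hw. unfold rho. pose proof (del_ptolemy x y z w) as H.
apply del_pos in Hx, Hy, Hz, Hw.
set (P := del x c * del y c * del z c * del w c).
assert (HP : 0 < P) by (unfold P; repeat apply Rmult_lt_0_compat; assumption).
apply Rmult_le_reg_r with P; [exact HP|].
replace (del x y / (del x c * del y c) * (del z w / (del z c * del w c)) * P)
  with (del x y * del z w) by (unfold P; field; lra).
replace ((del x z / (del x c * del z c) * (del y w / (del y c * del w c)) +
  del x w / (del x c * del w c) * (del y z / (del y c * del z c))) * P)
  with (del x z * del y w + del x w * del y z) by (unfold P; field; lra).
exact H.
Qed.

(* The triangle inequality for [rho c] is the Ptolemy inequality for a quadruple containing [c]. *)
Lemma rho_triangle c x y z : x <> c -> y <> c -> z <> c ->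
  rho del c x z <= rho del c x y + rho del c y z.
Proof.
intros Hx Hy Hz. unfold rho. pose proof (del_ptolemy x z y c) as H.
apply del_pos in Hx, Hy, Hz. rewrite (del_sym z y) in H.
set (P := del x c * del y c * del z c).
assert (HP : 0 < P) by (unfold P; repeat apply Rmult_lt_0_compat; assumption).
apply Rmult_le_reg_r with P; [exact HP|].
replace (del x z / (del x c * del z c) * P) with (del x z * del y c) by (unfold P; field; lra).
replace ((del x y / (del x c * del y c) + del y z / (del y c * del z c)) * P)
  with (del x y * del z c + del x c * del y z) by (unfold P; field; lra).
exact H.
Qed.

Lemma rho_lipschitz c x y z : x <> c -> y <> c -> z <> c ->
  Rabs (rho del c x z - rho del c y z) <= rho del c x y.
Proof.
intros Hx Hy Hz. apply Rabs_le.
pose proof (rho_triangle c x y z Hx Hy Hz). pose proof (rho_triangle c y x z Hy Hx Hz).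
rewrite (rho_sym c y x) in *. lra.
Qed.

(** This is inversion at [c']; it carries information on the lines of [rho del c] over to the metric
    in which one of their points is remote. *)
Lemma rho_change c c' a b : a <> c -> b <> c -> c' <> c -> a <> c' -> b <> c' ->
  rho del c' a b = rho del c a b / (rho del c a c' * rho del c b c' * del c' c ^ 2).
Proof.
intros H1 H2 H3 H4 H5. apply del_pos in H1, H2, H3, H4, H5. unfold rho. field. lra.
Qed.

Lemma rho_change_base c c' b : b <> c -> c' <> c -> b <> c' ->
  rho del c' c b = 1 / (rho del c b c' * del c' c ^ 2).
Proof.
intros H1 H2 H3. apply del_pos in H1, H2, H3. unfold rho.
rewrite (del_sym c b), (del_sym c c'). field. lra.
Qed.

(** It turns small parameters on a line into closeness for [del]. Since
    [del b c <= del b a + del a c], the hypothesis lets half of [del b a] be absorbed on the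
    left. *)
Lemma del_le_rho c a b : a <> c -> b <> c -> rho del c b a * del a c <= / 2 ->
  del b a <= 2 * rho del c b a * del a c ^ 2.
Proof.
intros Ha Hb H. apply del_pos in Ha, Hb.
assert (E : del b a = rho del c b a * del a c * del b c) by (unfold rho; field; lra).
pose proof (del_triangle b a c). pose proof (del_nonneg b a).
assert (del b a <= rho del c b a * del a c * (del b a + del a c)).
{ rewrite E at 1. apply Rmult_le_compat_l; [|lra].
  unfold rho. apply Rmult_le_pos; [|lra]. apply Rmult_le_pos; [lra|].
  apply Rlt_le, Rinv_0_lt_compat. nra. }
nra.
Qed.

(** Closed balls are used because they are what [baire] nests. *)
Definition near (w : X) (P : X -> Prop) : Prop :=
  exists r, 0 < r /\ forall w', del w' w <= r -> P w'.

Lemma near_and w P Q : near w P -> near w Q -> near w (fun w' => P w' /\ Q w').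
Proof.
intros (r & Hr & HP) (r' & Hr' & HQ). exists (Rmin r r'). split; [now apply Rmin_glb_lt|].
intros w' Hw. split; [apply HP|apply HQ]; eapply Rle_trans; try exact Hw;
  [apply Rmin_l|apply Rmin_r].
Qed.

Lemma near_imp w P Q : (forall w', P w' -> Q w') -> near w P -> near w Q.
Proof. intros H (r & Hr & HP). exists r. auto. Qed.

Lemma near_forall {A : Type} w (l : list A) (P : A -> X -> Prop) :
  (forall z, In z l -> near w (P z)) -> near w (fun w' => forall z, In z l -> P z w').
Proof.
induction l as [|z l IH]; intros H.
- exists 1. split; [lra|]. intros w' _ z [].
- eapply near_imp; [|apply near_and; [apply (H z); now left|apply IH; intros; apply H; now right]].
  intros w' [H1 H2] z' [<-|Hz]; auto.
Qed.

Lemma near_neq w a : a <> w -> near w (fun w' => a <> w').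
Proof.
intros H. apply del_pos in H. exists (del a w / 2). split; [lra|].
intros w' Hw <-. lra.
Qed.

(** Continuity in the remote point; it makes the inequalities of [almost_smooth] open conditions on
    [w]. *)
Lemma near_rho w a b e : a <> w -> b <> w -> 0 < e ->
  near w (fun w' => Rabs (rho del w' a b - rho del w a b) < e).
Proof.
intros Ha Hb He. apply del_pos in Ha, Hb. set (u := del a w) in *. set (v := del b w) in *.
set (K := del a b). assert (HK : 0 <= K) by apply del_nonneg.
(* As [r] is at most half of [u] and of [v], the new product of distances is at least [u * v / 4]
   and differs from [u * v] by at most [2 * r * (u + v)]. Writing [K + 1] avoids division by
   zero. *)
set (r := Rmin (Rmin (u / 2) (v / 2)) (e * (u * v) ^ 2 / (8 * (u + v) * (K + 1)))).
assert (HD : 0 < 8 * (u + v) * (K + 1)) by (apply Rmult_lt_0_compat; lra).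
assert (Huv : 0 < u * v) by nra.
assert (Hr : 0 < r).
{ repeat apply Rmin_glb_lt; try lra. apply Rdiv_lt_0_compat; [|exact HD].
  apply Rmult_lt_0_compat; [exact He|now apply pow_lt]. }
exists r. split; [exact Hr|]. intros w' Hw.
assert (R1 : r <= u / 2) by (eapply Rle_trans; [apply Rmin_l|apply Rmin_l]).
assert (R2 : r <= v / 2) by (eapply Rle_trans; [apply Rmin_l|apply Rmin_r]).
assert (R3 : r * (8 * (u + v) * (K + 1)) <= e * (u * v) ^ 2).
{ apply Rle_trans with (e * (u * v) ^ 2 / (8 * (u + v) * (K + 1)) * (8 * (u + v) * (K + 1))).
  - apply Rmult_le_compat_r; [lra|apply Rmin_r].
  - right. field. lra. }
unfold rho. fold u v K.
assert (A1 : u - r <= del a w' <= u + r).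
{ unfold u. pose proof (del_triangle a w' w). pose proof (del_triangle a w w').
  rewrite (del_sym w w') in *. lra. }
assert (A2 : v - r <= del b w' <= v + r).
{ unfold v. pose proof (del_triangle b w' w). pose proof (del_triangle b w w').
  rewrite (del_sym w w') in *. lra. }
set (u' := del a w') in *. set (v' := del b w') in *.
assert (Pu : 0 < u') by lra. assert (Pv : 0 < v') by lra.
replace (K / (u' * v') - K / (u * v)) with (K * (u * v - u' * v') / (u' * v' * (u * v)))
  by (field; lra).
assert (Q0 : u * v / 4 <= u' * v') by nra.
assert (Q1 : Rabs (u * v - u' * v') <= 2 * r * (u + v)).
{ replace (u * v - u' * v') with (u * (v - v') + (u - u') * v') by ring.
  eapply Rle_trans; [apply Rabs_triang|]. rewrite !Rabs_mult, (Rabs_pos_eq u), (Rabs_pos_eq v') by lra.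
  assert (Rabs (v - v') <= r) by (apply Rabs_le; lra).
  assert (Rabs (u - u') <= r) by (apply Rabs_le; lra). nra. }
assert (Q2 : 0 < u' * v' * (u * v)) by (apply Rmult_lt_0_compat; nra).
unfold Rdiv. rewrite Rabs_mult, Rabs_mult, (Rabs_pos_eq K) by lra.
rewrite (Rabs_pos_eq (/ _)) by (apply Rlt_le, Rinv_0_lt_compat, Q2).
apply Rmult_lt_reg_r with (u' * v' * (u * v)); [exact Q2|].
rewrite Rmult_assoc, Rinv_l, Rmult_1_r by lra.
apply Rle_lt_trans with (K * (2 * r * (u + v))); [now apply Rmult_le_compat_l|].
apply Rlt_le_trans with ((K + 1) * (2 * r * (u + v))); [nra|].
apply Rle_trans with (e * (u * v / 4 * (u * v))); [nra|].
apply Rmult_le_compat_l; [lra|]. apply Rmult_le_compat_r; lra.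
Qed.

Lemma line_neq c L s t : line del c L -> s <> t -> L s <> L t.
Proof.
intros [_ H] Hst E. specialize (H s t). rewrite E, rho_refl in H.
symmetry in H. apply Rabs_eq_0 in H. lra.
Qed.

Lemma line_avoids c L (l : list X) : line del c L ->
  forall eta, 0 < eta -> exists t, 0 < t < eta /\ ~ In (L t) l.
Proof.
intros HL. induction l as [|a l IH]; intros eta Heta.
- exists (eta / 2). split; [lra|intros []].
- destruct (IH eta Heta) as (t & Ht & Hn).
  destruct (classic (a = L t)) as [E|E].
  + destruct (IH t ltac:(lra)) as (t' & Ht' & Hn'). exists t'. split; [lra|].
    intros [E'|Hi]; [|contradiction].
    apply (line_neq c L t t' HL); [lra|congruence].
  + exists t. split; [exact Ht|]. intros [E'|Hi]; contradiction.
Qed.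

(* Ptolemy's inequality for three points of a line and a fourth point is convexity. *)
Lemma line_convex c L z t h : line del c L -> z <> c -> 0 <= h ->
  2 * rho del c z (L t) <= rho del c z (L (t + h)) + rho del c z (L (t - h)).
Proof.
intros [Hc HL] Hz Hh. destruct (Req_dec h 0) as [->|H0].
- rewrite Rplus_0_r, Rminus_0_r. lra.
- pose proof (rho_ptolemy c z (L t) (L (t - h)) (L (t + h)) Hz (Hc _) (Hc _) (Hc _)) as H.
  rewrite !HL in H.
  replace (t - h - (t + h)) with (- (2 * h)) in H by ring.
  replace (t - (t + h)) with (- h) in H by ring. replace (t - (t - h)) with h in H by ring.
  rewrite !Rabs_Ropp, !Rabs_pos_eq in H by lra.
  apply Rmult_le_reg_r with h; lra.
Qed.

(** * Consequences of lines, and density of almost smooth points *)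

Hypothesis Hlines : has_lines del.
Hypothesis Hthree : exists a b c : X, a <> b /\ a <> c /\ b <> c.

Lemma line_through w c (Hwc : w <> c) : exists L, line del c L /\ L 0 = w.
Proof.
assert (Hb : exists b, w <> b /\ b <> c).
{ destruct Hthree as (x & y & z & H1 & H2 & H3).
  destruct (classic (x = w)) as [->|Ex]; [destruct (classic (y = c)) as [->|Ey]|
    destruct (classic (x = c)) as [->|Ex']].
  - now exists z; split; [|apply not_eq_sym].
  - now exists y.
  - destruct (classic (y = w)) as [->|Ey].
    + exists z. split; congruence.
    + exists y. split; congruence.
  - exists x. split; congruence. }
destruct Hb as (b & H1 & H2).
destruct (Hlines w b c H1 Hwc H2) as (L & HL & H0 & _). now exists L.
Qed.

Lemma exists_neq (w : X) : exists c, w <> c.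
Proof.
destruct Hthree as (x & y & z & H1 & H2 & H3).
destruct (classic (w = x)) as [->|E]; [now exists y|now exists x].
Qed.

(** A line through [w] is injective and has points at arbitrarily small parameters; the two bounds
    on [t] are those required by [del_le_rho]. *)
Lemma no_isolated_point w r (l : list X) : 0 < r -> exists w', del w' w < r /\ ~ In w' l.
Proof.
intros Hr. destruct (exists_neq w) as [c Hc].
destruct (line_through w c Hc) as (L & HL & H0). pose proof HL as [HLc HLi].
set (d := del w c). assert (Hd : 0 < d) by now apply del_pos.
destruct (line_avoids c L l HL (Rmin (/ (2 * d)) (r / (2 * d ^ 2)))) as (t & Ht & Hn).
{ apply Rmin_glb_lt; [apply Rinv_0_lt_compat|apply Rdiv_lt_0_compat]; nra. }
assert (T1 : t < / (2 * d)) by (eapply Rlt_le_trans; [apply Ht|apply Rmin_l]).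
assert (T2 : t < r / (2 * d ^ 2)) by (eapply Rlt_le_trans; [apply Ht|apply Rmin_r]).
assert (T3 : t * d <= / 2).
{ apply Rle_trans with (/ (2 * d) * d); [apply Rmult_le_compat_r; lra|right; field; lra]. }
assert (T4 : t * (2 * d ^ 2) < r).
{ apply Rlt_le_trans with (r / (2 * d ^ 2) * (2 * d ^ 2)).
  - apply Rmult_lt_compat_r; [nra|exact T2].
  - right; field; lra. }
exists (L t). split; [|exact Hn].
assert (E : rho del c (L t) w = t).
{ rewrite <- H0, HLi, Rminus_0_r, Rabs_pos_eq; lra. }
pose proof (del_le_rho c w (L t) Hc (HLc t)) as H. rewrite E in H. fold d in H.
specialize (H T3). lra.
Qed.

(** The excess of the triangle inequality at [z]. When [p] and [q] recede to infinity,
    [defect w p q z - defect w p q x] becomes the sum of their Busemann functions normalised at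
    [x]. *)
Definition defect (w p q z : X) : R := rho del w z p + rho del w z q - rho del w p q.

(* [p] and [q] play the role of two points close to [w] on opposite sides of it on a circle
   through [w], [x] and [y]: seen from [z], that circle has almost no kink at [w]. *)
Definition almost_smooth (x y : X) (l : list X) (e : R) (w : X) : Prop :=
  x <> w /\ y <> w /\ exists p q, p <> w /\ q <> w /\
    rho del w x y - e < rho del w x p - rho del w y p /\
    forall z, In z l -> z <> w /\ defect w p q z < e.

Lemma positive_lower_bound (l : list X) (f : X -> R) :
  (forall z, In z l -> 0 < f z) -> exists m, 0 < m /\ forall z, In z l -> m <= f z.
Proof.
induction l as [|z l IH]; intros H.
- exists 1. split; [lra|intros z []].
- destruct IH as (m & Hm & Hl); [intros; apply H; now right|].
  exists (Rmin m (f z)). split; [apply Rmin_glb_lt; [exact Hm|apply H; now left]|].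
  intros z' [<-|Hz]; [apply Rmin_r|eapply Rle_trans; [apply Rmin_l|now apply Hl]].
Qed.

(** On a line of [rho del x] from a point [w1] near [w0] to [y], some parameter [t] has small second
    differences for the distances to all of [l]. With [w], [p], [q] at [t], [t + h], [t - h],
    inversion at [w] turns these second differences into defects, and the strict inequalities
    persist around [w]. *)
Lemma almost_smooth_dense x y l e w0 r : x <> y -> 0 < e -> 0 < r ->
  exists w, del w w0 < r /\ near w (almost_smooth x y l e).
Proof.
intros Hxy He Hr.
destruct (no_isolated_point w0 (r / 2) (x :: y :: l) ltac:(lra)) as (w1 & Hw1 & Hn).
assert (Hxw : x <> w1) by (intros E; apply Hn; now left).
assert (Hyw : y <> w1) by (intros E; apply Hn; right; now left).
assert (Hlw : forall z, In z l -> z <> w1)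
  by (intros z Hz E; apply Hn; right; right; now rewrite <- E).
destruct (Hlines w1 y x (not_eq_sym Hyw) (not_eq_sym Hxw) (not_eq_sym Hxy))
  as (L & HL & HL0 & HLT). pose proof HL as [HLx HLi].
set (T := rho del x w1 y) in *. set (d := del w1 x).
assert (HT : 0 < T) by (apply rho_pos; auto).
assert (Hd : 0 < d) by (apply del_pos; auto).
(* The list [l] may contain [x], which is remote for [rho del x]: it gets the dummy value 1 here and
   its own computation below. *)
destruct (positive_lower_bound l
  (fun z => if excluded_middle_informative (z = x) then 1 else rho del x z w1)) as (m & Hm & Hml).
{ intros z Hz. destruct (excluded_middle_informative (z = x)); [lra|].
  apply rho_pos; auto. }
set (r1 := Rmin (r / 2) (d / 2)).
assert (Hr1 : 0 < r1) by (apply Rmin_glb_lt; lra).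
(* [T] stops the line short of [y]; the next two bounds keep [L t] within [r1] of [w1] through
   [del_le_rho]; the last keeps it at distance at least [m / 2] from the points of [l] other than
   [x]. *)
set (eta := Rmin (Rmin T (/ (2 * d))) (Rmin (r1 / (2 * d ^ 2)) (m / 2))).
assert (Heta : 0 < eta).
{ repeat apply Rmin_glb_lt; try lra; [apply Rinv_0_lt_compat|apply Rdiv_lt_0_compat]; nra. }
assert (E1 : eta <= T) by (eapply Rle_trans; [apply Rmin_l|apply Rmin_l]).
assert (E2 : eta * d <= / 2).
{ apply Rle_trans with (/ (2 * d) * d); [|right; field; lra].
  apply Rmult_le_compat_r; [lra|]. eapply Rle_trans; [apply Rmin_l|apply Rmin_r]. }
assert (E3 : 2 * eta * d ^ 2 <= r1).
{ apply Rle_trans with (r1 / (2 * d ^ 2) * (2 * d ^ 2)); [|right; field; lra].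
  replace (2 * eta * d ^ 2) with (eta * (2 * d ^ 2)) by ring.
  apply Rmult_le_compat_r; [nra|]. eapply Rle_trans; [apply Rmin_r|apply Rmin_l]. }
assert (E4 : eta <= m / 2) by (eapply Rle_trans; [apply Rmin_r|apply Rmin_r]).
assert (Hclose : forall t, 0 <= t <= eta -> del (L t) w1 <= r1).
{ intros t Ht. assert (E : rho del x (L t) w1 = t).
  { rewrite <- HL0, HLi, Rminus_0_r, Rabs_pos_eq; lra. }
  pose proof (del_le_rho x w1 (L t) (not_eq_sym Hxw) (HLx t)) as H.
  rewrite E in H. fold d in H. specialize (H ltac:(nra)). nra. }
assert (Hfar : forall z t, In z l -> z <> x -> 0 <= t <= eta -> m / 2 <= rho del x z (L t)).
{ intros z t Hz Hzx Ht. specialize (Hml z Hz).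
  destruct (excluded_middle_informative (z = x)); [contradiction|].
  pose proof (rho_triangle x z (L t) w1 Hzx (HLx t) (not_eq_sym Hxw)).
  assert (E : rho del x (L t) w1 = t).
  { rewrite <- HL0, HLi, Rminus_0_r, Rabs_pos_eq; lra. } lra. }
(* [m / 2] and [d / 2] are lower bounds for [rho del x z w] and [del w x]; the final half makes the
   estimate strict. *)
set (e1 := e * (m / 2) * (d / 2) ^ 2 / 2).
assert (He1 : 0 < e1).
{ unfold e1. apply Rdiv_lt_0_compat; [|lra]. apply Rmult_lt_0_compat; nra. }
destruct (small_second_difference (fun z t => rho del x z (L t))
  (List.filter (fun z => if excluded_middle_informative (z = x) then false else true) l)
  eta e1 Heta He1) as (t & h & Hh & Hth & Hte & Hdiff).
{ intros z s t Hz. apply filter_In in Hz. destruct Hz as [_ Hz].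
  destruct (excluded_middle_informative (z = x)) as [|Hzx]; [discriminate|].
  rewrite !(rho_sym x z). eapply Rle_trans; [apply rho_lipschitz; auto|]. rewrite HLi. lra. }
{ intros z t h Hz Hh. apply filter_In in Hz. destruct Hz as [_ Hz].
  destruct (excluded_middle_informative (z = x)) as [|Hzx]; [discriminate|].
  now apply line_convex. }
set (w := L t). set (p := L (t + h)). set (q := L (t - h)).
assert (Hpw : p <> w) by (apply (line_neq x L _ _ HL); lra).
assert (Hqw : q <> w) by (apply (line_neq x L _ _ HL); lra).
assert (Hxw' : w <> x) by apply HLx. assert (Hpx : p <> x) by apply HLx.
assert (Hqx : q <> x) by apply HLx.
assert (Hyw' : y <> w).
{ rewrite <- HLT. apply (line_neq x L _ _ HL). lra. }
assert (Hww : del w w1 <= r1) by (apply Hclose; lra).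
assert (R1 : r1 <= r / 2) by apply Rmin_l. assert (R2 : r1 <= d / 2) by apply Rmin_r.
set (D := del w x).
assert (HD : d / 2 <= D).
{ pose proof (del_triangle w1 w x) as H. rewrite (del_sym w1 w) in H. fold d D in H. lra. }
assert (Epw : rho del x p w = h).
{ unfold p, w. rewrite HLi. replace (t + h - t) with h by ring. apply Rabs_pos_eq; lra. }
assert (Eqw : rho del x q w = h).
{ unfold q, w. rewrite HLi. replace (t - h - t) with (- h) by ring.
  rewrite Rabs_Ropp. apply Rabs_pos_eq; lra. }
assert (Epq : rho del x p q = 2 * h).
{ unfold p, q. rewrite HLi. replace (t + h - (t - h)) with (2 * h) by ring. apply Rabs_pos_eq; lra. }
assert (Eyw : rho del x y w = T - t).
{ unfold w. rewrite <- HLT, HLi. apply Rabs_pos_eq; lra. }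
assert (Eyp : rho del x y p = T - t - h).
{ unfold p. rewrite <- HLT, HLi. rewrite Rabs_pos_eq; lra. }
assert (Hz : forall z, In z l -> z <> w /\ defect w p q z < e).
{ intros z Hz. unfold defect. destruct (classic (z = x)) as [->|Hzx].
  - split; [now apply not_eq_sym|].
    rewrite (rho_change_base x w p), (rho_change_base x w q), (rho_change x w p q) by assumption.
    rewrite Epw, Eqw, Epq. fold D.
    replace (1 / (h * D ^ 2) + 1 / (h * D ^ 2) - 2 * h / (h * h * D ^ 2)) with 0 by (field; lra).
    exact He.
  - pose proof (Hfar z t Hz Hzx ltac:(lra)) as Hf.
    assert (Hzw : z <> w).
    { intros E. rewrite E in Hf. unfold w in Hf. rewrite rho_refl in Hf. lra. }
    split; [exact Hzw|].
    rewrite (rho_change x w z p), (rho_change x w z q), (rho_change x w p q) by assumption.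
    rewrite Epw, Eqw, Epq. fold D.
    fold w in Hf. set (f := rho del x z w) in *.
    assert (Hd2 : rho del x z p + rho del x z q - 2 * f <= e1 * h).
    { apply Hdiff. apply filter_In. split; [exact Hz|].
      now destruct (excluded_middle_informative (z = x)). }
    replace (rho del x z p / (f * h * D ^ 2) + rho del x z q / (f * h * D ^ 2)
      - 2 * h / (h * h * D ^ 2)) with ((rho del x z p + rho del x z q - 2 * f) / (f * h * D ^ 2))
      by (field; lra).
    assert (HP : 0 < f * h * D ^ 2).
    { apply Rmult_lt_0_compat; [apply Rmult_lt_0_compat|apply pow_lt]; lra. }
    apply Rmult_lt_reg_r with (f * h * D ^ 2); [exact HP|].
    unfold Rdiv. rewrite Rmult_assoc, Rinv_l, Rmult_1_r by lra.
    apply Rle_lt_trans with (e1 * h); [exact Hd2|].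
    replace (e * (f * h * D ^ 2)) with (e * f * D ^ 2 * h) by ring.
    apply Rmult_lt_compat_r; [exact Hh|].
    apply Rlt_le_trans with (e * (m / 2) * (d / 2) ^ 2).
    + unfold e1. assert (0 < e * (m / 2) * (d / 2) ^ 2); [|lra].
      apply Rmult_lt_0_compat; nra.
    + apply Rmult_le_compat; [nra|apply pow2_ge_0| |apply pow_incr; lra].
      apply Rmult_le_compat_l; lra. }
(* An exact equality: [w], [p], [y] follow each other on a line with remote point [x], so after
   inversion at [w] the point [y] lies between [x] and [p]. *)
assert (Hdiff2 : rho del w x p - rho del w y p = rho del w x y).
{ rewrite (rho_change_base x w p), (rho_change_base x w y), (rho_change x w y p) by auto.
  rewrite Epw, Eyw, Eyp. fold D. field. lra. }
exists w. split.
{ pose proof (del_triangle w w1 w0). lra. }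
(* The same [p] and [q] serve for all remote points [w'] close to [w]. *)
assert (NL : near w (fun w' => forall z, In z l -> z <> w' /\ defect w' p q z < e)).
{ apply near_forall. intros z Hzl. destruct (Hz z Hzl) as [Hzw Hdz].
  apply near_and; [now apply near_neq|].
  set (g := (e - defect w p q z) / 3). assert (Hg : 0 < g) by (unfold g; lra).
  generalize (near_and _ _ _ (near_rho w z p g Hzw Hpw Hg)
    (near_and _ _ _ (near_rho w z q g Hzw Hqw Hg) (near_rho w p q g Hpw Hqw Hg))).
  apply near_imp. intros w' (H1 & H2 & H3). apply Rabs_def2 in H1, H2, H3.
  unfold g in *. unfold defect in *. lra. }
assert (Hg : 0 < e / 3) by lra.
generalize (near_and _ _ _ NL (near_and _ _ _ (near_and _ _ _ (near_neq w p Hpw) (near_neq w q Hqw))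
  (near_and _ _ _ (near_and _ _ _ (near_neq w x (not_eq_sym Hxw')) (near_neq w y Hyw'))
  (near_and _ _ _ (near_rho w x p _ (not_eq_sym Hxw') Hpw Hg)
  (near_and _ _ _ (near_rho w y p _ Hyw' Hpw Hg)
     (near_rho w x y _ (not_eq_sym Hxw') Hyw' Hg)))))).
apply near_imp. intros w' (H1 & (H2 & H3) & (H4 & H5) & H6 & H7 & H8).
apply Rabs_def2 in H6, H7, H8.
split; [exact H4|]. split; [exact H5|]. exists p, q. repeat split; try tauto; try lra; apply H1; assumption.
Qed.

(** * Compactness, Baire category and a smooth point *)

Hypothesis Hcompact : metric_compact del.

Lemma ball_open c r : metric_open del (fun y => del y c < r).
Proof.
intros p Hp. exists (r - del p c). split; [lra|]. intros y Hy.
pose proof (del_triangle y p c). lra.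
Qed.

Lemma coball_open c r : metric_open del (fun y => r < del y c).
Proof.
intros p Hp. exists (del p c - r). split; [lra|]. intros y Hy.
pose proof (del_triangle p y c). rewrite (del_sym p y) in *. lra.
Qed.

Lemma finite_net e : 0 < e -> exists l : list X, forall x, exists y, In y l /\ del x y < e.
Proof.
intros He. destruct (Hcompact X (fun y x => del x y < e)) as [l Hl].
- intros y. apply ball_open.
- intros x. exists x. now rewrite del_refl.
- exists l. exact Hl.
Qed.

Lemma dense_sequence : exists u : nat -> X, forall x r, 0 < r -> exists n, del (u n) x < r.
Proof.
destruct Hthree as (x0 & _).
destruct (functional_choice
  (fun (k : nat) l => forall x, exists y, In y l /\ del x y < / INR (S k))) as [l Hl].
{ intros k. apply finite_net, Rinv_0_lt_compat, lt_0_INR. lia. }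
(* Finite nets of mesh [/ INR (S k)] are run through by Cantor pairing; positions beyond the end of
   a net give the default [x0]. *)
exists (fun n => nth (snd (Cantor.of_nat n)) (l (fst (Cantor.of_nat n))) x0).
intros x r Hr. destruct (archimed_cor1 r Hr) as (k & Hk & Hk0).
destruct (Hl k x) as (y & Hy & Hd). destruct (In_nth _ _ x0 Hy) as (i & Hi & Ei).
exists (Cantor.to_nat (k, i)). rewrite Cantor.cancel_of_to. simpl fst; simpl snd. rewrite Ei.
rewrite del_sym. eapply Rlt_trans; [exact Hd|]. eapply Rle_lt_trans; [|exact Hk].
apply Rinv_le_contravar; [now apply lt_0_INR|]. apply le_INR. lia.
Qed.

(** Nested closed balls, with compactness in place of completeness: were their intersection empty,
    the complements would form an open cover, and the centre of the smallest ball met by a finite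
    subcover would escape it. *)
Lemma baire (P : nat -> X -> Prop) :
  (forall k w0 r, 0 < r -> exists w, del w w0 < r /\ near w (P k)) ->
  exists w, forall k, P k w.
Proof.
intros HP. destruct Hthree as (x0 & _).
destruct (functional_choice (fun (a : nat * (X * R)) (b : X * R) => 0 < snd (snd a) ->
   0 < snd b /\ (forall w, del w (fst b) <= snd b -> del w (fst (snd a)) <= snd (snd a)) /\
   forall w, del w (fst b) <= snd b -> P (fst a) w)) as [step Hstep].
{ intros (k & w0 & r). simpl. destruct (Rlt_dec 0 r) as [Hr|Hr].
  - destruct (HP k w0 (r / 2) ltac:(lra)) as (w & Hw & r' & Hr' & HPw).
    exists (w, Rmin r' (r / 2)). intros _. simpl. split; [apply Rmin_glb_lt; lra|]. split.
    + intros w' Hw'. pose proof (Rmin_r r' (r / 2)). pose proof (del_triangle w' w w0). lra.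
    + intros w' Hw'. apply HPw. pose proof (Rmin_l r' (r / 2)). lra.
  - exists (w0, r). intros; lra. }
set (s := fix s (k : nat) : X * R :=
  match k with O => (x0, 1) | S k => step (k, s k) end).
assert (Hs : forall k, 0 < snd (s k)).
{ induction k as [|k IH]; [simpl; lra|]. apply (Hstep (k, s k)). exact IH. }
assert (Hnest : forall k j w, (k <= j)%nat -> del w (fst (s j)) <= snd (s j) ->
   del w (fst (s k)) <= snd (s k)).
{ intros k j w Hkj. induction Hkj as [|j Hkj IH]; [auto|]. intros Hw. apply IH.
  apply (proj1 (proj2 (Hstep (j, s j) (Hs j)))). exact Hw. }
destruct (classic (exists w, forall k, del w (fst (s k)) <= snd (s k))) as [[w Hw]|Hno].
- exists w. intros k. apply (proj2 (proj2 (Hstep (k, s k) (Hs k)))). apply (Hw (S k)).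
- exfalso. destruct (Hcompact nat (fun k w => snd (s k) < del w (fst (s k)))) as [l Hl].
  + intros k. apply coball_open.
  + intros w. apply NNPP; intros Hn. apply Hno. exists w. intros k.
    apply Rnot_lt_le; intros Hk. apply Hn. now exists k.
  + destruct (Hl (fst (s (list_max l)))) as (k & Hk & Hd).
    assert (Hle : (k <= list_max l)%nat).
    { pose proof (proj1 (list_max_le l (list_max l)) (le_n _)) as HF.
      rewrite Forall_forall in HF. now apply HF. }
    assert (H := Hnest k _ (fst (s (list_max l))) Hle). rewrite del_refl in H.
    specialize (H (Rlt_le _ _ (Hs _))). lra.
Qed.

(** There is one condition for each triple [(i, j, n)], hence countably many; the error
    [/ INR (S n)] and the test list of the first [n + 1] points improve together. *)
Lemma exists_smooth_point : exists (w : X) (u : nat -> X),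
  (forall x r, 0 < r -> exists n, del (u n) x < r) /\ (forall n, u n <> w) /\
  forall i j n, u i <> u j ->
    almost_smooth (u i) (u j) (map u (seq 0 (S n))) (/ INR (S n)) w.
Proof.
destruct dense_sequence as [u Hu].
destruct (baire (fun k w => let (i, jn) := Cantor.of_nat k in let (j, n) := Cantor.of_nat jn in
   u i <> u j -> almost_smooth (u i) (u j) (map u (seq 0 (S n))) (/ INR (S n)) w)) as [w Hw].
{ intros k w0 r Hr. destruct (Cantor.of_nat k) as [i jn]. destruct (Cantor.of_nat jn) as [j n].
  destruct (classic (u i = u j)) as [E|E].
  - exists w0. split; [rewrite del_refl; exact Hr|]. exists 1. split; [lra|]. tauto.
  - destruct (almost_smooth_dense (u i) (u j) (map u (seq 0 (S n))) (/ INR (S n)) w0 r E)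
      as (w & H1 & H2); [apply Rinv_0_lt_compat, lt_0_INR; lia|exact Hr|].
    exists w. split; [exact H1|]. eapply near_imp; [|exact H2]. auto. }
assert (Hs : forall i j n, u i <> u j ->
  almost_smooth (u i) (u j) (map u (seq 0 (S n))) (/ INR (S n)) w).
{ intros i j n. specialize (Hw (Cantor.to_nat (i, Cantor.to_nat (j, n)))).
  rewrite !Cantor.cancel_of_to in Hw. exact Hw. }
exists w, u. split; [exact Hu|]. split; [|exact Hs].
(* [u n <> w] is the first clause of [almost_smooth], which is available once some [u j] differs
   from [u n]. *)
intros n. destruct (exists_neq (u n)) as [c Hc].
destruct (Hu c (del (u n) c)) as [j Hj]; [now apply del_pos|].
assert (Hnj : u n <> u j) by (intros E; rewrite <- E in Hj; lra).
apply (Hs n j 0%nat Hnj).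
Qed.

(** * Affine functions at a smooth point *)

Definition affine_at (w : X) (b : X -> R) : Prop :=
  (forall x y, x <> w -> y <> w -> Rabs (b x - b y) <= rho del w x y) /\
  (forall x m y, x <> w -> m <> w -> y <> w ->
     rho del w x m + rho del w m y = rho del w x y ->
     b m * rho del w x y = b x * rho del w m y + b y * rho del w x m).

Lemma rho_lt w x y e : x <> w -> y <> w -> 0 < e ->
  del y x < Rmin (del x w / 2) (e * (del x w ^ 2 / 2)) -> rho del w y x < e.
Proof.
intros Hx Hy He Hn. pose proof (del_pos x w Hx) as Hd. set (d := del x w) in *.
pose proof (Rmin_l (d / 2) (e * (d ^ 2 / 2))). pose proof (Rmin_r (d / 2) (e * (d ^ 2 / 2))).
assert (Hun : d / 2 <= del y w).
{ pose proof (del_triangle x y w) as H1. rewrite (del_sym x y) in H1. fold d in H1. lra. }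
unfold rho. fold d. set (D := del y w) in *.
assert (HP : 0 < D * d) by nra.
apply Rmult_lt_reg_r with (D * d); [exact HP|].
unfold Rdiv. rewrite Rmult_assoc, Rinv_l, Rmult_1_r by lra.
apply Rlt_le_trans with (e * (d ^ 2 / 2)); [lra|]. apply Rmult_le_compat_l; [lra|]. nra.
Qed.

Lemma rho_lt_radius_pos w x e : x <> w -> 0 < e ->
  0 < Rmin (del x w / 2) (e * (del x w ^ 2 / 2)).
Proof.
intros Hx He. pose proof (del_pos x w Hx) as Hd. apply Rmin_glb_lt; [lra|].
apply Rmult_lt_0_compat; [exact He|]. pose proof (pow_lt _ 2 Hd). lra.
Qed.

Lemma dense_rho w u x e : (forall x r, 0 < r -> exists n, del (u n) x < r) ->
  (forall n : nat, u n <> w) -> x <> w -> 0 < e -> exists n, rho del w (u n) x < e.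
Proof.
intros Hu Huw Hx He. destruct (Hu x _ (rho_lt_radius_pos w x e Hx He)) as [n Hn].
exists n. now apply rho_lt.
Qed.

Lemma defect_nonneg w p q z : p <> w -> q <> w -> z <> w -> 0 <= defect w p q z.
Proof.
intros Hp Hq Hz. unfold defect. pose proof (rho_triangle w p z q Hp Hz Hq).
rewrite (rho_sym w p z) in *. lra.
Qed.

(** Replacing [x] and [y] by members of the dense sequence costs at most [4 * e], and the error of
    [almost_smooth] is the fifth term. *)
Lemma almost_smooth_pairs w u x y :
  (forall x r, 0 < r -> exists n, del (u n) x < r) -> (forall n, u n <> w) ->
  (forall i j n, u i <> u j ->
     almost_smooth (u i) (u j) (map u (seq 0 (S n))) (/ INR (S n)) w) ->
  x <> w -> y <> w -> x <> y ->
  forall n, exists p q, p <> w /\ q <> w /\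
    rho del w x y - 5 * / INR (S n) <= rho del w x p - rho del w y p /\
    forall l, (l <= n)%nat -> defect w p q (u l) < / INR (S n).
Proof.
intros Hu Huw Hs Hx Hy Hxy n.
assert (Hn : 0 < / INR (S n)) by (apply Rinv_0_lt_compat, lt_0_INR; lia).
pose proof (rho_pos w x y Hx Hy Hxy) as Hr.
(* Half of the distance keeps the two approximants distinct. *)
set (e := Rmin (/ INR (S n)) (rho del w x y / 2)).
assert (He : 0 < e) by (apply Rmin_glb_lt; lra).
assert (He1 : e <= / INR (S n)) by apply Rmin_l.
assert (He2 : e <= rho del w x y / 2) by apply Rmin_r.
destruct (dense_rho w u x e Hu Huw Hx He) as [i Hi].
destruct (dense_rho w u y e Hu Huw Hy He) as [j Hj].
pose proof (Huw i) as Hui. pose proof (Huw j) as Huj.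
pose proof (rho_triangle w x (u i) y Hx Hui Hy) as T1.
pose proof (rho_triangle w (u i) (u j) y Hui Huj Hy) as T2.
rewrite (rho_sym w x (u i)) in T1.
assert (Hij : u i <> u j).
{ intros E. rewrite E, rho_refl in T2. rewrite E in *. lra. }
destruct (Hs i j n Hij) as (_ & _ & p & q & Hp & Hq & Hd & Hl).
exists p, q. split; [exact Hp|]. split; [exact Hq|]. split.
- pose proof (rho_triangle w (u i) x p Hui Hx Hp) as T3.
  pose proof (rho_triangle w y (u j) p Hy Huj Hp) as T4.
  rewrite (rho_sym w y (u j)) in T4. lra.
- intros l Hln. apply Hl. apply in_map, in_seq. lia.
Qed.

(* At a smooth point the Busemann functions of opposite rays cancel: their sum is a limit of
   defects, and both are convex, so they are affine. *)
Theorem enough_affine_functions : exists w, forall x y, x <> w -> y <> w -> x <> y ->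
  exists b, affine_at w b /\ b x - b y = rho del w x y.
Proof.
destruct exists_smooth_point as (w & u & Hu & Huw & Hs). exists w.
intros x y Hx Hy Hxy.
destruct (functional_choice _ (almost_smooth_pairs w u x y Hu Huw Hs Hx Hy Hxy)) as [p Hp].
destruct (functional_choice _ Hp) as [q Hpq]. clear Hp.
destruct ultrafilter_nat as (G & PG & Hev & HU).
assert (Hlim : forall (r : nat -> X), (forall n, r n <> w) ->
  exists b, forall z, z <> w -> tends G (fun n => rho del w z (r n) - rho del w x (r n)) (b z)).
{ intros r Hr. apply (functional_choice (fun z l => z <> w ->
    tends G (fun n => rho del w z (r n) - rho del w x (r n)) l)). intros z.
  destruct (classic (z = w)) as [E|E]; [exists 0; tauto|].
  destruct (ultrafilter_limit G PG HU (fun n => rho del w z (r n) - rho del w x (r n))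
    (rho del w z x)) as [l Hl].
  - intros n. now apply rho_lipschitz.
  - now exists l. }
destruct (Hlim p) as [b Hb]; [intros; apply Hpq|].
destruct (Hlim q) as [g Hg]; [intros; apply Hpq|].
(* Ptolemy's inequality for [a], [m], [c] and the receding point [r n] becomes convexity of the
   Busemann function in the limit. *)
assert (Hconv : forall (r : nat -> X) (f : X -> R), (forall n, r n <> w) ->
  (forall z, z <> w -> tends G (fun n => rho del w z (r n) - rho del w x (r n)) (f z)) ->
  forall a m c, a <> w -> m <> w -> c <> w ->
    rho del w a m + rho del w m c = rho del w a c ->
    f m * rho del w a c <= f a * rho del w m c + f c * rho del w a m).
{ intros r f Hr Hf a m c Ha Hm Hc E.
  refine (tends_le G _ _ _ _ PG
    (tends_mult G _ _ _ _ PG (Hf m Hm) (tends_const G (rho del w a c) PG))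
    (tends_plus G _ _ _ _ PG
      (tends_mult G _ _ _ _ PG (Hf a Ha) (tends_const G (rho del w m c) PG))
      (tends_mult G _ _ _ _ PG (Hf c Hc) (tends_const G (rho del w a m) PG))) _).
  apply filter_forall. intros n.
  pose proof (rho_ptolemy w m (r n) a c Hm (Hr n) Ha Hc) as H.
  rewrite (rho_sym w m a), (rho_sym w (r n) c), (rho_sym w (r n) a) in H.
  assert (E2 : rho del w x (r n) * rho del w a c
    = rho del w x (r n) * (rho del w a m + rho del w m c)) by now rewrite E.
  lra. }
(* The defect is 2-Lipschitz in [z], so a nearby [u l] controls it as soon as [n >= l]. *)
assert (Hdef : forall z, z <> w -> tends G (fun n => defect w (p n) (q n) z) 0).
{ intros z Hz e He. destruct (dense_rho w u z (e / 4) Hu Huw Hz ltac:(lra)) as [l Hl].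
  apply Hev. destruct (archimed_cor1 (e / 2) ltac:(lra)) as (N & HN & HN0).
  exists (Nat.max l N). intros n Hn.
  destruct (Hpq n) as (Hpn & Hqn & _ & Hdn). specialize (Hdn l ltac:(lia)).
  pose proof (defect_nonneg w (p n) (q n) z Hpn Hqn Hz).
  pose proof (rho_lipschitz w z (u l) (p n) Hz (Huw l) Hpn) as L1.
  pose proof (rho_lipschitz w z (u l) (q n) Hz (Huw l) Hqn) as L2.
  apply Rabs_le_between in L1, L2. rewrite (rho_sym w z) in L1, L2.
  assert (/ INR (S n) <= / INR N).
  { apply Rinv_le_contravar; [apply lt_0_INR; lia|apply le_INR; lia]. }
  rewrite Rminus_0_r, Rabs_pos_eq by assumption. unfold defect in *. lra. }
(* Both functions are normalised to vanish at [x], so their sum is the limit of the defect at [z]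
   minus the defect at [x]. *)
assert (Hsum : forall z, z <> w -> b z + g z = 0).
{ intros z Hz.
  pose proof (tends_plus G _ _ _ _ PG (Hb z Hz) (Hg z Hz)) as H1.
  pose proof (tends_plus G _ _ _ _ PG (Hdef z Hz)
    (tends_mult G _ _ _ _ PG (tends_const G (-1) PG) (Hdef x Hx))) as H2.
  apply Rle_antisym.
  - replace 0 with (0 + -1 * 0) by ring. refine (tends_le G _ _ _ _ PG H1 H2 _).
    apply filter_forall. intros n. unfold defect. lra.
  - replace 0 with (0 + -1 * 0) by ring. refine (tends_le G _ _ _ _ PG H2 H1 _).
    apply filter_forall. intros n. unfold defect. lra. }
assert (Hlip : forall a c, a <> w -> c <> w -> b a - b c <= rho del w a c).
{ intros a c Ha Hc. replace (b a - b c) with (b a + -1 * b c) by ring.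
  refine (tends_le G _ _ _ _ PG (tends_plus G _ _ _ _ PG (Hb a Ha)
    (tends_mult G _ _ _ _ PG (tends_const G (-1) PG) (Hb c Hc)))
    (tends_const G _ PG) _).
  apply filter_forall. intros n.
  pose proof (rho_triangle w a c (p n) Ha Hc (proj1 (Hpq n))). lra. }
exists b. split; [split|].
- intros a c Ha Hc. apply Rabs_le. pose proof (Hlip a c Ha Hc). pose proof (Hlip c a Hc Ha).
  rewrite (rho_sym w c a) in *. lra.
- intros a m c Ha Hm Hc E.
  pose proof (Hconv p b (fun n => proj1 (Hpq n)) Hb a m c Ha Hm Hc E).
  pose proof (Hconv q g (fun n => proj1 (proj2 (Hpq n))) Hg a m c Ha Hm Hc E).
  pose proof (Hsum a Ha). pose proof (Hsum m Hm). pose proof (Hsum c Hc).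
  replace (g a) with (- b a) in * by lra. replace (g m) with (- b m) in * by lra.
  replace (g c) with (- b c) in * by lra. lra.
- apply Rle_antisym; [now apply Hlip|].
  replace (rho del w x y) with (rho del w x y + -5 * 0) by ring.
  replace (b x - b y) with (b x + -1 * b y) by ring.
  refine (tends_le G _ _ _ _ PG
    (tends_plus G _ _ _ _ PG (tends_const G _ PG)
      (tends_mult G _ _ _ _ PG (tends_const G (-5) PG) (tends_inv_INR G Hev)))
    (tends_plus G _ _ _ _ PG (Hb x Hx)
      (tends_mult G _ _ _ _ PG (tends_const G (-1) PG) (Hb y Hy))) _).
  apply filter_forall. intros n. destruct (Hpq n) as (_ & _ & H & _). lra.
Qed.

(** * The complement of a smooth point is a Euclidean space *)

Lemma affine_combination w :
  (forall x y, x <> w -> y <> w -> x <> y -> exists b, affine_at w b /\ b x - b y = rho del w x y) ->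
  forall (a : R * ({x | x <> w} * {x | x <> w})), exists z : {x | x <> w},
    forall b, affine_at w b -> b (proj1_sig z)
      = (1 - fst a) * b (proj1_sig (fst (snd a))) + fst a * b (proj1_sig (snd (snd a))).
Proof.
intros Hsep [t [[x Hx] [y Hy]]]. simpl.
destruct (classic (x = y)) as [<-|Hxy].
{ exists (exist _ x Hx). simpl. intros b _. ring. }
destruct (Hlines x y w Hxy Hx Hy) as (L & [HLw HL] & H0 & HT).
set (T := rho del w x y) in *. assert (PT : 0 < T) by now apply rho_pos.
(* One point serves for all [b]. The cases on [t] are the three orders of [x], [y] and this point on
   the line; values outside [0, 1] are allowed because lines are complete. *)
exists (exist _ (L (t * T)) (HLw _)). intros b [_ Hb]. simpl.
apply Rmult_eq_reg_r with T; [|lra].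
assert (Ex : forall s, rho del w x (L s) = Rabs s)
  by (intros s; rewrite <- H0, HL, <- Rabs_Ropp; f_equal; ring).
assert (Ey : forall s, rho del w y (L s) = Rabs (T - s)) by (intros s; rewrite <- HT at 1; apply HL).
pose proof (Ex (t * T)) as E1. pose proof (Ey (t * T)) as E2.
set (z := L (t * T)) in *. assert (Hz : z <> w) by apply HLw.
destruct (Rle_dec 0 t) as [Ht0|Ht0]; [destruct (Rle_dec t 1) as [Ht1|Ht1]|].
- rewrite Rabs_pos_eq in E1, E2 by nra.
  pose proof (Hb x z y Hx Hz Hy) as H. rewrite (rho_sym w z y), E1, E2 in H. fold T in H.
  specialize (H ltac:(ring)). lra.
- rewrite Rabs_pos_eq in E1 by nra. rewrite Rabs_left in E2 by nra.
  pose proof (Hb x y z Hx Hy Hz) as H. rewrite E1, E2 in H. fold T in H.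
  specialize (H ltac:(ring)). nra.
- rewrite Rabs_left in E1 by nra. rewrite Rabs_pos_eq in E2 by nra.
  pose proof (Hb z x y Hz Hx Hy) as H. rewrite (rho_sym w z x), (rho_sym w z y), E1, E2 in H.
  fold T in H. specialize (H ltac:(ring)). nra.
Qed.

(** A point at [rho]-distance 1 from [o] satisfies [del u o = del u w * d], so the triangle
    inequality keeps it at distance at least [m = d / (1 + d)] from [w]. There [rho] is at most
    [del / m ^ 2], and a finite net of mesh [m ^ 2 / 2] with pigeonholes applies. *)
Lemma unit_sphere_totally_bounded w o : o <> w ->
  exists M, forall u : nat -> X, (forall i, u i <> w) ->
    (forall i, (i < M)%nat -> rho del w (u i) o = 1) ->
    exists i j, (i < j)%nat /\ (j < M)%nat /\ rho del w (u i) (u j) < 1.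
Proof.
intros Ho. set (d := del o w). assert (Hd : 0 < d) by now apply del_pos.
set (m := d / (1 + d)). assert (Hm : 0 < m) by (apply Rdiv_lt_0_compat; lra).
destruct (finite_net (m ^ 2 / 2)) as [l Hl]; [nra|].
exists (S (length l)). intros u Huw Hu.
destruct (pigeonhole l (fun i y => del (u i) y < m ^ 2 / 2)) as (i & j & y & Hij & Hj & Hi & Hj');
  [intros i; apply Hl|].
exists i, j. split; [exact Hij|]. split; [exact Hj|].
assert (Hfar : forall k, (k < S (length l))%nat -> m <= del (u k) w).
{ intros k Hk. specialize (Hu k Hk). unfold rho in Hu. fold d in Hu.
  pose proof (del_pos _ _ (Huw k)) as Hp.
  assert (E : del (u k) o = del (u k) w * d).
  { apply Rmult_eq_compat_r with (r := del (u k) w * d) in Hu.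
    rewrite Rmult_1_l in Hu. rewrite <- Hu. field. lra. }
  pose proof (del_triangle o (u k) w) as Ht. rewrite (del_sym o (u k)), E in Ht. fold d in Ht.
  unfold m. apply Rmult_le_reg_r with (1 + d); [lra|].
  replace (d / (1 + d) * (1 + d)) with d by (field; lra). lra. }
pose proof (Hfar i ltac:(lia)). pose proof (Hfar j Hj).
assert (Hdij : del (u i) (u j) < m ^ 2).
{ pose proof (del_triangle (u i) y (u j)). rewrite (del_sym y (u j)) in *. lra. }
unfold rho. assert (HP : m ^ 2 <= del (u i) w * del (u j) w) by nra.
assert (HP0 : 0 < del (u i) w * del (u j) w) by nra.
apply Rmult_lt_reg_r with (del (u i) w * del (u j) w); [exact HP0|].
unfold Rdiv. rewrite Rmult_assoc, Rinv_l, Rmult_1_r by lra. lra.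
Qed.

(** Points are added and scaled along lines with [o] as origin. Vector identities are tested on
    affine functions; norm estimates too ([Hcmp]), because every distance is attained as a
    difference of values of some affine function. *)
Theorem euclidean_coordinates : exists (w : X) (m : nat) (c : nat -> X -> R),
  (forall x y, x <> w -> y <> w ->
     rho del w x y ^ 2 = sum_f_R0 (fun i => (c i x - c i y) ^ 2) m) /\
  (forall a : nat -> R, exists x, x <> w /\ forall i, (i <= m)%nat -> c i x = a i).
Proof.
destruct enough_affine_functions as [w Hsep]. exists w.
destruct (exists_neq w) as [o0 Ho]. apply not_eq_sym in Ho.
pose (V := {x | x <> w}). pose (o := exist _ o0 Ho : V).
destruct (functional_choice _ (affine_combination w Hsep)) as [comb Hcomb].
pose (P := fun v : V => proj1_sig v).
(* Twice the midpoint of [x] and [y], as seen from [o]. *)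
pose (add := fun x y : V => comb (2, (o, comb (/ 2, (x, y)))) : V).
pose (scal := fun (l : R) (x : V) => comb (l, (o, x)) : V).
pose (dual := fun f : V -> R => exists b, affine_at w b /\ forall v, f v = b (P v) - b (P o)).
pose (nn := fun v : V => rho del w (P v) (P o)).
assert (HP : forall v, P v <> w) by (intros [v Hv]; exact Hv).
assert (Aadd : forall b, affine_at w b -> forall x y : V,
   b (P (add x y)) = b (P x) + b (P y) - b (P o)).
{ intros b Hb x y. unfold add, P. rewrite (Hcomb _ b Hb). simpl fst; simpl snd.
  rewrite (Hcomb _ b Hb). simpl fst; simpl snd. field. }
assert (Ascal : forall b, affine_at w b -> forall l (x : V),
   b (P (scal l x)) = b (P o) + l * (b (P x) - b (P o))).
{ intros b Hb l x. unfold scal, P. rewrite (Hcomb _ b Hb). simpl fst; simpl snd. ring. }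
assert (Hcmp : forall (x y x' y' : V) l,
   (forall b, affine_at w b -> b (P x) - b (P y) = l * (b (P x') - b (P y'))) ->
   rho del w (P x) (P y) <= Rabs l * rho del w (P x') (P y')).
{ intros x y x' y' l H. destruct (classic (P x = P y)) as [E|E].
  - rewrite E, rho_refl. apply Rmult_le_pos; [apply Rabs_pos|now apply rho_nonneg].
  - destruct (Hsep _ _ (HP x) (HP y) E) as (b & Hb & <-). rewrite (H b Hb).
    eapply Rle_trans; [apply Rle_abs|]. rewrite Rabs_mult.
    apply Rmult_le_compat_l; [apply Rabs_pos|]. apply Hb; apply HP. }
assert (Heq : forall x y x' y' : V,
   (forall b, affine_at w b -> b (P x) - b (P y) = b (P x') - b (P y')) ->
   rho del w (P x) (P y) = rho del w (P x') (P y')).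
{ intros x y x' y' H. apply Rle_antisym.
  - rewrite <- (Rmult_1_l (rho del w (P x') (P y'))), <- (Rabs_pos_eq 1) by lra.
    apply Hcmp. intros b Hb. rewrite (H b Hb). ring.
  - rewrite <- (Rmult_1_l (rho del w (P x) (P y))), <- (Rabs_pos_eq 1) by lra.
    apply Hcmp. intros b Hb. rewrite (H b Hb). ring. }
assert (Hsub : forall x y : V, nn (add x (scal (-1) y)) = rho del w (P x) (P y)).
{ intros x y. apply Heq. intros b Hb. rewrite (Aadd b Hb), (Ascal b Hb). ring. }
assert (Hscal : forall l x, nn (scal l x) <= Rabs l * nn x).
{ intros l x. apply Hcmp. intros b Hb. rewrite (Ascal b Hb). ring. }
destruct (unit_sphere_totally_bounded w o0 Ho) as [M HM].
destruct (rhombus_norm_euclidean add scal o dual nn) with (M := M) as (m & c & Hc & Hsurj).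
- intros f (b & Hb & Hf) x y. rewrite !Hf, (Aadd b Hb). ring.
- intros f (b & Hb & Hf) l x. rewrite !Hf, (Ascal b Hb). ring.
- intros f (b & Hb & Hf). rewrite Hf. ring.
- intros x y H. destruct (classic (P x = P y)) as [E|E].
  + destruct x as [x Hx], y as [y Hy]. simpl in E. subst y. f_equal. apply proof_irrelevance.
  + exfalso. destruct (Hsep _ _ (HP x) (HP y) E) as (b & Hb & Hxy).
    pose proof (rho_pos w _ _ (HP x) (HP y) E).
    specialize (H (fun v => b (P v) - b (P o)) ltac:(now exists b)). simpl in H. lra.
- intros x Hx. apply rho_pos; try apply HP. intros E. apply Hx.
  destruct x as [x Hx']. unfold o. simpl in E. subst x. f_equal. apply proof_irrelevance.
- intros l x. apply Rle_antisym; [apply Hscal|].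
  destruct (Req_dec l 0) as [->|Hl].
  + rewrite Rabs_R0, Rmult_0_l. apply rho_nonneg; apply HP.
  + assert (E : nn x <= Rabs (/ l) * nn (scal l x)).
    { apply Hcmp. intros b Hb. rewrite (Ascal b Hb). field. exact Hl. }
    pose proof (Rabs_pos_lt l Hl). rewrite Rabs_inv in E.
    apply Rmult_le_compat_l with (r := Rabs l) in E; [|lra].
    rewrite <- Rmult_assoc, Rinv_r, Rmult_1_l in E by lra. exact E.
- intros x y. destruct (classic (P (add x y) = P o)) as [E|E].
  + unfold nn at 1. rewrite E, rho_refl. apply Rplus_le_le_0_compat; apply rho_nonneg; apply HP.
  + destruct (Hsep _ _ (HP (add x y)) (HP o) E) as (b & Hb & Hxy).
    unfold nn at 1. rewrite <- Hxy, (Aadd b Hb).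
    pose proof (Rle_trans _ _ _ (Rle_abs _) (proj1 Hb _ _ (HP x) (HP o))).
    pose proof (Rle_trans _ _ _ (Rle_abs _) (proj1 Hb _ _ (HP y) (HP o))).
    unfold nn. lra.
(* The rhombus inequality is Ptolemy's inequality for [x], [-x], [y], [-y]: the diagonals are
   [2 * nn x] and [2 * nn y], the sides are the norms of [x + y] and [x - y], each twice. *)
- intros x y. pose (x' := scal (-1) x). pose (y' := scal (-1) y).
  assert (Htwice : forall v : V, rho del w (P v) (P (scal (-1) v)) = 2 * nn v).
  { intros v. apply Rle_antisym.
    - rewrite <- (Rabs_pos_eq 2) by lra. apply Hcmp. intros b Hb. rewrite (Ascal b Hb). ring.
    - assert (E : nn v <= Rabs (/ 2) * rho del w (P v) (P (scal (-1) v))).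
      { apply Hcmp. intros b Hb. rewrite (Ascal b Hb). field. }
      rewrite Rabs_pos_eq in E by lra. lra. }
  pose proof (rho_ptolemy w (P x) (P x') (P y) (P y') (HP _) (HP _) (HP _) (HP _)) as H.
  unfold x', y' in H. rewrite !Htwice in H.
  rewrite (Heq (scal (-1) x) (scal (-1) y) y x) in H
    by (intros b Hb; rewrite !(Ascal b Hb); ring).
  rewrite (Heq x (scal (-1) y) (add x y) o), (Heq (scal (-1) x) y o (add x y)) in H
    by (intros b Hb; rewrite (Ascal b Hb), (Aadd b Hb); ring).
  rewrite (rho_sym w (P o)), (rho_sym w (P y) (P x)) in H. rewrite Hsub.
  unfold nn in *. lra.
- intros u Hu. destruct (HM (fun i => P (u i))) as (i & j & Hij & Hj & H).
  + intros i. apply HP.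
  + exact Hu.
  + exists i, j. rewrite Hsub. auto.
- destruct (exists_neq o0) as [z0 Hz0]. destruct (classic (z0 = w)) as [Ez|Ez].
  (* The other known point may be [w] itself; a point near [w] then serves instead. *)
  + destruct (no_isolated_point w 1 (o0 :: w :: nil) ltac:(lra)) as (z & _ & Hz).
    assert (Hzw : z <> w) by (intros ->; apply Hz; simpl; auto).
    exists (exist _ z Hzw). intros E. apply Hz. left. now inversion E.
  + exists (exist _ z0 Ez). intros E. apply Hz0. now inversion E.
(* The coordinates live on a subtype; they are extended to [X] by 0 at [w], consistently by proof
   irrelevance. *)
- destruct (functional_choice (fun (v : nat * X) (r : R) => forall H : snd v <> w,
    r = c (fst v) (exist _ (snd v) H))) as [c' Hc'].
  { intros [i x]. simpl. destruct (classic (x = w)) as [E|E].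
    - exists 0. intros H. contradiction.
    - exists (c i (exist _ x E)). intros H. do 2 f_equal. apply proof_irrelevance. }
  exists m, (fun i x => c' (i, x)). split.
  + intros x y Hx Hy. transitivity (rho del w (P (exist _ x Hx)) (P (exist _ y Hy)) ^ 2);
      [reflexivity|]. rewrite <- Hsub, Hc. apply sum_eq. intros i _.
    rewrite (Hc' (i, x) Hx), (Hc' (i, y) Hy). reflexivity.
  + intros a. destruct (Hsurj a) as [[x Hx] Ha]. exists x. split; [exact Hx|].
    intros i Hi. rewrite (Hc' (i, x) Hx). now apply Ha.
Qed.

End Moebius.

(** * Circles as lines *)

Definition circle_pt (x y : R) (i : nat) : R :=
  match i with O => x | S O => y | _ => 0 end.

Lemma circle_pt_sphere x y : x ^ 2 + y ^ 2 = 1 -> sphere_pt 1 (circle_pt x y).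
Proof.
intros H. split; [|exact H].
intros [|[|i]] Hi; [lia|lia|reflexivity].
Qed.

Lemma sphere_ext (n : nat) (p q : Sphere n) :
  (forall i, (i <= n)%nat -> proj1_sig p i = proj1_sig q i) -> p = q.
Proof.
destruct p as [u [Hu Hu2]], q as [v [Hv Hv2]]. simpl. intros H.
assert (E : u = v).
{ extensionality i. destruct (le_dec i n) as [Hi|Hi]; [now apply H|].
  rewrite Hu, Hv by lia. reflexivity. }
subst v. f_equal. apply proof_irrelevance.
Qed.

Lemma circle_ext (p q : Sphere 1) :
  proj1_sig p 0%nat = proj1_sig q 0%nat -> proj1_sig p 1%nat = proj1_sig q 1%nat -> p = q.
Proof.
intros H0 H1. apply sphere_ext. intros [|[|i]] Hi; [exact H0|exact H1|lia].
Qed.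

Lemma circle_eq (p : Sphere 1) : proj1_sig p 0%nat ^ 2 + proj1_sig p 1%nat ^ 2 = 1.
Proof. destruct p as [v [H1 H2]]. exact H2. Qed.

Definition hyp (a b : R) : R := sqrt (a ^ 2 + b ^ 2).

Lemma hyp_nonneg a b : 0 <= hyp a b. Proof. apply sqrt_pos. Qed.

Lemma hyp_sqr a b : hyp a b ^ 2 = a ^ 2 + b ^ 2.
Proof. apply pow2_sqrt. nra. Qed.

Lemma hyp_triangle a b c d : hyp (a + c) (b + d) <= hyp a b + hyp c d.
Proof.
pose proof (hyp_nonneg a b). pose proof (hyp_nonneg c d). pose proof (hyp_nonneg (a + c) (b + d)).
pose proof (hyp_sqr a b) as E1. pose proof (hyp_sqr c d) as E2.
pose proof (hyp_sqr (a + c) (b + d)) as E3.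
assert (Hcs : a * c + b * d <= hyp a b * hyp c d).
{ assert (E : (hyp a b * hyp c d) ^ 2 = (a * c + b * d) ^ 2 + (a * d - b * c) ^ 2).
  { rewrite Rpow_mult_distr, E1, E2. ring. }
  assert (0 <= hyp a b * hyp c d) by now apply Rmult_le_pos.
  pose proof (pow2_ge_0 (a * d - b * c)).
  destruct (Rle_dec (a * c + b * d) (hyp a b * hyp c d)); [assumption|nra]. }
assert (hyp (a + c) (b + d) ^ 2 <= (hyp a b + hyp c d) ^ 2) by nra.
destruct (Rle_dec (hyp (a + c) (b + d)) (hyp a b + hyp c d)); [assumption|nra].
Qed.

Lemma hyp_le_Rabs a b : hyp a b <= Rabs a + Rabs b.
Proof.
pose proof (hyp_nonneg a b). pose proof (hyp_sqr a b) as E.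
rewrite <- (pow2_abs a), <- (pow2_abs b) in E.
pose proof (Rabs_pos a). pose proof (Rabs_pos b).
destruct (Rle_dec (hyp a b) (Rabs a + Rabs b)); [assumption|nra].
Qed.

Lemma Rabs_le_hyp a b : Rabs a <= hyp a b /\ Rabs b <= hyp a b.
Proof.
pose proof (hyp_nonneg a b). pose proof (hyp_sqr a b) as E.
rewrite <- (pow2_abs a), <- (pow2_abs b) in E.
pose proof (Rabs_pos a). pose proof (Rabs_pos b).
split; apply Rnot_lt_le; intros Hn; nra.
Qed.

Lemma d0_circle (p q : Sphere 1) : d0 1 p q =
  Finite (hyp (proj1_sig p 0%nat - proj1_sig q 0%nat) (proj1_sig p 1%nat - proj1_sig q 1%nat)).
Proof. reflexivity. Qed.

Lemma circle_open_near (V : Sphere 1 -> Prop) p : is_open (d0 1) noOm V -> V p ->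
  exists e, 0 < e /\ forall q, hyp (proj1_sig q 0%nat - proj1_sig p 0%nat)
      (proj1_sig q 1%nat - proj1_sig p 1%nat) < e -> V q.
Proof.
intros HV Hp. destruct (HV p Hp) as (x & r & _ & Hx).
set (x0 := proj1_sig x 0%nat) in *. set (x1 := proj1_sig x 1%nat) in *.
rewrite d0_circle in Hx. setoid_rewrite d0_circle in Hx. simpl in Hx. fold x0 x1 in Hx.
set (p0 := proj1_sig p 0%nat) in *. set (p1 := proj1_sig p 1%nat) in *.
destruct Hx as [[Hr HU]|[Hr HU]].
- exists (r - hyp (x0 - p0) (x1 - p1)). split; [lra|]. intros q Hq. apply HU.
  set (q0 := proj1_sig q 0%nat) in *. set (q1 := proj1_sig q 1%nat) in *.
  pose proof (hyp_triangle (x0 - p0) (x1 - p1) (p0 - q0) (p1 - q1)) as H.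
  replace (x0 - p0 + (p0 - q0)) with (x0 - q0) in H by ring.
  replace (x1 - p1 + (p1 - q1)) with (x1 - q1) in H by ring.
  replace (hyp (p0 - q0) (p1 - q1)) with (hyp (q0 - p0) (q1 - p1)) in H
    by (unfold hyp; f_equal; ring). lra.
- exists (hyp (x0 - p0) (x1 - p1) - r). split; [lra|]. intros q Hq. apply HU.
  set (q0 := proj1_sig q 0%nat) in *. set (q1 := proj1_sig q 1%nat) in *.
  pose proof (hyp_triangle (x0 - q0) (x1 - q1) (q0 - p0) (q1 - p1)) as H.
  replace (x0 - q0 + (q0 - p0)) with (x0 - p0) in H by ring.
  replace (x1 - q1 + (q1 - p1)) with (x1 - p1) in H by ring. lra.
Qed.

(** The signed area whose sign tells on which side of the chord from [x] to [z] the point [q]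
    lies. *)
Definition side (x z q : Sphere 1) : R :=
  (proj1_sig z 0%nat - proj1_sig x 0%nat) * (proj1_sig q 1%nat - proj1_sig x 1%nat)
  - (proj1_sig z 1%nat - proj1_sig x 1%nat) * (proj1_sig q 0%nat - proj1_sig x 0%nat).

Lemma coordinate_bound (p : Sphere 1) :
  -1 <= proj1_sig p 0%nat <= 1 /\ -1 <= proj1_sig p 1%nat <= 1.
Proof. pose proof (circle_eq p). split; nra. Qed.

Lemma side_open x z (s : R) : is_open (d0 1) noOm (fun q => 0 < s * side x z q).
Proof.
intros p Hp.
assert (Hs : s <> 0) by (intros ->; lra). apply Rabs_pos_lt in Hs.
(* [side x z] is 4-Lipschitz, since the coordinates of [z - x] are at most 2 in absolute value. *)
exists p, (s * side x z p / (4 * Rabs s)). split; [intros []|]. left.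
assert (Hr : 0 < s * side x z p / (4 * Rabs s)) by (apply Rdiv_lt_0_compat; lra).
rewrite d0_circle. setoid_rewrite d0_circle. simpl. split.
- rewrite !Rminus_diag. unfold hyp. replace (0 ^ 2 + 0 ^ 2) with 0 by ring. rewrite sqrt_0. exact Hr.
- intros q Hq.
  destruct (Rabs_le_hyp (proj1_sig p 0%nat - proj1_sig q 0%nat)
    (proj1_sig p 1%nat - proj1_sig q 1%nat)) as [H0 H1].
  set (r := s * side x z p / (4 * Rabs s)) in *.
  assert (E : s * side x z p = 4 * Rabs s * r) by (unfold r; field; lra).
  assert (D : Rabs (side x z p - side x z q) < 4 * r).
  { unfold side.
    replace ((proj1_sig z 0%nat - proj1_sig x 0%nat) * (proj1_sig p 1%nat - proj1_sig x 1%nat)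
      - (proj1_sig z 1%nat - proj1_sig x 1%nat) * (proj1_sig p 0%nat - proj1_sig x 0%nat)
      - ((proj1_sig z 0%nat - proj1_sig x 0%nat) * (proj1_sig q 1%nat - proj1_sig x 1%nat)
      - (proj1_sig z 1%nat - proj1_sig x 1%nat) * (proj1_sig q 0%nat - proj1_sig x 0%nat)))
      with ((proj1_sig z 0%nat - proj1_sig x 0%nat) * (proj1_sig p 1%nat - proj1_sig q 1%nat)
      + - (proj1_sig z 1%nat - proj1_sig x 1%nat) * (proj1_sig p 0%nat - proj1_sig q 0%nat)) by ring.
    eapply Rle_lt_trans; [apply Rabs_triang|]. rewrite !Rabs_mult, Rabs_Ropp.
    pose proof (coordinate_bound x). pose proof (coordinate_bound z).
    assert (Rabs (proj1_sig z 0%nat - proj1_sig x 0%nat) <= 2) by (apply Rabs_le; lra).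
    assert (Rabs (proj1_sig z 1%nat - proj1_sig x 1%nat) <= 2) by (apply Rabs_le; lra).
    pose proof (Rabs_pos (proj1_sig p 0%nat - proj1_sig q 0%nat)).
    pose proof (Rabs_pos (proj1_sig p 1%nat - proj1_sig q 1%nat)). nra. }
  replace (s * side x z q) with (4 * Rabs s * r - s * (side x z p - side x z q))
    by (rewrite <- E; ring).
  pose proof (Rle_abs (s * (side x z p - side x z q))) as H. rewrite Rabs_mult in H.
  apply Rmult_lt_compat_l with (r := Rabs s) in D; lra.
Qed.

(** On the line through [x] and [z] one has [q = x + l * (z - x)], and lying on the circle forces
    [l * (l - 1) = 0]. *)
Lemma side_zero x z q : x <> z -> side x z q = 0 -> q = x \/ q = z.
Proof.
intros Hxz H. unfold side in H.
pose proof (circle_eq x) as Ex. pose proof (circle_eq z) as Ez. pose proof (circle_eq q) as Eq.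
set (x0 := proj1_sig x 0%nat) in *. set (x1 := proj1_sig x 1%nat) in *.
set (z0 := proj1_sig z 0%nat) in *. set (z1 := proj1_sig z 1%nat) in *.
set (q0 := proj1_sig q 0%nat) in *. set (q1 := proj1_sig q 1%nat) in *.
set (D := (z0 - x0) ^ 2 + (z1 - x1) ^ 2).
assert (HD : 0 < D).
{ destruct (Req_dec (z0 - x0) 0) as [H0|H0]; [destruct (Req_dec (z1 - x1) 0) as [H1|H1]|].
  - exfalso. apply Hxz. apply circle_ext; fold x0 x1 z0 z1; lra.
  - unfold D. apply Rplus_le_lt_0_compat; [apply pow2_ge_0|now apply pow2_gt_0].
  - unfold D. apply Rplus_lt_le_0_compat; [now apply pow2_gt_0|apply pow2_ge_0]. }
set (l := ((q0 - x0) * (z0 - x0) + (q1 - x1) * (z1 - x1)) / D).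
assert (E0 : q0 - x0 = l * (z0 - x0)).
{ apply Rmult_eq_reg_r with D; [|lra].
  replace (l * (z0 - x0) * D) with (((q0 - x0) * (z0 - x0) + (q1 - x1) * (z1 - x1)) * (z0 - x0))
    by (unfold l; field; lra).
  unfold D. replace ((q0 - x0) * ((z0 - x0) ^ 2 + (z1 - x1) ^ 2))
    with ((q0 - x0) * (z0 - x0) ^ 2 + (z1 - x1) * ((z1 - x1) * (q0 - x0))) by ring.
  replace ((z1 - x1) * (q0 - x0)) with ((z0 - x0) * (q1 - x1)) by lra. ring. }
assert (E1 : q1 - x1 = l * (z1 - x1)).
{ apply Rmult_eq_reg_r with D; [|lra].
  replace (l * (z1 - x1) * D) with (((q0 - x0) * (z0 - x0) + (q1 - x1) * (z1 - x1)) * (z1 - x1))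
    by (unfold l; field; lra).
  unfold D. replace ((q1 - x1) * ((z0 - x0) ^ 2 + (z1 - x1) ^ 2))
    with ((q1 - x1) * (z1 - x1) ^ 2 + (z0 - x0) * ((z0 - x0) * (q1 - x1))) by ring.
  replace ((z0 - x0) * (q1 - x1)) with ((z1 - x1) * (q0 - x0)) by lra. ring. }
assert (Eb : 2 * (x0 * (z0 - x0) + x1 * (z1 - x1)) = - D) by (unfold D; nra).
assert (El : l * (l - 1) * D = 0).
{ replace (l * (l - 1) * D) with (l * (2 * (x0 * (z0 - x0) + x1 * (z1 - x1))) + l ^ 2 * D)
    by (rewrite Eb; ring).
  unfold D. replace (l * (2 * (x0 * (z0 - x0) + x1 * (z1 - x1))) +
     l ^ 2 * ((z0 - x0) ^ 2 + (z1 - x1) ^ 2))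
   with ((x0 + l * (z0 - x0)) ^ 2 + (x1 + l * (z1 - x1)) ^ 2 - (x0 ^ 2 + x1 ^ 2)) by ring.
  rewrite <- E0, <- E1, Ex. replace (x0 + (q0 - x0)) with q0 by ring.
  replace (x1 + (q1 - x1)) with q1 by ring. lra. }
apply Rmult_integral in El. destruct El as [El|El]; [|lra].
apply Rmult_integral in El. destruct El as [El|El].
- left. rewrite El in E0, E1. apply circle_ext; fold x0 x1 q0 q1; lra.
- right. assert (l = 1) by lra. rewrite H0 in E0, E1.
  apply circle_ext; fold z0 z1 q0 q1; lra.
Qed.

(* Inverse stereographic projection from [(1, 0)], rotated so that the centre becomes [c]. *)
Lemma stereo_eq (c : Sphere 1) t :
  (proj1_sig c 0%nat * ((t ^ 2 - 1) / (t ^ 2 + 1)) - proj1_sig c 1%nat * (2 * t / (t ^ 2 + 1))) ^ 2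
  + (proj1_sig c 0%nat * (2 * t / (t ^ 2 + 1)) + proj1_sig c 1%nat * ((t ^ 2 - 1) / (t ^ 2 + 1))) ^ 2
  = 1.
Proof.
pose proof (circle_eq c) as Ec. set (c0 := proj1_sig c 0%nat) in *. set (c1 := proj1_sig c 1%nat) in *.
transitivity (c0 ^ 2 + c1 ^ 2); [field; nra|exact Ec].
Qed.

Definition stereo (c : Sphere 1) (t : R) : Sphere 1 :=
  exist _ _ (circle_pt_sphere _ _ (stereo_eq c t)).

Lemma stereo_0 c t : proj1_sig (stereo c t) 0%nat =
  proj1_sig c 0%nat * ((t ^ 2 - 1) / (t ^ 2 + 1)) - proj1_sig c 1%nat * (2 * t / (t ^ 2 + 1)).
Proof. reflexivity. Qed.

Lemma stereo_1 c t : proj1_sig (stereo c t) 1%nat =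
  proj1_sig c 0%nat * (2 * t / (t ^ 2 + 1)) + proj1_sig c 1%nat * ((t ^ 2 - 1) / (t ^ 2 + 1)).
Proof. reflexivity. Qed.

Lemma stereo_neq c t : stereo c t <> c.
Proof.
intros E. pose proof (circle_eq c) as Ec.
pose proof (stereo_0 c t) as E0. pose proof (stereo_1 c t) as E1. rewrite E in E0, E1. symmetry in E0, E1.
set (c0 := proj1_sig c 0%nat) in *. set (c1 := proj1_sig c 1%nat) in *.
set (A := (t ^ 2 - 1) / (t ^ 2 + 1)) in *. set (B := 2 * t / (t ^ 2 + 1)) in *.
assert (HA : A = 1).
{ replace A with (c0 * (c0 * A - c1 * B) + c1 * (c0 * B + c1 * A)).
  - rewrite E0, E1. lra.
  - replace (c0 * (c0 * A - c1 * B) + c1 * (c0 * B + c1 * A)) with ((c0 ^ 2 + c1 ^ 2) * A) by ring.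
    rewrite Ec. ring. }
unfold A in HA. apply Rmult_eq_compat_r with (r := t ^ 2 + 1) in HA.
unfold Rdiv in HA. rewrite Rmult_assoc, Rinv_l in HA by nra. lra.
Qed.

Lemma stereo_surjective c p : p <> c -> exists t, stereo c t = p.
Proof.
intros Hp. pose proof (circle_eq c) as Ec. pose proof (circle_eq p) as Ep.
set (c0 := proj1_sig c 0%nat) in *. set (c1 := proj1_sig c 1%nat) in *.
set (p0 := proj1_sig p 0%nat) in *. set (p1 := proj1_sig p 1%nat) in *.
set (A := c0 * p0 + c1 * p1). set (B := c0 * p1 - c1 * p0).
assert (E1 : A ^ 2 + B ^ 2 = 1).
{ transitivity ((c0 ^ 2 + c1 ^ 2) * (p0 ^ 2 + p1 ^ 2)); [unfold A, B; ring|rewrite Ec, Ep; ring]. }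
assert (P0 : p0 = c0 * A - c1 * B).
{ transitivity ((c0 ^ 2 + c1 ^ 2) * p0); [rewrite Ec; ring|unfold A, B; ring]. }
assert (P1 : p1 = c0 * B + c1 * A).
{ transitivity ((c0 ^ 2 + c1 ^ 2) * p1); [rewrite Ec; ring|unfold A, B; ring]. }
assert (HA : A <> 1).
{ intros HA. assert (HB : B = 0) by (rewrite HA in E1; nra). rewrite HA, HB in *.
  apply Hp. apply circle_ext; fold c0 c1 p0 p1; lra. }
assert (E2 : B ^ 2 = (1 - A) * (1 + A)) by lra.
assert (Ht : (B / (1 - A)) ^ 2 + 1 = 2 / (1 - A)).
{ transitivity ((B ^ 2 + (1 - A) ^ 2) / (1 - A) ^ 2); [field; lra|]. rewrite E2. field. lra. }
assert (EA : ((B / (1 - A)) ^ 2 - 1) / ((B / (1 - A)) ^ 2 + 1) = A).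
{ replace ((B / (1 - A)) ^ 2 - 1) with (2 / (1 - A) - 2) by (rewrite <- Ht; ring).
  rewrite Ht. field. lra. }
assert (EB : 2 * (B / (1 - A)) / ((B / (1 - A)) ^ 2 + 1) = B).
{ rewrite Ht. field. lra. }
exists (B / (1 - A)). apply circle_ext; rewrite ?stereo_0, ?stereo_1, EA, EB;
  fold c0 c1 p0 p1; congruence.
Qed.

(** Compared with [side_stereo_base]: for [t1 < t2 < t3] the signs are opposite, so [c] and the
    point of parameter [t2] are on different sides of the chord. *)
Lemma side_stereo c t1 t2 t3 : side (stereo c t1) (stereo c t3) (stereo c t2)
  = 4 * (t3 - t1) * (t3 - t2) * (t2 - t1) / ((t1 ^ 2 + 1) * (t2 ^ 2 + 1) * (t3 ^ 2 + 1)).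
Proof.
unfold side. rewrite !stereo_0, !stereo_1. pose proof (circle_eq c) as Ec.
set (c0 := proj1_sig c 0%nat) in *. set (c1 := proj1_sig c 1%nat) in *.
transitivity ((c0 ^ 2 + c1 ^ 2) * (4 * (t3 - t1) * (t3 - t2) * (t2 - t1) /
  ((t1 ^ 2 + 1) * (t2 ^ 2 + 1) * (t3 ^ 2 + 1)))).
- field. repeat split; nra.
- rewrite Ec. ring.
Qed.

Lemma side_stereo_base c t1 t3 : side (stereo c t1) (stereo c t3) c
  = - (4 * (t3 - t1) / ((t1 ^ 2 + 1) * (t3 ^ 2 + 1))).
Proof.
unfold side. rewrite !stereo_0, !stereo_1. pose proof (circle_eq c) as Ec.
set (c0 := proj1_sig c 0%nat) in *. set (c1 := proj1_sig c 1%nat) in *.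
transitivity ((c0 ^ 2 + c1 ^ 2) * - (4 * (t3 - t1) / ((t1 ^ 2 + 1) * (t3 ^ 2 + 1)))).
- field. repeat split; nra.
- rewrite Ec. ring.
Qed.

Lemma stereo_injective c s t : stereo c s = stereo c t -> s = t.
Proof.
intros E. apply NNPP; intros Hn.
pose proof (side_stereo_base c s t) as H. unfold side in H. rewrite E in H.
rewrite !Rminus_diag, !Rmult_0_l, Rminus_diag in H.
assert (0 < (s ^ 2 + 1) * (t ^ 2 + 1)) by nra.
assert (H1 : 4 * (t - s) = 0).
{ apply Rmult_eq_reg_r with (/ ((s ^ 2 + 1) * (t ^ 2 + 1))); [|apply Rinv_neq_0_compat; lra].
  unfold Rdiv in H. lra. }
lra.
Qed.

Lemma hyp_rotation_bound (c : Sphere 1) a b m : Rabs a <= m -> Rabs b <= m ->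
  hyp (proj1_sig c 0%nat * a - proj1_sig c 1%nat * b)
      (proj1_sig c 0%nat * b + proj1_sig c 1%nat * a) <= 4 * m.
Proof.
intros Ha Hb. eapply Rle_trans; [apply hyp_le_Rabs|].
destruct (coordinate_bound c) as [H0 H1].
assert (K0 : Rabs (proj1_sig c 0%nat) <= 1) by now apply Rabs_le.
assert (K1 : Rabs (proj1_sig c 1%nat) <= 1) by now apply Rabs_le.
pose proof (Rabs_pos a). pose proof (Rabs_pos b).
assert (Hm : forall u v, Rabs u <= 1 -> Rabs v <= m -> Rabs (u * v) <= m).
{ intros u v Hu Hv. rewrite Rabs_mult. pose proof (Rabs_pos u). pose proof (Rabs_pos v). nra. }
pose proof (Rabs_triang (proj1_sig c 0%nat * a) (- (proj1_sig c 1%nat * b))) as T1.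
pose proof (Rabs_triang (proj1_sig c 0%nat * b) (proj1_sig c 1%nat * a)) as T2.
rewrite Rabs_Ropp in T1. unfold Rminus.
pose proof (Hm _ _ K0 Ha). pose proof (Hm _ _ K0 Hb). pose proof (Hm _ _ K1 Ha).
pose proof (Hm _ _ K1 Hb). lra.
Qed.

Lemma stereo_lipschitz c s t :
  hyp (proj1_sig (stereo c s) 0%nat - proj1_sig (stereo c t) 0%nat)
      (proj1_sig (stereo c s) 1%nat - proj1_sig (stereo c t) 1%nat) <= 8 * Rabs (s - t).
Proof.
rewrite !stereo_0, !stereo_1.
set (a := (s ^ 2 - 1) / (s ^ 2 + 1) - (t ^ 2 - 1) / (t ^ 2 + 1)).
set (b := 2 * s / (s ^ 2 + 1) - 2 * t / (t ^ 2 + 1)).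
assert (HP : 0 < (s ^ 2 + 1) * (t ^ 2 + 1)) by nra.
assert (Key : forall k, Rabs k <= (s ^ 2 + 1) * (t ^ 2 + 1) ->
  Rabs (2 * (s - t) * k / ((s ^ 2 + 1) * (t ^ 2 + 1))) <= 2 * Rabs (s - t)).
{ intros k Hk. unfold Rdiv. rewrite !Rabs_mult, (Rabs_pos_eq 2) by lra.
  rewrite (Rabs_pos_eq (/ _)) by (apply Rlt_le, Rinv_0_lt_compat, HP).
  apply Rmult_le_reg_r with ((s ^ 2 + 1) * (t ^ 2 + 1)); [exact HP|].
  rewrite Rmult_assoc, Rinv_l, Rmult_1_r by lra.
  apply Rmult_le_compat_l; [|exact Hk]. pose proof (Rabs_pos (s - t)). lra. }
assert (Ha : Rabs a <= 2 * Rabs (s - t)).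
{ replace a with (2 * (s - t) * (s + t) / ((s ^ 2 + 1) * (t ^ 2 + 1)))
    by (unfold a; field; split; nra).
  apply Key. apply Rabs_le.
  pose proof (pow2_ge_0 (s - / 2)). pose proof (pow2_ge_0 (t - / 2)).
  pose proof (pow2_ge_0 (s + / 2)). pose proof (pow2_ge_0 (t + / 2)).
  pose proof (pow2_ge_0 (s * t)). split; lra. }
assert (Hb : Rabs b <= 2 * Rabs (s - t)).
{ replace b with (2 * (s - t) * (1 - s * t) / ((s ^ 2 + 1) * (t ^ 2 + 1)))
    by (unfold b; field; split; nra).
  apply Key. apply Rabs_le.
  pose proof (pow2_ge_0 (s - t)). pose proof (pow2_ge_0 (s + t)).
  pose proof (pow2_ge_0 (s * t)). pose proof (pow2_ge_0 s). pose proof (pow2_ge_0 t). split; lra. }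
pose proof (hyp_rotation_bound c a b (2 * Rabs (s - t)) Ha Hb) as H.
replace (8 * Rabs (s - t)) with (4 * (2 * Rabs (s - t))) by ring.
eapply Rle_trans; [|exact H]. right. unfold a, b. f_equal; ring.
Qed.

Lemma stereo_at_infinity c t : 1 <= Rabs t ->
  hyp (proj1_sig (stereo c t) 0%nat - proj1_sig c 0%nat)
      (proj1_sig (stereo c t) 1%nat - proj1_sig c 1%nat) <= 8 * / Rabs t.
Proof.
intros Ht. rewrite stereo_0, stereo_1.
set (a := (t ^ 2 - 1) / (t ^ 2 + 1) - 1). set (b := 2 * t / (t ^ 2 + 1)).
set (u := Rabs t) in *. assert (Eu : t ^ 2 = u ^ 2) by (symmetry; apply pow2_abs).
assert (Hi : 0 < / (t ^ 2 + 1)) by (apply Rinv_0_lt_compat; nra).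
assert (Ha : Rabs a <= 2 * / u).
{ replace a with (- (2 * / (t ^ 2 + 1))) by (unfold a; field; nra).
  rewrite Rabs_Ropp, Rabs_pos_eq by lra. apply Rmult_le_compat_l; [lra|].
  apply Rinv_le_contravar; [lra|]. rewrite Eu. nra. }
assert (Hb : Rabs b <= 2 * / u).
{ unfold b, Rdiv. rewrite !Rabs_mult, (Rabs_pos_eq 2), (Rabs_pos_eq (/ _)) by lra. fold u.
  rewrite Rmult_assoc. apply Rmult_le_compat_l; [lra|].
  apply Rmult_le_reg_r with (u * (t ^ 2 + 1)); [nra|].
  replace (u * / (t ^ 2 + 1) * (u * (t ^ 2 + 1))) with (u ^ 2) by (field; nra).
  replace (/ u * (u * (t ^ 2 + 1))) with (t ^ 2 + 1) by (field; lra). rewrite Eu. lra. }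
pose proof (hyp_rotation_bound c a b (2 * / u) Ha Hb) as H.
replace (8 * / u) with (4 * (2 * / u)) by ring.
eapply Rle_trans; [|exact H]. right. unfold a, b. f_equal; ring.
Qed.

(** * Circles through a point are lines once that point is remote *)

Section Circles.

Context {X : Type} (d : X -> X -> Rbar) (Om : X -> Prop) (W : X -> R).
Hypothesis HW : forall x, 0 < W x.

Let del (x y : X) : R := pf d x y / (W x * W y).

Hypothesis Hdel : ptolemaic del.
Hypothesis Hopen : forall U, metric_open del U -> is_open d Om U.

Section OneCircle.

Context (sigma : X -> Prop) (h : Sphere 1 -> X).
Hypothesis Hh : homeo_S1_onto d Om sigma h.
Hypothesis Hpt : forall x y z w, sigma x -> sigma y -> sigma z -> sigma w ->
  x <> y -> x <> z -> x <> w -> y <> z -> y <> w -> z <> w ->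
  diff_components d Om (fun p => sigma p /\ p <> x /\ p <> z) y w ->
  pf d x z * pf d y w = pf d x y * pf d z w + pf d x w * pf d y z.

Lemma circle_continuous p e : 0 < e -> exists eta, 0 < eta /\ forall q,
  hyp (proj1_sig q 0%nat - proj1_sig p 0%nat) (proj1_sig q 1%nat - proj1_sig p 1%nat) < eta ->
  del (h q) (h p) < e.
Proof.
intros He. destruct Hh as (_ & _ & Hc & _).
apply (circle_open_near (fun q => del (h q) (h p) < e)).
- apply (Hc (fun y => del y (h p) < e)). apply Hopen. now apply ball_open.
- now rewrite (proj1 Hdel).
Qed.

(** The two open arcs are traces of open sets of [X] because [h] is a homeomorphism onto its image.
    They cover the circle without [h x] and [h z], so no connected subset meets both. *)
Lemma opposite_sides x z y w : x <> z -> side x z y * side x z w < 0 ->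
  diff_components d Om (fun p => sigma p /\ p <> h x /\ p <> h z) (h y) (h w).
Proof.
intros Hxz Hyw. destruct Hh as (Hinj & Hsig & _ & Ho).
assert (Hs : forall p, sigma (h p)) by (intros p; apply Hsig; now exists p).
assert (Hz0 : side x z z = 0) by (unfold side; ring).
assert (Hx0 : side x z x = 0) by (unfold side; ring).
split; [|split].
- split; [apply Hs|]. split; intros E; apply Hinj in E; subst y; nra.
- split; [apply Hs|]. split; intros E; apply Hinj in E; subst w; nra.
- intros (C & HC & Cy & Cw & Hconn). apply Hconn.
  destruct (Ho _ (side_open x z (side x z y))) as (U & HU & EU).
  destruct (Ho _ (side_open x z (side x z w))) as (V & HV & EV).
  exists U, V. split; [exact HU|]. split; [exact HV|]. split; [|split; [|split]].
  + intros p Cp. destruct (HC p Cp) as (Sp & Hpx & Hpz). apply Hsig in Sp. destruct Sp as [q <-].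
    assert (Hq : side x z q <> 0).
    { intros E. apply side_zero in E; [|exact Hxz]. destruct E; subst q; tauto. }
    destruct (Rlt_dec 0 (side x z y * side x z q)) as [Hc|Hc].
    * left. now apply EU.
    * right. apply EV. set (a := side x z y) in *. set (b := side x z w) in *.
      set (e := side x z q) in *.
      assert (Ha : a <> 0) by (intros E; rewrite E in Hyw; lra).
      assert (Hae : a * e <> 0) by now apply Rmult_integral_contrapositive.
      apply Rmult_lt_reg_l with (a ^ 2); [now apply pow2_gt_0|].
      replace (a ^ 2 * (b * e)) with ((- (a * b)) * (- (a * e))) by ring.
      rewrite Rmult_0_r. apply Rmult_lt_0_compat; lra.
  + exists (h y). split; [exact Cy|]. apply EU. nra.
  + exists (h w). split; [exact Cw|]. apply EV. nra.
  + intros p Cp. destruct (HC p Cp) as (Sp & _). apply Hsig in Sp. destruct Sp as [q <-].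
    intros HUq HVq. apply EU in HUq. apply EV in HVq. nra.
Qed.

Context (c : Sphere 1).

Let gam (t : R) : X := h (stereo c t).

Lemma gam_neq t : gam t <> h c.
Proof. intros E. apply (stereo_neq c t). now apply Hh. Qed.

Lemma gam_injective s t : gam s = gam t -> s = t.
Proof. intros E. apply (stereo_injective c). now apply Hh. Qed.

(** The Ptolemy equality for three parameters and [h c], divided by the distances to [h c]. *)
Lemma gam_rho_additive t1 t2 t3 : t1 < t2 -> t2 < t3 ->
  rho del (h c) (gam t1) (gam t3) = rho del (h c) (gam t1) (gam t2) + rho del (h c) (gam t2) (gam t3).
Proof.
intros H12 H23.
assert (Hs : forall p, sigma (h p)) by (intros p; apply Hh; now exists p).
assert (Hne : forall s t, s < t -> gam s <> gam t)
  by (intros s t Hst E; apply gam_injective in E; lra).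
assert (E : pf d (gam t1) (gam t3) * pf d (gam t2) (h c) = pf d (gam t1) (gam t2) * pf d (gam t3) (h c)
  + pf d (gam t1) (h c) * pf d (gam t2) (gam t3)).
{ apply Hpt; try apply Hs; try apply gam_neq; try (apply Hne; lra).
  apply opposite_sides.
  - intros E. apply stereo_injective in E. lra.
  - rewrite side_stereo, side_stereo_base.
    assert (P1 : 0 < t1 ^ 2 + 1) by nra. assert (P2 : 0 < t2 ^ 2 + 1) by nra.
    assert (P3 : 0 < t3 ^ 2 + 1) by nra.
    assert (0 < 4 * (t3 - t1) * (t3 - t2) * (t2 - t1) / ((t1 ^ 2 + 1) * (t2 ^ 2 + 1) * (t3 ^ 2 + 1))).
    { apply Rdiv_lt_0_compat; repeat apply Rmult_lt_0_compat; lra. }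
    assert (0 < 4 * (t3 - t1) / ((t1 ^ 2 + 1) * (t3 ^ 2 + 1))).
    { apply Rdiv_lt_0_compat; repeat apply Rmult_lt_0_compat; lra. }
    nra. }
assert (Hp : forall t, 0 < pf d (gam t) (h c)).
{ intros t. pose proof (proj1 (proj2 Hdel) _ _ (gam_neq t)) as H. unfold del in H.
  pose proof (HW (gam t)). pose proof (HW (h c)).
  assert (HP : 0 < W (gam t) * W (h c)) by now apply Rmult_lt_0_compat.
  replace (pf d (gam t) (h c)) with (pf d (gam t) (h c) / (W (gam t) * W (h c)) * (W (gam t) * W (h c)))
    by (field; lra).
  now apply Rmult_lt_0_compat. }
pose proof (Hp t1). pose proof (Hp t2). pose proof (Hp t3).
pose proof (HW (gam t1)). pose proof (HW (gam t2)). pose proof (HW (gam t3)). pose proof (HW (h c)).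
unfold rho, del.
replace (pf d (gam t1) (gam t3)) with ((pf d (gam t1) (gam t2) * pf d (gam t3) (h c)
  + pf d (gam t1) (h c) * pf d (gam t2) (gam t3)) / pf d (gam t2) (h c))
  by (rewrite <- E; field; lra).
field. lra.
Qed.

Lemma gam_rho_additive_le t1 t2 t3 : t1 <= t2 -> t2 <= t3 ->
  rho del (h c) (gam t1) (gam t3) = rho del (h c) (gam t1) (gam t2) + rho del (h c) (gam t2) (gam t3).
Proof.
intros [H12| ->] [H23| <-]; rewrite ?(rho_refl del Hdel); try ring.
now apply gam_rho_additive.
Qed.

Lemma gam_rho_continuous t e : 0 < e -> exists eta, 0 < eta /\
  forall s, Rabs (s - t) < eta -> rho del (h c) (gam s) (gam t) < e.
Proof.
intros He. pose proof (rho_lt_radius_pos del Hdel (h c) (gam t) e (gam_neq t) He) as Hr.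
destruct (circle_continuous (stereo c t) _ Hr) as (eta & Heta & H).
exists (eta / 8). split; [lra|]. intros s Hs.
apply (rho_lt del Hdel); auto using gam_neq. apply H.
eapply Rle_lt_trans; [apply stereo_lipschitz|]. lra.
Qed.

(** For large parameters [gam t] approaches the remote point. Once [del (gam t) (h c)] is below [z],
    the numerator of [rho] is at least [D / 2] while [K] times the denominator is at most that. *)
Lemma gam_rho_unbounded t0 K : exists T, forall t, T <= Rabs t ->
  K <= rho del (h c) (gam t0) (gam t).
Proof.
set (D := del (gam t0) (h c)). assert (HD : 0 < D) by apply Hdel, gam_neq.
pose proof (Rabs_pos K) as HK.
set (z := Rmin (D / 2) (/ (2 * (Rabs K + 1)))).
assert (Hz : 0 < z) by (apply Rmin_glb_lt; [lra|apply Rinv_0_lt_compat; lra]).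
assert (Hz1 : z <= D / 2) by apply Rmin_l.
assert (Hz2 : 2 * (Rabs K + 1) * z <= 1).
{ apply Rle_trans with (2 * (Rabs K + 1) * / (2 * (Rabs K + 1))).
  - apply Rmult_le_compat_l; [lra|apply Rmin_r].
  - right; field; lra. }
destruct (circle_continuous c z Hz) as (eta & Heta & H).
exists (Rmax 1 (8 / eta + 1)). intros t Ht.
assert (H1 : 1 <= Rabs t) by (eapply Rle_trans; [apply Rmax_l|exact Ht]).
assert (H2 : 8 / eta + 1 <= Rabs t) by (eapply Rle_trans; [apply Rmax_r|exact Ht]).
assert (Hd : del (gam t) (h c) < z).
{ apply H. eapply Rle_lt_trans; [now apply stereo_at_infinity|].
  apply Rmult_lt_reg_r with (Rabs t); [lra|]. rewrite Rmult_assoc, Rinv_l, Rmult_1_r by lra.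
  apply Rlt_le_trans with (eta * (8 / eta + 1)).
  - replace (eta * (8 / eta + 1)) with (8 + eta) by (field; lra). lra.
  - apply Rmult_le_compat_l; lra. }
pose proof (proj1 (proj2 Hdel) _ _ (gam_neq t)) as Hp.
destruct Hdel as (_ & _ & _ & Htri & _).
pose proof (Htri (gam t0) (gam t) (h c)) as Ht'. fold D in Ht'.
unfold rho. fold D. set (y := del (gam t) (h c)) in *. set (x := del (gam t0) (gam t)) in *.
apply Rmult_le_reg_r with (D * y); [nra|].
unfold Rdiv. rewrite Rmult_assoc, Rinv_l, Rmult_1_r by nra.
pose proof (Rle_abs K). apply Rle_trans with (D / 2); [|lra].
apply Rle_trans with (Rabs K * (D * z)).
- apply Rle_trans with (Rabs K * (D * y)).
  + apply Rmult_le_compat_r; [nra|assumption].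
  + apply Rmult_le_compat_l; [lra|]. apply Rmult_le_compat_l; lra.
- nra.
Qed.

(** [phi] is signed arc length from [a]. It is continuous and unbounded on both sides, hence onto by
    the intermediate value theorem, and the line is [gam] after its inverse [psi]; the sign [k]
    orients it towards [b]. *)
Lemma circle_line a b : sigma a -> sigma b -> a <> b -> a <> h c -> b <> h c ->
  exists L, line del (h c) L /\ L 0 = a /\ L (rho del (h c) a b) = b.
Proof.
intros Ha Hb Hab Hac Hbc.
assert (Hs : forall x, sigma x -> x <> h c -> exists t, gam t = x).
{ intros x Hx Hxc. apply Hh in Hx. destruct Hx as [p <-].
  destruct (stereo_surjective c p) as [t Ht]; [congruence|].
  exists t. unfold gam. now rewrite Ht. }
destruct (Hs a Ha Hac) as [t0 E0]. destruct (Hs b Hb Hbc) as [tb Eb].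
set (r := fun s t => rho del (h c) (gam s) (gam t)).
assert (Hr0 : forall s t, 0 <= r s t) by (intros; apply (rho_nonneg del Hdel); apply gam_neq).
assert (Hrs : forall s t, r s t = r t s) by (intros; apply (rho_sym del Hdel)).
assert (Hadd : forall t1 t2 t3, t1 <= t2 -> t2 <= t3 -> r t1 t3 = r t1 t2 + r t2 t3)
  by apply gam_rho_additive_le.
set (phi := fun t => if Rle_dec t0 t then r t0 t else - r t0 t).
assert (Hle : forall s t, s <= t -> phi t - phi s = r s t).
{ intros s t Hst. unfold phi. destruct (Rle_dec t0 t), (Rle_dec t0 s); try lra.
  - rewrite (Hadd t0 s t) by lra. ring.
  - rewrite (Hadd s t0 t), (Hrs s t0) by lra. ring.
  - rewrite (Hrs t0 s), (Hadd s t t0), (Hrs t t0) by lra. ring. }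
assert (Hiso : forall s t, r s t = Rabs (phi s - phi t)).
{ intros s t. destruct (Rle_dec s t) as [H|H].
  - rewrite <- (Hle s t H), Rabs_minus_sym, Rabs_pos_eq; [reflexivity|]. rewrite (Hle s t H). apply Hr0.
  - rewrite Hrs, <- (Hle t s) by lra. rewrite Rabs_pos_eq; [reflexivity|]. rewrite Hle by lra. apply Hr0. }
assert (Hcont : continuity phi).
{ intros t e He. destruct (gam_rho_continuous t e He) as (eta & Heta & H).
  exists eta. split; [exact Heta|]. intros s [_ Hst]. simpl in *. unfold Rdist in *.
  rewrite <- Hiso. now apply H. }
assert (Hsurj : forall v, exists t, phi t = v).
{ intros v. destruct (gam_rho_unbounded t0 (Rabs v)) as [T HT]. fold gam in HT.
  set (B := Rabs T + Rabs t0 + 1).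
  pose proof (Rle_abs T). pose proof (Rabs_pos T). pose proof (Rabs_pos t0).
  assert (HB1 : Rabs v <= r t0 B).
  { apply HT. rewrite Rabs_pos_eq; unfold B; lra. }
  assert (HB2 : Rabs v <= r t0 (- B)).
  { apply HT. rewrite Rabs_Ropp, Rabs_pos_eq; unfold B; lra. }
  pose proof (Rle_abs t0). pose proof (Rle_abs (- t0)) as Hn. rewrite Rabs_Ropp in Hn.
  pose proof (Rle_abs v). pose proof (Rle_abs (- v)) as Hv. rewrite Rabs_Ropp in Hv.
  assert (P1 : v <= phi B).
  { unfold phi. destruct (Rle_dec t0 B) as [|Hc]; [lra|unfold B in Hc; lra]. }
  assert (P2 : phi (- B) <= v).
  { unfold phi. destruct (Rle_dec t0 (- B)) as [Hc|]; [unfold B in Hc; lra|lra]. }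
  destruct (IVT_gen phi (- B) B v Hcont) as (t & _ & Ht); [|now exists t].
  split; [eapply Rle_trans; [apply Rmin_l|exact P2]|eapply Rle_trans; [exact P1|apply Rmax_r]]. }
destruct (functional_choice _ Hsurj) as [psi Hpsi].
assert (Hinv : forall t, psi (phi t) = t).
{ intros t. apply gam_injective. apply NNPP; intros Hn.
  apply (rho_pos del Hdel (h c)) in Hn; try apply gam_neq.
  change (0 < r (psi (phi t)) t) in Hn. rewrite Hiso, Hpsi, Rminus_diag, Rabs_R0 in Hn. lra. }
assert (Hphi0 : phi t0 = 0).
{ unfold phi, r. rewrite (rho_refl del Hdel). destruct (Rle_dec t0 t0); ring. }
assert (Hline : forall k, k = 1 \/ k = -1 -> line del (h c) (fun s => gam (psi (k * s)))).
{ intros k Hk. split; [intros; apply gam_neq|]. intros s t.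
  change (r (psi (k * s)) (psi (k * t)) = Rabs (s - t)). rewrite Hiso, !Hpsi.
  rewrite <- Rmult_minus_distr_l, Rabs_mult. destruct Hk as [-> | ->].
  - rewrite Rabs_R1. ring.
  - rewrite Rabs_left by lra. ring. }
assert (HT : rho del (h c) a b = Rabs (phi tb)).
{ rewrite <- E0, <- Eb. change (r t0 tb = Rabs (phi tb)). rewrite Hiso, Hphi0, Rabs_minus_sym.
  f_equal; ring. }
assert (H0 : forall k, gam (psi (k * 0)) = a).
{ intros k. rewrite Rmult_0_r, <- Hphi0, Hinv. exact E0. }
rewrite HT. destruct (Rle_dec 0 (phi tb)) as [Hc|Hc].
- exists (fun s => gam (psi (1 * s))). split; [now apply Hline; left|]. split; [apply H0|].
  rewrite Rmult_1_l, Rabs_pos_eq, Hinv by assumption. exact Eb.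
- exists (fun s => gam (psi (-1 * s))). split; [now apply Hline; right|]. split; [apply H0|].
  rewrite Rabs_left by lra. replace (-1 * - phi tb) with (phi tb) by ring. rewrite Hinv. exact Eb.
Qed.

End OneCircle.

Lemma circles_give_lines :
  (forall a b c : X, a <> b -> a <> c -> b <> c ->
     exists sigma : X -> Prop, is_circle d Om sigma /\ sigma a /\ sigma b /\ sigma c) ->
  has_lines del.
Proof.
intros H a b c Hab Hac Hbc.
destruct (H a b c Hab Hac Hbc) as (sigma & [[h Hh] Hpt] & Ha & Hb & Hc).
apply (proj1 (proj2 Hh)) in Hc. destruct Hc as [p <-].
now apply (circle_line sigma h Hh Hpt).
Qed.

Lemma compact_metric_compact : is_compact d Om -> metric_compact del.
Proof.
intros H I U HU. apply H. intros i. now apply Hopen.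
Qed.

End Circles.

(** * A metric with finite values in the Moebius class *)

Section Remetrization.

Context {X : Type} (d : X -> X -> Rbar) (Om : X -> Prop).
Hypothesis Hext : ext_metric d Om.
Hypothesis Hptol : ptolemy d.

Hypothesis Htwo : exists a b : X, a <> b.

Lemma pf_finite x y : ~ Om x -> ~ Om y -> d x y = Finite (pf d x y) /\ pf d x y = real (d x y).
Proof.
intros Hx Hy. destruct Hext as (_ & H & _). destruct (H x y Hx Hy) as [r Hr].
unfold pf. rewrite Hr. now split.
Qed.

Lemma pf_refl x : pf d x x = 0.
Proof.
destruct Hext as (_ & H1 & _ & H2 & _ & _ & _ & H3). destruct (classic (Om x)) as [Hx|Hx].
- unfold pf. now rewrite H3.
- destruct (pf_finite x x Hx Hx) as [_ ->]. now apply H2.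
Qed.

Lemma pf_remote x w : ~ Om x -> Om w -> pf d x w = 1 /\ pf d w x = 1.
Proof.
intros Hx Hw. destruct Hext as (_ & _ & _ & _ & _ & _ & H & _).
destruct (H x w Hx Hw) as [H1 H2]. unfold pf. now rewrite H1, H2.
Qed.

Lemma pf_pos x y : x <> y -> 0 < pf d x y.
Proof.
intros Hxy. destruct (classic (Om x)) as [Hx|Hx]; destruct (classic (Om y)) as [Hy|Hy].
- exfalso. apply Hxy. now apply (proj1 Hext).
- destruct (pf_remote y x Hy Hx) as [_ ->]. lra.
- destruct (pf_remote x y Hx Hy) as [-> _]. lra.
- destruct (pf_finite x y Hx Hy) as [_ E]. rewrite E.
  destruct Hext as (_ & _ & H0 & H1 & _). specialize (H0 x y Hx Hy).
  destruct (Rle_lt_or_eq_dec _ _ H0) as [H|H]; [exact H|].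
  exfalso. apply Hxy. apply (H1 x y Hx Hy). lra.
Qed.

Lemma pf_sym x y : pf d x y = pf d y x.
Proof.
destruct (classic (x = y)) as [->|Hxy]; [reflexivity|].
destruct (classic (Om x)) as [Hx|Hx]; destruct (classic (Om y)) as [Hy|Hy].
- exfalso. apply Hxy. now apply (proj1 Hext).
- destruct (pf_remote y x Hy Hx) as [-> ->]. reflexivity.
- destruct (pf_remote x y Hx Hy) as [-> ->]. reflexivity.
- destruct (pf_finite x y Hx Hy) as [_ ->], (pf_finite y x Hy Hx) as [_ ->].
  destruct Hext as (_ & _ & _ & _ & H & _). now apply H.
Qed.

(* When there is a remote point [w], dividing by the distances to a finite point [o] and to [w]
   gives a bounded metric in the same Moebius class. *)
Lemma moebius_metric : exists W : X -> R, (forall x, 0 < W x) /\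
  ptolemaic (fun x y => pf d x y / (W x * W y)) /\
  forall U, metric_open (fun x y => pf d x y / (W x * W y)) U -> is_open d Om U.
Proof.
assert (Hgen : forall W : X -> R, (forall x, 0 < W x) ->
  (forall x y z, pf d x z * W y <= pf d x y * W z + pf d y z * W x) ->
  ptolemaic (fun x y => pf d x y / (W x * W y))).
{ intros W HW HWt. split; [|split; [|split; [|split]]].
  - intros x. rewrite pf_refl. unfold Rdiv. ring.
  - intros x y Hxy. apply Rdiv_lt_0_compat; [now apply pf_pos|].
    apply Rmult_lt_0_compat; apply HW.
  - intros x y. rewrite pf_sym, (Rmult_comm (W x)). reflexivity.
  - intros x y z. pose proof (HW x). pose proof (HW y). pose proof (HW z).
    assert (HP : 0 < W x * W y * W z) by (repeat apply Rmult_lt_0_compat; assumption).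
    apply Rmult_le_reg_r with (W x * W y * W z); [exact HP|].
    replace (pf d x z / (W x * W z) * (W x * W y * W z)) with (pf d x z * W y) by (field; lra).
    replace ((pf d x y / (W x * W y) + pf d y z / (W y * W z)) * (W x * W y * W z))
      with (pf d x y * W z + pf d y z * W x) by (field; lra).
    apply HWt.
  - intros x y z w. pose proof (HW x). pose proof (HW y). pose proof (HW z). pose proof (HW w).
    assert (HP : 0 < W x * W y * W z * W w) by (repeat apply Rmult_lt_0_compat; assumption).
    apply Rmult_le_reg_r with (W x * W y * W z * W w); [exact HP|].
    replace (pf d x y / (W x * W y) * (pf d z w / (W z * W w)) * (W x * W y * W z * W w))
      with (pf d x y * pf d z w) by (field; lra).
    replace ((pf d x z / (W x * W z) * (pf d y w / (W y * W w)) +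
      pf d x w / (W x * W w) * (pf d y z / (W y * W z))) * (W x * W y * W z * W w))
      with (pf d x z * pf d y w + pf d x w * pf d y z) by (field; lra).
    apply Hptol. }
destruct (classic (exists w, Om w)) as [[w Hw]|Hno].
- assert (Hfin : exists o, ~ Om o).
  { destruct Htwo as (a & b & Hab). apply NNPP; intros Hn. apply Hab.
    apply (proj1 Hext); apply NNPP; intros H; apply Hn; eauto. }
  destruct Hfin as [o Ho].
  + set (W := fun x => pf d x o + pf d x w).
    assert (Ww : W w = 1).
    { unfold W. rewrite pf_refl. destruct (pf_remote o w Ho Hw) as [_ ->]. ring. }
    assert (Wf : forall x, ~ Om x -> W x = pf d x o + 1).
    { intros x Hx. unfold W. destruct (pf_remote x w Hx Hw) as [-> _]. reflexivity. }
    assert (Hn : forall x y, 0 <= pf d x y).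
    { intros x y. destruct (classic (x = y)) as [->|E]; [rewrite pf_refl; lra|].
      apply Rlt_le, pf_pos, E. }
    assert (Hww : forall x, Om x -> x = w) by (intros x Hx; now apply (proj1 Hext)).
    assert (W1 : forall x, 1 <= W x).
    { intros x. destruct (classic (Om x)) as [Hx|Hx].
      - rewrite (Hww x Hx), Ww. lra.
      - rewrite (Wf x Hx). specialize (Hn x o). lra. }
    exists W. split; [|split].
    * intros x. specialize (W1 x). lra.
    (* The triangle inequality is the sum of the Ptolemy inequalities with fourth point [o] and with
       fourth point [w]. *)
    * apply Hgen; [intros x; specialize (W1 x); lra|]. intros x y z. unfold W.
      pose proof (Hptol x z y o) as H1. pose proof (Hptol x z y w) as H2.
      rewrite (pf_sym z y) in H1, H2. lra.
    * intros U HU p Hp. destruct (HU p Hp) as (r & Hr & HUr).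
      destruct (classic (Om p)) as [HOp|HOp].
      (* The new distance from a finite [y] to [w] is the inverse of [pf d o y + 1], which is below
         [r] outside the closed ball of radius [/ r] around [o]. *)
      -- rewrite (Hww p HOp) in *. exists o, (/ r). split; [exact Ho|]. right. split.
         ++ destruct Hext as (_ & _ & _ & _ & _ & _ & H & _).
            destruct (H o w Ho Hw) as [-> _]. exact I.
         ++ intros y Hy. apply HUr. destruct (classic (Om y)) as [HOy|HOy].
            ** rewrite (Hww y HOy), pf_refl. unfold Rdiv. rewrite Rmult_0_l. exact Hr.
            ** destruct (pf_finite o y Ho HOy) as [E _]. rewrite E in Hy. simpl in Hy.
               rewrite Ww, (Wf y HOy), (pf_sym y o). destruct (pf_remote y w HOy Hw) as [-> _].
               rewrite Rmult_1_r. apply Rmult_lt_reg_r with (pf d o y + 1).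
               { specialize (Hn o y). lra. }
               unfold Rdiv. rewrite Rmult_1_l, Rinv_l by (specialize (Hn o y); lra).
               apply Rmult_lt_compat_l with (r := r) in Hy; [|exact Hr].
               rewrite Rinv_r in Hy by lra. lra.
      -- exists p, r. split; [exact HOp|]. left. split.
         ++ destruct (pf_finite p p HOp HOp) as [E _]. rewrite E, pf_refl. exact Hr.
         ++ intros y Hy. apply HUr. destruct (classic (Om y)) as [HOy|HOy].
            ** exfalso. destruct Hext as (_ & _ & _ & _ & _ & _ & H & _).
               destruct (H p y HOp HOy) as [E _]. rewrite E in Hy. exact Hy.
            ** destruct (pf_finite p y HOp HOy) as [E _]. rewrite E in Hy. simpl in Hy.
               rewrite pf_sym. pose proof (W1 y). pose proof (W1 p).
               assert (1 <= W y * W p) by nra.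
               apply Rmult_lt_reg_r with (W y * W p); [lra|].
               unfold Rdiv. rewrite Rmult_assoc, Rinv_l, Rmult_1_r by lra. nra.
- exists (fun _ => 1). split; [intros; lra|]. split.
  + apply Hgen; [intros; lra|]. intros x y z.
    assert (Hx : ~ Om x) by eauto. assert (Hy : ~ Om y) by eauto. assert (Hz : ~ Om z) by eauto.
    destruct (pf_finite x y Hx Hy) as [_ ->], (pf_finite x z Hx Hz) as [_ ->],
      (pf_finite y z Hy Hz) as [_ ->].
    rewrite !Rmult_1_r. destruct Hext as (_ & _ & _ & _ & _ & H & _). now apply H.
  + intros U HU p Hp. destruct (HU p Hp) as (r & Hr & HUr).
    assert (HOp : ~ Om p) by eauto. exists p, r. split; [exact HOp|]. left. split.
    * destruct (pf_finite p p HOp HOp) as [E _]. rewrite E, pf_refl. exact Hr.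
    * intros y Hy. apply HUr. assert (HOy : ~ Om y) by eauto.
      destruct (pf_finite p y HOp HOy) as [E _]. rewrite E in Hy. simpl in Hy.
      rewrite pf_sym. lra.
Qed.

End Remetrization.

(** * Stereographic projection *)

Definition sqnorm (m : nat) (a : nat -> R) : R := sum_f_R0 (fun i => a i ^ 2) m.

Lemma sqnorm_nonneg m a : 0 <= sqnorm m a.
Proof.
induction m as [|m IH]; unfold sqnorm in *; rewrite ?tech5; [apply pow2_ge_0|].
pose proof (pow2_ge_0 (a (S m))). lra.
Qed.

Lemma sqnorm_comb m s t a b : sqnorm m (fun i => s * a i + t * b i)
  = s ^ 2 * sqnorm m a + 2 * s * t * sum_f_R0 (fun i => a i * b i) m + t ^ 2 * sqnorm m b.
Proof.
unfold sqnorm. induction m as [|m IH]; [simpl; ring|]. rewrite !tech5, IH. ring.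
Qed.

(** Indices 0 to [m] are horizontal and [S m] is the axis of the pole [north m], so R^(m+1) lands in
    the sphere of dimension [S m]. *)
Definition unstereo (m : nat) (a : nat -> R) (i : nat) : R :=
  if le_dec i m then 2 / (1 + sqnorm m a) * a i
  else if Nat.eq_dec i (S m) then (sqnorm m a - 1) / (1 + sqnorm m a) else 0.

Definition north (m : nat) (i : nat) : R := if Nat.eq_dec i (S m) then 1 else 0.

Lemma unstereo_low m a i : (i <= m)%nat -> unstereo m a i = 2 / (1 + sqnorm m a) * a i.
Proof. intros H. unfold unstereo. destruct (le_dec i m); [reflexivity|lia]. Qed.

Lemma unstereo_top m a : unstereo m a (S m) = (sqnorm m a - 1) / (1 + sqnorm m a).
Proof.
unfold unstereo. destruct (le_dec (S m) m); [lia|].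
destruct (Nat.eq_dec (S m) (S m)); [reflexivity|lia].
Qed.

Lemma north_low m i : (i <= m)%nat -> north m i = 0.
Proof. intros H. unfold north. destruct (Nat.eq_dec i (S m)); [lia|reflexivity]. Qed.

Lemma north_top m : north m (S m) = 1.
Proof. unfold north. destruct (Nat.eq_dec (S m) (S m)); [reflexivity|lia]. Qed.

Lemma sqnorm_zero m : sqnorm m (fun _ => 0) = 0.
Proof. unfold sqnorm. induction m as [|m IH]; [simpl|rewrite tech5, IH]; ring. Qed.

Lemma sqnorm_unstereo m a (u : nat -> R) : (forall i, (i <= m)%nat -> u i = unstereo m a i) ->
  sqnorm m u = 4 * sqnorm m a / (1 + sqnorm m a) ^ 2.
Proof.
intros Hu. pose proof (sqnorm_nonneg m a).
transitivity (sqnorm m (fun i => 2 / (1 + sqnorm m a) * a i + 0 * 0)).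
- unfold sqnorm at 1 2. apply sum_eq. intros i Hi. rewrite Hu, unstereo_low by assumption. f_equal. ring.
- rewrite (sqnorm_comb m _ _ a (fun _ => 0)). field. lra.
Qed.

Lemma unstereo_sphere m a : sphere_pt (S m) (unstereo m a).
Proof.
split.
- intros i Hi. unfold unstereo. destruct (le_dec i m); [lia|].
  destruct (Nat.eq_dec i (S m)); [lia|reflexivity].
- rewrite tech5. fold (sqnorm m (unstereo m a)).
  rewrite (sqnorm_unstereo m a) by reflexivity. rewrite unstereo_top.
  pose proof (sqnorm_nonneg m a). field. lra.
Qed.

Lemma north_sphere m : sphere_pt (S m) (north m).
Proof.
split.
- intros i Hi. unfold north. destruct (Nat.eq_dec i (S m)); [lia|reflexivity].
- rewrite tech5. rewrite north_top.
  rewrite (sum_eq _ (fun _ => 0 ^ 2)) by (intros i Hi; now rewrite north_low).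
  fold (sqnorm m (fun _ => 0)). rewrite sqnorm_zero. ring.
Qed.

Lemma chordal_unstereo m a b : sum_f_R0 (fun i => (unstereo m a i - unstereo m b i) ^ 2) (S m)
  = 4 * sqnorm m (fun i => a i - b i) / ((1 + sqnorm m a) * (1 + sqnorm m b)).
Proof.
pose proof (sqnorm_nonneg m a). pose proof (sqnorm_nonneg m b).
rewrite tech5. rewrite !unstereo_top.
rewrite (sum_eq _ (fun i => (2 / (1 + sqnorm m a) * a i + - (2 / (1 + sqnorm m b)) * b i) ^ 2))
  by (intros i Hi; rewrite !unstereo_low by assumption; ring).
pose proof (sqnorm_comb m (2 / (1 + sqnorm m a)) (- (2 / (1 + sqnorm m b))) a b) as E1.
unfold sqnorm at 1 in E1. rewrite E1.
assert (E2 : sqnorm m (fun i => a i - b i) = sqnorm m (fun i => 1 * a i + -1 * b i)).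
{ unfold sqnorm. apply sum_eq. intros i _. f_equal. ring. }
rewrite E2, sqnorm_comb. field. lra.
Qed.

Lemma chordal_north m a : sum_f_R0 (fun i => (unstereo m a i - north m i) ^ 2) (S m)
  = 4 / (1 + sqnorm m a).
Proof.
pose proof (sqnorm_nonneg m a). rewrite tech5. rewrite unstereo_top, north_top.
rewrite (sum_eq _ (fun i => unstereo m a i ^ 2))
  by (intros i Hi; rewrite north_low by assumption; f_equal; ring).
fold (sqnorm m (unstereo m a)). rewrite (sqnorm_unstereo m a) by reflexivity. field. lra.
Qed.

(** Stated for every [b] that agrees with [a] up to index [m], because [euclidean_coordinates]
    prescribes exactly these coordinates. *)
Lemma unstereo_surjective m v : sphere_pt (S m) v -> v (S m) <> 1 ->
  exists a, forall b, (forall i, (i <= m)%nat -> b i = a i) ->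
    forall i, (i <= S m)%nat -> unstereo m b i = v i.
Proof.
intros [Hv Hs] H1. rewrite tech5 in Hs. fold (sqnorm m v) in Hs.
pose proof (sqnorm_nonneg m v) as H0. set (z := v (S m)) in *.
assert (Hz : z < 1) by nra.
exists (fun i => / (1 - z) * v i). intros b Hb.
assert (E : sqnorm m b = (1 + z) / (1 - z)).
{ transitivity (sqnorm m (fun i => / (1 - z) * v i + 0 * 0)).
  - unfold sqnorm. apply sum_eq. intros i Hi. rewrite Hb by assumption. f_equal. ring.
  - rewrite (sqnorm_comb m _ _ v (fun _ => 0)).
    replace (sqnorm m v) with ((1 - z) * (1 + z)) by lra. field. lra. }
intros i Hi. destruct (Nat.eq_dec i (S m)) as [->|Hne].
- rewrite unstereo_top, E. fold z. field. lra.
- rewrite unstereo_low, Hb, E by lia. field. lra.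
Qed.

Lemma north_unique m v : sphere_pt (S m) v -> v (S m) = 1 ->
  forall i, (i <= S m)%nat -> north m i = v i.
Proof.
intros [Hv Hs] H1 i Hi. rewrite tech5 in Hs. rewrite H1 in Hs.
destruct (Nat.eq_dec i (S m)) as [->|Hne]; [now rewrite north_top|].
rewrite north_low by lia.
assert (K : forall k, (i <= k)%nat -> v i ^ 2 <= sqnorm k v).
{ intros k Hk. induction Hk as [|k Hk IH].
  - destruct i as [|j]; unfold sqnorm; [simpl; lra|]. rewrite tech5.
    pose proof (sqnorm_nonneg j v). unfold sqnorm in *. lra.
  - unfold sqnorm in *. rewrite tech5. pose proof (pow2_ge_0 (v (S k))). lra. }
specialize (K m ltac:(lia)). unfold sqnorm in K. nra.
Qed.

(** Every entry of a cross ratio triple involves each of the four points once, so all three entries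
    acquire the same factor. *)
Lemma moebius_of_conformal {X : Type} (d : X -> X -> Rbar) (n : nat) (f : X -> Sphere n)
  (k : R) (u : X -> R) : 0 < k -> (forall x, 0 < u x) ->
  (forall x y, x <> y -> 0 < pf d x y) ->
  (forall x y, pf (d0 n) (f x) (f y) = k * pf d x y * u x * u y) ->
  is_moebius d (d0 n) f.
Proof.
intros Hk Hu Hpos H. split.
- intros a b E. apply NNPP; intros Hab. specialize (Hpos a b Hab).
  assert (H0 : pf (d0 n) (f a) (f b) = 0).
  { rewrite E. unfold pf, d0.
    rewrite (sum_eq _ (fun _ => 0 ^ 2)) by (intros; f_equal; ring).
    fold (sqnorm n (fun _ => 0)). rewrite sqnorm_zero. apply sqrt_0. }
  rewrite H in H0. pose proof (Hu a). pose proof (Hu b).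
  assert (0 < k * pf d a b * u a * u b) by (repeat apply Rmult_lt_0_compat; assumption). lra.
- intros x y z w _. unfold crt, rp2_eq. rewrite !H.
  exists (k ^ 2 * (u x * u y * u z * u w)).
  assert (0 < k ^ 2 * (u x * u y * u z * u w)).
  { apply Rmult_lt_0_compat; [now apply pow_lt|]. repeat apply Rmult_lt_0_compat; apply Hu. }
  repeat split; [lra|ring..].
Qed.

Theorem theorem1p2 (X : Type) (d : X -> X -> Rbar) (Om : X -> Prop) :
  ext_metric d Om ->
  is_compact d Om ->
  ptolemy d ->
  (exists a b c : X, a <> b /\ a <> c /\ b <> c) ->
  (forall a b c : X, a <> b -> a <> c -> b <> c ->
     exists sigma : X -> Prop, is_circle d Om sigma /\ sigma a /\ sigma b /\ sigma c) ->
  exists n : nat, (1 <= n)%nat /\ moebius_equivalent d (d0 n).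
Proof.
intros Hext Hcomp Hptol Hthree Hcirc.
assert (Htwo : exists a b : X, a <> b) by (destruct Hthree as (a & b & _ & H & _); eauto).
destruct (moebius_metric d Om Hext Hptol Htwo) as (W & HW & Hdel & Hopen).
set (del := fun x y => pf d x y / (W x * W y)) in *.
destruct (euclidean_coordinates del Hdel (circles_give_lines d Om W HW Hdel Hopen Hcirc) Hthree
  (compact_metric_compact d Om W Hopen Hcomp)) as (w & m & c & Hc & Hsurj).
set (N := fun x => sqnorm m (fun i => c i x)).
assert (HN : forall x, 0 <= N x) by (intros; apply sqnorm_nonneg).
exists (S m). split; [lia|].
set (f := fun x => if excluded_middle_informative (x = w)
  then exist _ _ (north_sphere m) : Sphere (S m)
  else exist _ _ (unstereo_sphere m (fun i => c i x))).
(* The conformal factor of [f] with respect to [del]: [/ del x w] passes from [del] to [rho del w],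
   the square root comes from [chordal_unstereo], and the value 1 at [w] fits [chordal_north]. *)
set (v := fun x => if excluded_middle_informative (x = w) then 1
  else / (del x w * sqrt (1 + N x))).
assert (Hs : forall x, 0 < sqrt (1 + N x)) by (intros x; apply sqrt_lt_R0; specialize (HN x); lra).
assert (Hss : forall x, sqrt (1 + N x) ^ 2 = 1 + N x)
  by (intros x; apply pow2_sqrt; specialize (HN x); lra).
assert (Hv : forall x, 0 < v x).
{ intros x. unfold v. destruct (excluded_middle_informative (x = w)) as [E|E]; [lra|].
  apply Rinv_0_lt_compat, Rmult_lt_0_compat; [now apply Hdel|apply Hs]. }
assert (Hdist : forall x y, pf (d0 (S m)) (f x) (f y) = 2 * del x y * v x * v y).
{ assert (Hnorth : forall x (E : x <> w), sqrt (4 / (1 + N x)) = 2 * del x w * / (del x w * sqrt (1 + N x))).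
  { intros x E. assert (Hp : 0 < del x w) by now apply Hdel.
    replace (4 / (1 + N x)) with ((2 * / sqrt (1 + N x)) ^ 2).
    - rewrite sqrt_pow2.
      + field. specialize (Hs x). lra.
      + apply Rlt_le, Rmult_lt_0_compat; [lra|apply Rinv_0_lt_compat, Hs].
    - rewrite Rpow_mult_distr, pow_inv, Hss. field. specialize (HN x). lra. }
  intros x y. unfold f, v. unfold pf at 1, d0.
  destruct (excluded_middle_informative (x = w)) as [Ex|Ex];
    destruct (excluded_middle_informative (y = w)) as [Ey|Ey]; simpl proj1_sig.
  - subst x y. rewrite (proj1 Hdel).
    rewrite (sum_eq _ (fun _ => 0 ^ 2)) by (intros; f_equal; ring).
    fold (sqnorm (S m) (fun _ => 0)). rewrite sqnorm_zero, sqrt_0. ring.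
  - subst x. rewrite (sum_eq _ (fun i => (unstereo m (fun i => c i y) i - north m i) ^ 2))
      by (intros; ring).
    rewrite chordal_north. fold (N y). rewrite (Hnorth y Ey), (del_sym del Hdel w y). ring.
  - subst y. rewrite chordal_north. fold (N x). rewrite (Hnorth x Ex). ring.
  - rewrite chordal_unstereo. unfold sqnorm at 1. rewrite <- (Hc x y Ex Ey). fold (N x) (N y).
    assert (Hpx : 0 < del x w) by now apply Hdel. assert (Hpy : 0 < del y w) by now apply Hdel.
    pose proof (Hs x). pose proof (Hs y).
    replace (4 * rho del w x y ^ 2 / ((1 + N x) * (1 + N y)))
      with ((2 * rho del w x y * / sqrt (1 + N x) * / sqrt (1 + N y)) ^ 2).
    + rewrite sqrt_pow2.
      * unfold rho. field. lra.
      * pose proof (rho_nonneg del Hdel w x y Ex Ey).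
        assert (0 < / sqrt (1 + N x)) by now apply Rinv_0_lt_compat.
        assert (0 < / sqrt (1 + N y)) by now apply Rinv_0_lt_compat.
        apply Rmult_le_pos; [apply Rmult_le_pos|]; lra.
    + rewrite !Rpow_mult_distr, !pow_inv, !Hss. field.
      pose proof (HN x). pose proof (HN y). lra. }
exists f. split.
- intros [p Hp]. destruct (Req_dec (p (S m)) 1) as [E|E].
  + exists w. unfold f. destruct (excluded_middle_informative (w = w)) as [_|]; [|contradiction].
    apply sphere_ext. simpl proj1_sig. now apply north_unique.
  + destruct (unstereo_surjective m p Hp E) as [a Ha]. destruct (Hsurj a) as (x & Hx & Hxa).
    exists x. unfold f. destruct (excluded_middle_informative (x = w)) as [|_]; [contradiction|].
    apply sphere_ext. simpl proj1_sig. now apply Ha.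
- apply (moebius_of_conformal d (S m) f 2 (fun x => v x / W x)).
  + lra.
  + intros x. now apply Rdiv_lt_0_compat.
  + now apply (pf_pos d Om).
  + intros x y. rewrite Hdist. unfold del. pose proof (HW x). pose proof (HW y). field. lra.
Qed.
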